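(* Let $G$ be a countable locally finite abelian group (written additively). The following statements are equivalent. (i) $2G=\{2g:g\in G\}$ is infinite. (ii) For every filtration $G_\bullet$ of $G$ by finite subgroups and all real $0\le\alpha\le\beta\le1$, there exists $A\subseteq G$ such that $\underline d_{G_\bullet}(\mathcal P(A))=\alpha$ and $\overline d_{G_\bullet}(\mathcal P(A))=\beta$. (iii) For every filtration $G_\bullet$ of $G$ by finite subgroups and all real $0\le\alpha\le\beta\le1$, there exists $A\subseteq G$ such that $\mathcal L_{G_\bullet}(A)=[\alpha,\beta]$.
   Context: An abelian group is locally finite if every finitely generated subgroup is finite. A filtration $G_\bullet=(G_i)_{i\ge1}$ of $G$ by finite subgroups is a chain $G_1\le G_2\le\cdots$ of finite subgroups with $\bigcup_{i\ge1}G_i=G$. For $A\subseteq G$, $\mathcal P(A):=\{\sum_{a\in F}a : F\subseteq A,\ |F|<\infty\}$ is the set of finite subset sums, including the empty sum $0$. For $S\subseteq G$: $d_i^{G_\bullet}(S):=|S\cap G_i|/|G_i|$, $\underline d_{G_\bullet}(S):=\liminf_{i\to\infty}d_i^{G_\bullet}(S)$, $\overline d_{G_\bullet}(S):=\limsup_{i\to\infty}d_i^{G_\bullet}(S)$. $\mathcal L_{G_\bullet}(A)$ is the set of all $\gamma\in[0,1]$ such that $\lim_{\ell\to\infty}d_{i_\ell}^{G_\bullet}(\mathcal P(A))=\gamma$ for some $i_1<i_2<\cdots$. *)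

(* Defs.v *)
From HB Require Import structures.
From mathcomp Require Import all_boot all_order all_algebra finmap.
From mathcomp Require Import all_classical all_reals all_analysis.
Set Implicit Arguments.
Unset Strict Implicit.
Unset Printing Implicit Defensive.
Import Order.TTheory GRing.Theory Num.Theory.
Import numFieldNormedType.Exports.
Local Open Scope classical_set_scope.
Local Open Scope ring_scope.

Definition is_subgroup (G : zmodType) (H : set G) : Prop := zmod_closed (mem H).

Definition generated_subgroup (G : zmodType) (S : set G) : set G :=
  smallest (@is_subgroup G) S.

Definition locally_finite (G : zmodType) : Prop :=
  forall S : set G, finite_set S -> finite_set (generated_subgroup S).

(* The chain G_1 <= G_2 <= ... is indexed from 0: [Gs i] is G_(i+1).  Limits,
   liminf, limsup and subsequential limits are unaffected by this shift. *)
Definition filtration (G : zmodType) (Gs : nat -> set G) : Prop :=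
  [/\ forall i, is_subgroup (Gs i),
      forall i, finite_set (Gs i),
      forall i, Gs i `<=` Gs i.+1
    & \bigcup_i Gs i = [set: G]].

Definition subset_sums (G : zmodType) (A : set G) : set G :=
  [set \sum_(a <- F) a | F in [set F : {fset G} | [set` F] `<=` A]].

(* [fset_set] is the junk value [fset0] on infinite sets; it is only relevant
   here for finite [Gs i], as in a filtration. *)
Definition density (R : realType) (G : zmodType) (Gs : nat -> set G)
    (S : set G) : R^nat :=
  fun i => #|` fset_set (S `&` Gs i)|%:R / #|` fset_set (Gs i)|%:R.

(* [limn_inf] and [limn_sup] are meaningful only for bounded sequences; here
   the densities lie in [0, 1]. *)
Definition lower_density (R : realType) (G : zmodType) (Gs : nat -> set G)
    (S : set G) : R := limn_inf (density R Gs S).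

Definition upper_density (R : realType) (G : zmodType) (Gs : nat -> set G)
    (S : set G) : R := limn_sup (density R Gs S).

Definition limit_densities (R : realType) (G : zmodType) (Gs : nat -> set G)
    (A : set G) : set R :=
  [set gamma : R | 0 <= gamma <= 1 /\
    exists2 i : nat -> nat, increasing_seq i &
      density R Gs (subset_sums A) (i l) @[l --> \oo] --> gamma].
Arguments limit_densities R {G} Gs A _.

(* Main.v *)
(* If 2G is finite, no A has lower density 0 and upper density 1: either A
   generates G, and then P(A) + 2G = G makes the densities at least 1/|2G|, or
   P(A) lies in a proper subgroup and the densities are eventually at most 1/2.

   If 2G is infinite, A is the union of finite sets A_k contained in G_n, n = n(k),
   each extended by elements outside G_n so that P(A_(k+1)) meets G_n in P(A_k).
   The new elements lie in a finite subgroup L containing G_n and are followed by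
   neutral ones, whose subset sums form a transversal of L in some G_m and thus
   leave the density in L unchanged.  Repeated small extensions carry the density
   down through [alpha, beta] and up again with ever smaller errors.

   Suppose first that every finite subgroup H admits elements x of arbitrarily
   large order r modulo H.  Multiples of x whose subset sums form an interval
   -tx, ..., 0 with slightly fewer than r terms lower the density by a small
   amount.  To raise it, take an interval slightly longer than r / 2 and adjoin
   jx + z, where z in H is chosen with |S /\ (S + z)| |H| <= |S|^2 for S = P(A_k);
   such z exists by averaging.

   Otherwise G has bounded exponent, and there is q >= 3 (an odd prime or 4) such
   that every finite subgroup is independent of some cyclic group of order q.  Such
   a group has a list with subset sums all of it but one element w.  Adjoining
   w' - w + h produces two translates of S over all cosets but two, which
   iterates to subset sums missing 2^k out of q^(k+1) elements and hence to small
   descents.  For ascents one keeps P(A_k) = Q + W with W in a subgroup E, and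
   enlarges only W inside E, so that the density never exceeds that of Q + E. *)
Require Import Defs.
From HB Require Import structures.
From mathcomp Require Import all_boot all_order all_algebra finmap.
From mathcomp Require Import all_classical all_reals all_analysis.
From mathcomp Require Import zify ring lra.
Set Implicit Arguments.
Unset Strict Implicit.
Unset Printing Implicit Defensive.
Import Order.TTheory GRing.Theory Num.Theory.
Import numFieldNormedType.Exports.
Local Open Scope classical_set_scope.
Local Open Scope ring_scope.

(** * Sumsets and subset sums *)

(** The filtration is arbitrary: at the levels between n and m a subgroup [Hs j] may meet the new
    part L in almost any way, so a subset of L with the right density in L may have a wrong one in L
    /\ Hs j. Every move is therefore controlled coset by coset over an earlier subgroup, and the
    density at level j is an average over the cosets inside [Hs j]. For multiples of x the
    exceptional cosets are arranged to be among x, 2x, ..., tx: a segment that starts right after 0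
    contains at most t / s multiples of s, which fails for segments elsewhere. Since elements must
    be distinct, intervals arise from the multipliers 1, ..., n, whence triangular numbers and the
    need for gaps of order sqrt r to be small against r / K.

    In a group of exponent 2 every P(A) is a subgroup, so nothing flexible can be built from
    elements of order 2; the infinity of 2G serves to provide q >= 3. A third element of the cyclic
    group keeps the defective cosets away from 0. For fixed q an ascent cannot be made small, and
    only the ceiling Q + E, brought close to beta beforehand by small descents, prevents it from
    overshooting. *)

Section Sumsets.
Variable G : zmodType.
Implicit Types (X Y Z H K L M T : {fset G}) (x y z g : G) (s : seq G).
Local Open Scope fset_scope.
Local Open Scope ring_scope.

Definition sumset X Y : {fset G} := [fset x + y | x in X, y in Y].

Lemma sumsetP X Y z :
  reflect (exists x y, [/\ x \in X, y \in Y & z = x + y]) (z \in sumset X Y).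
Proof.
apply: (iffP (imfset2P _ _ _ _ _)) => [[x xX [y yY ->]]|[x [y [xX yY ->]]]].
  by exists x, y.
by exists x => //; exists y.
Qed.

Lemma mem_sumset X Y x y : x \in X -> y \in Y -> x + y \in sumset X Y.
Proof. by move=> xX yY; apply/sumsetP; exists x, y. Qed.

Lemma sumsetC X Y : sumset X Y = sumset Y X.
Proof.
by apply/fsetP => z; apply/sumsetP/sumsetP => -[x [y [xX yY ->]]];
  exists y, x; rewrite addrC.
Qed.

Lemma sumsetA X Y Z : sumset X (sumset Y Z) = sumset (sumset X Y) Z.
Proof.
apply/fsetP => w; apply/sumsetP/sumsetP.
  move=> [x [yz [xX /sumsetP[y [z [yY zZ ->]]] ->]]].
  by exists (x + y), z; rewrite addrA mem_sumset.
move=> [xy [z [/sumsetP[x [y [xX yY ->]]] zZ ->]]].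
by exists x, (y + z); rewrite addrA mem_sumset.
Qed.

Lemma sumset0l X : sumset [fset 0] X = X.
Proof.
apply/fsetP => z; apply/sumsetP/idP.
  by move=> [x [y [/fset1P -> yX ->]]]; rewrite add0r.
by move=> zX; exists 0, z; rewrite inE eqxx add0r.
Qed.

Lemma sumset0r X : sumset X [fset 0] = X.
Proof. by rewrite sumsetC sumset0l. Qed.

Lemma sumsetS X X' Y Y' :
  X `<=` X' -> Y `<=` Y' -> sumset X Y `<=` sumset X' Y'.
Proof.
move=> /fsubsetP sX /fsubsetP sY; apply/fsubsetP => z /sumsetP[x [y [xX yY ->]]].
by rewrite mem_sumset ?sX ?sY.
Qed.

Lemma sumsetUl X X' Y : sumset (X `|` X') Y = sumset X Y `|` sumset X' Y.
Proof.
apply/fsetP => z; rewrite in_fsetU; apply/sumsetP/orP.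
  move=> [x [y [/fsetUP[] xX yY ->]]]; [left|right]; exact: mem_sumset.
move=> [] /sumsetP[x [y [xX yY ->]]]; exists x, y.
  by rewrite in_fsetU xX.
by rewrite in_fsetU xX orbT.
Qed.

Lemma mem_sumset1 x Y z : (z \in sumset [fset x] Y) = (z - x \in Y).
Proof.
apply/sumsetP/idP.
  by move=> [x' [y [/fset1P -> yY ->]]]; rewrite addrAC subrr add0r.
by move=> zY; exists x, (z - x); rewrite inE eqxx subrKC.
Qed.

(** Partial transversal: at most one element of [T] in each coset of [H]. *)
Definition inj_mod H T := forall t t', t \in T -> t' \in T -> t - t' \in H -> t = t'.

Definition subgroup H := (0 \in H) /\ (forall x y, x \in H -> y \in H -> x - y \in H).

Lemma sg0 H : subgroup H -> 0 \in H. Proof. by case. Qed.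

Lemma sgB H x y : subgroup H -> x \in H -> y \in H -> x - y \in H.
Proof. by case=> _; exact. Qed.

Lemma sgN H x : subgroup H -> x \in H -> - x \in H.
Proof. by move=> sH xH; rewrite -sub0r sgB ?sg0. Qed.

Lemma sgNE H x : subgroup H -> (- x \in H) = (x \in H).
Proof. by move=> sH; apply/idP/idP => [/(sgN sH)|/(sgN sH)//]; rewrite opprK. Qed.

Lemma sgD H x y : subgroup H -> x \in H -> y \in H -> x + y \in H.
Proof. by move=> sH xH yH; rewrite -[y]opprK sgB// sgN. Qed.

Lemma sgDr H x y : subgroup H -> x \in H -> (x + y \in H) = (y \in H).
Proof.
move=> sH xH; apply/idP/idP => [xyH|]; last exact: sgD.
by rewrite -(addKr x y) addrC sgB.
Qed.

Lemma sgDl H x y : subgroup H -> y \in H -> (x + y \in H) = (x \in H).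
Proof. by move=> sH yH; rewrite addrC sgDr. Qed.

Lemma sgMn H x n : subgroup H -> x \in H -> x *+ n \in H.
Proof.
move=> sH xH; elim: n => [|n IH]; first by rewrite mulr0n sg0.
by rewrite mulrS sgD.
Qed.

Lemma sgMz H x (n : int) : subgroup H -> x \in H -> x *~ n \in H.
Proof.
by move=> sH xH; case: n => n; rewrite ?NegzE ?mulrNz -?pmulrn ?sgN// sgMn.
Qed.

Lemma sg1 : subgroup [fset 0].
Proof.
split; first by rewrite inE.
by move=> x y /fset1P -> /fset1P ->; rewrite subr0 inE.
Qed.

Lemma sgI H K : subgroup H -> subgroup K -> subgroup (H `&` K).
Proof.
move=> sH sK; split; first by rewrite in_fsetI !sg0.
by move=> x y /fsetIP[xH xK] /fsetIP[yH yK]; rewrite in_fsetI !sgB.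
Qed.

Lemma sg_sumset H K : subgroup H -> subgroup K -> subgroup (sumset H K).
Proof.
move=> sH sK; split; first by rewrite -(addr0 0) mem_sumset ?sg0.
move=> _ _ /sumsetP[x [y [xH yK ->]]] /sumsetP[x' [y' [xH' yK' ->]]].
by rewrite opprD addrACA mem_sumset ?sgB.
Qed.

Lemma sumset_sub H X Y : subgroup H -> X `<=` H -> Y `<=` H -> sumset X Y `<=` H.
Proof.
move=> sH /fsubsetP XH /fsubsetP YH; apply/fsubsetP => z.
by move=> /sumsetP[x [y [/XH xH /YH yH ->]]]; exact: sgD.
Qed.

Lemma sumset_subl X Y : 0 \in Y -> X `<=` sumset X Y.
Proof. by move=> Y0; apply/fsubsetP => x xX; rewrite -[x]addr0 mem_sumset. Qed.

Lemma sumset_subr X Y : 0 \in X -> Y `<=` sumset X Y.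
Proof. by rewrite sumsetC; exact: sumset_subl. Qed.

Lemma card_gt0 H x : x \in H -> (0 < #|` H|)%N.
Proof. by rewrite cardfs_gt0 => xH; apply/fset0Pn; exists x. Qed.

Lemma card_sumset X T : {in X & X, forall x x', {in T & T, forall t t',
    x + t = x' + t' -> t = t'}} -> #|` sumset X T| = (#|` X| * #|` T|)%N.
Proof.
move=> inj; rewrite -(size_allpairs (fun x t => x + t)); apply/perm_size/uniq_perm.
- exact: fset_uniq.
- apply: allpairs_uniq; rewrite ?fset_uniq// => -[x t] [x' t'] /=.
  move=> /allpairsP[[a b] /= [aX bT [-> ->]]] /allpairsP[[a' b'] /= [aX' bT' [-> ->]]] E.
  have E' := inj _ _ aX aX' _ _ bT bT' E.
  by move: E; rewrite E' => /addIr ->.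
- move=> z; apply/sumsetP/allpairsP => [[x [y [xX yY ->]]]|[[x y] [xX yY ->]]].
    by exists (x, y).
  by exists x, y.
Qed.

Lemma card_sumset_le X T : (#|` sumset X T| <= #|` X| * #|` T|)%N.
Proof.
rewrite -(size_allpairs (fun x t => x + t)); apply: uniq_leq_size (fset_uniq _) _.
by move=> _ /sumsetP[x [t [xX tT ->]]]; apply: allpairs_f.
Qed.

Lemma card_sumset_mod H X T : subgroup H -> X `<=` H -> inj_mod H T ->
  #|` sumset X T| = (#|` X| * #|` T|)%N.
Proof.
move=> sH /fsubsetP XH HT; apply: card_sumset => x x' /XH xH /XH xH' t t' tT tT' E.
apply: HT => //; have -> : t - t' = x' - x.
  by apply/eqP; rewrite subr_eq addrAC -E addrAC subrr add0r.
exact: sgB.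
Qed.

Lemma card_sumset1 x X : #|` sumset [fset x] X| = #|` X|.
Proof.
rewrite card_sumset ?cardfs1 ?mul1n// => y y' /fset1P -> /fset1P -> t t' _ _.
exact: addrI.
Qed.

(* Double counting of the pairs [(x, u)] with [u \in U `&` M] and [x - u \in H]. *)
Lemma sum_coset_card H M U : subgroup H -> subgroup M -> H `<=` M ->
  (\sum_(x <- M) #|` U `&` sumset [fset x] H| = #|` H| * #|` U `&` M|)%N.
Proof.
move=> sH sM /fsubsetP HM.
have E x : x \in M -> #|` U `&` sumset [fset x] H| =
    (\sum_(u <- U `&` M) ((u - x)%R \in H))%N.
  move=> xM; rewrite -sum1_size /= -big_mkcond /= -[RHS]big_filter.
  rewrite (perm_big [seq u <- U `&` M | u - x \in H]) ?big_filter//.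
  apply: uniq_perm; rewrite ?fset_uniq ?filter_uniq ?fset_uniq// => u.
  rewrite mem_filter !in_fsetI mem_sumset1.
  case uH: (u - x \in H); rewrite ?andbF//= andbT.
  by rewrite -(subrK x u) (sgD sM) ?andbT// HM.
rewrite big_seq_cond (eq_bigr (fun x => \sum_(u <- U `&` M) ((u - x)%R \in H)))%N; last first.
  by move=> x /andP[xM _]; exact: E.
rewrite -big_seq_cond exchange_big /= big_seq_cond.
rewrite (eq_bigr (fun=> #|` H|)); last first.
  move=> u /andP[/fsetIP[_ uM] _].
  rewrite -big_mkcond /= -sum1_size -[LHS]big_filter.
  rewrite (perm_big [seq u - h | h <- H]) ?big_map//.
  apply: uniq_perm; rewrite ?filter_uniq ?fset_uniq ?map_inj_uniq ?fset_uniq//.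
    by move=> a b /addrI /oppr_inj.
  move=> x; rewrite mem_filter; apply/andP/mapP.
    by move=> [xH _]; exists (u - x) => //; rewrite opprB subrKC.
  by move=> [h hH ->]; rewrite opprB subrKC hH sgB// HM.
by rewrite -big_seq_cond big_const_seq count_predT iter_addn_0.
Qed.

(** Lists make concatenation correspond to the sumset. A repeated entry would count twice, so [uniq]
    is needed when [psums] is compared with sums over finite sets in [psumsP]. *)
Fixpoint psums s : {fset G} :=
  if s is a :: s' then sumset [fset 0; a] (psums s') else [fset 0].

Lemma psums_cat s t : psums (s ++ t) = sumset (psums s) (psums t).
Proof. by elim: s => [|a s IH] /=; rewrite ?sumset0l// IH sumsetA. Qed.

Lemma psums0 s : 0 \in psums s.
Proof.
elim: s => [|a s IH] /=; first by rewrite inE.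
by rewrite -[X in X \in _]addr0 mem_sumset// !inE eqxx.
Qed.

Lemma psums_sub H s : subgroup H -> {subset s <= H} -> psums s `<=` H.
Proof.
move=> sH; elim: s => [|a s IH] sub /=.
  by apply/fsubsetP => _ /fset1P ->; exact: sg0.
apply: sumset_sub => //; last by apply: IH => x xs; rewrite sub// inE xs orbT.
by apply/fsubsetP => _ /fset2P[]->; [exact: sg0|rewrite sub// mem_head].
Qed.

Lemma mem_psums s x : x \in s -> x \in psums s.
Proof.
elim: s => //= a s IH; rewrite inE => /orP[/eqP ->|/IH xs].
  by rewrite -[X in X \in _]addr0 mem_sumset ?psums0// !inE eqxx orbT.
by rewrite -[X in X \in _]add0r mem_sumset// !inE eqxx.
Qed.

Lemma psumsP s x : uniq s ->
  reflect (exists2 F : {fset G}, {subset F <= s} & x = \sum_(a <- F) a)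
    (x \in psums s).
Proof.
move=> us; apply: (iffP idP); last first.
  move=> [F]; elim: s x F us => [|a s IH] x F /=.
    move=> _ F0 ->; suff -> : F = fset0 by rewrite big_seq_fset0 inE.
    by apply/fsetP => y; rewrite inE; apply/negP => /F0.
  move=> /andP[nas us] Fs ->; case aF: (a \in F).
    rewrite (big_fsetD1 a)//= mem_sumset ?inE ?eqxx ?orbT//.
    apply: (IH _ (F `\ a)) => // y; rewrite !inE => /andP[ya /Fs].
    by rewrite inE (negPf ya).
  rewrite -[X in X \in _]add0r mem_sumset ?inE ?eqxx//.
  apply: (IH _ F) => // y yF; move/Fs: (yF); rewrite inE => /predU1P[ya|//].
  by rewrite -ya yF in aF.
elim: s x us => [|a s IH] x /= => [_ /fset1P -> |/andP[nas us]].
  by exists fset0; rewrite ?big_seq_fset0// => y; rewrite inE.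
move=> /sumsetP[y [z [yY /(IH _ us)[F Fs ->] ->]]].
move: yY => /fset2P[->|->].
  by exists F; rewrite ?add0r// => u /Fs us'; rewrite inE us' orbT.
exists (a |` F) => [u|].
  by rewrite !inE => /orP[->//|/Fs ->]; rewrite orbT.
by rewrite big_fsetU1//=; apply: contra nas => /Fs.
Qed.

End Sumsets.

Lemma psums_map (U V : zmodType) (f : {additive U -> V}) (s : seq U) :
  psums (map f s) = [fset f x | x in psums s]%fset.
Proof.
elim: s => [|a s IH] /=; first by rewrite imfset_fset1 raddf0.
rewrite IH; apply/fsetP => z; apply/sumsetP/imfsetP => /=.
  move=> [x [_ [xX /imfsetP[y /= yY ->] ->]]].
  have [e eE ->] : exists2 e, e \in [fset 0; a]%fset & x = f e.
    by case/fset2P: xX => ->; [exists 0 | exists a]; rewrite ?raddf0// !inE eqxx ?orbT.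
  by exists (e + y); rewrite ?raddfD//; exact: mem_sumset.
move=> [_ /sumsetP[x [y [xX yY ->]]] ->].
exists (f x), (f y); rewrite raddfD in_imfset//; split => //.
by move: xX; rewrite !inE => /orP[]/eqP->; rewrite ?raddf0 eqxx ?orbT.
Qed.

(** * Cyclic extensions of finite subgroups *)

(** The triangular number 1 + ... + n. *)
Definition tri n := 'C(n.+1, 2).

Lemma tri0 : tri 0 = 0%N. Proof. by []. Qed.

Lemma triS n : tri n.+1 = (tri n + n.+1)%N.
Proof. by rewrite /tri binS bin1. Qed.

Lemma tri_mul2 n : (tri n * 2 = n * n.+1)%N.
Proof. by elim: n => [//|n IH]; rewrite triS mulnDl IH; nia. Qed.

Lemma tri_floor M : exists n, (tri n <= M < tri n.+1)%N.
Proof.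
elim: M => [|M [n /andP[nM Mn]]]; first by exists 0%N.
have [MSn|MSn] := ltnP M.+1 (tri n.+1); first by exists n; rewrite MSn ltnW.
by exists n.+1; rewrite MSn triS; lia.
Qed.

(** Two copies of an interval with [hi - lo + 1] terms, shifted by at most that many places, leave
    no gap. *)
Lemma psums_interval_pos (l : seq int) (lo hi c : int) :
  (forall k, (k \in psums l) = (lo <= k <= hi)) -> 0 <= c <= hi - lo + 1 ->
  forall k, (k \in psums (c :: l)) = (lo <= k <= hi + c).
Proof.
move=> lP cP k /=; apply/sumsetP/idP.
  by move=> [x [y [/fset2P[]-> + ->]]]; rewrite lP; lia.
move=> kP; have [khi|khi] := lerP k hi.
  by exists 0, k; rewrite lP !inE eqxx add0r; split => //; lia.
by exists c, (k - c); rewrite lP !inE eqxx orbT subrKC; split => //; lia.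
Qed.

Lemma psums_interval_neg (l : seq int) (lo hi c : int) :
  (forall k, (k \in psums l) = (lo <= k <= hi)) -> 0 <= c <= hi - lo + 1 ->
  forall k, (k \in psums (- c :: l)) = (lo - c <= k <= hi).
Proof.
move=> lP cP k /=; apply/sumsetP/idP.
  by move=> [x [y [/fset2P[]-> + ->]]]; rewrite lP; lia.
move=> kP; have [khi|khi] := lerP lo k.
  by exists 0, k; rewrite lP !inE eqxx add0r; split => //; lia.
by exists (- c), (k + c); rewrite lP !inE eqxx orbT; split => //; lia.
Qed.

(** Listed in decreasing order, so that passing from n to n + 1 puts the new entry at the head,
    where [psums] recurses. *)
Definition posints n : seq int := [seq Posz i | i <- rev (iota 1 n)].

Definition negints n : seq int := [seq - Posz i | i <- rev (iota 1 n)].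

Lemma posintsS n : posints n.+1 = Posz n.+1 :: posints n.
Proof. by rewrite /posints -[n.+1]addn1 iotaD rev_cat /= addnC. Qed.

Lemma negintsS n : negints n.+1 = - Posz n.+1 :: negints n.
Proof. by rewrite /negints -[n.+1]addn1 iotaD rev_cat /= addnC. Qed.

Lemma mem_posints n k : (k \in posints n) = (1 <= k <= n%:Z).
Proof. by elim: n => [|n IH]; [rewrite in_nil|rewrite posintsS inE IH]; lia. Qed.

Lemma mem_negints n k : (k \in negints n) = (- n%:Z <= k <= -1).
Proof. by elim: n => [|n IH]; [rewrite in_nil|rewrite negintsS inE IH]; lia. Qed.

Lemma uniq_posints n : uniq (posints n).
Proof. by rewrite map_inj_uniq ?rev_uniq ?iota_uniq// => a b []. Qed.

Lemma uniq_negints n : uniq (negints n).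
Proof. by rewrite map_inj_uniq ?rev_uniq ?iota_uniq// => a b /oppr_inj[]. Qed.

Lemma psums_posints n k : (k \in psums (posints n)) = (0 <= k <= tri n).
Proof.
elim: n k => [|n IH] k; first by rewrite /= inE tri0; lia.
rewrite posintsS (psums_interval_pos (hi := tri n) (lo := 0))// ?triS; last first.
  by elim: n {IH k} => // n; rewrite triS; lia.
by rewrite PoszD.
Qed.

Lemma psums_negints_cat a (l : seq int) (hi : int) : 0 <= hi ->
  (forall k, (k \in psums l) = (0 <= k <= hi)) ->
  forall k, (k \in psums (negints a ++ l)) = (- (tri a)%:Z <= k <= hi).
Proof.
move=> hi0 lP; elim: a => [|a IH] k; first by rewrite lP tri0; lia.
rewrite negintsS cat_cons (psums_interval_neg IH) ?triS; last first.
  by elim: a {IH k} => [|a]; rewrite ?tri0 ?triS; lia.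
by apply/idP/idP; lia.
Qed.

(** Only triangular numbers plus one occur as lengths for the multipliers 1, ..., n; one negative
    multiplier supplies the remainder and is automatically distinct from the others. *)
Lemma interval_psums N : (0 < N)%N -> exists (l : seq int) (lo : int),
  [/\ uniq l, 0 \notin l, lo <= 0 < lo + N%:Z
    & forall k, (k \in psums l) = (lo <= k < lo + N%:Z)].
Proof.
case: N => // M _; have [n /andP[nM Mn]] := tri_floor M.
have [E|m0] := eqVneq M (tri n).
  exists (posints n), 0; split; rewrite ?uniq_posints ?mem_posints//.
  by move=> k; rewrite psums_posints; lia.
(* The remainder M - tri n is at most n, hence at most the length of the interval built so far. *)
exists (- (M - tri n)%:Z :: posints n), (- (M - tri n)%:Z); split.
- by rewrite /= uniq_posints mem_posints; lia.
- by rewrite inE mem_posints; lia.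
- by lia.
move=> k; rewrite (psums_interval_neg (psums_posints n)); first by lia.
move: Mn; rewrite triS; have : (n <= tri n)%N by elim: (n) => // i; rewrite triS; lia.
by lia.
Qed.

Section Cyclic.
Variable G : zmodType.
Implicit Types (H K L M : {fset G}) (x y : G).
Local Open Scope fset_scope.
Local Open Scope ring_scope.

(** [r] is the order of the image of [x] in the quotient by [H]. *)
Definition order_mod H x r :=
  [/\ (0 < r)%N, x *+ r \in H & forall i, (0 < i < r)%N -> x *+ i \notin H].

Lemma torsion_fset K x : subgroup K -> x \in K ->
  exists2 r, (0 < r <= #|` K|)%N & x *+ r = 0.
Proof.
move=> sK xK; have : ~~ uniq [seq x *+ i | i <- iota 0 #|` K|.+1].
  apply/negP => u; have /(uniq_leq_size u) : {subset [seq x *+ i | i <- iota 0 #|` K|.+1] <= K}.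
    by move=> _ /mapP[i _ ->]; exact: sgMn.
  by rewrite size_map size_iota ltnn.
move=> /(uniqPn 0)[i [j [ij]]]; rewrite size_map size_iota => jK.
rewrite !(nth_map 0%N) ?size_iota ?(ltn_trans ij)// !nth_iota ?(ltn_trans ij)// !add0n.
move=> E; exists (j - i)%N; first by lia.
by rewrite mulrnBr ?(ltnW ij)// E subrr.
Qed.

Lemma order_mod_exists H K x : subgroup H -> subgroup K -> x \in K ->
  exists r, order_mod H x r.
Proof.
move=> sH sK xK; have [r0 /andP[r0g _] r0x] := torsion_fset sK xK.
have ex : exists r, (0 < r)%N && (x *+ r \in H) by exists r0; rewrite r0g r0x sg0.
case: (ex_minnP ex) => r /andP[rg rx] rmin; exists r; split => // i /andP[ig ir].
by apply/negP => ix; move: (rmin i); rewrite ig ix => /(_ isT); lia.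
Qed.

Lemma order_modP H x r (k : int) : subgroup H -> order_mod H x r ->
  (x *~ k \in H) = (r %| k)%Z.
Proof.
move=> sH [r0 rx rmin]; rewrite {1}(divz_eq k r) mulrzDr sgDr//; last first.
  by rewrite mulrC mulrzA sgMz// -pmulrn.
have /andP[m0 mr] : 0 <= (k %% r)%Z < r%:Z by rewrite modz_ge0 ?ltz_pmod//; lia.
case E : (k %% r)%Z m0 mr => [i|i] // _ ir.
apply/idP/dvdz_mod0P => [|E0]; last by move: E; rewrite E0 => -[<-]; rewrite sg0.
rewrite -pmulrn E; have [->//|i0] := posnP i; apply: contraTeq => _.
by apply: rmin; rewrite i0.
Qed.

Lemma order_mod_inj H x r (lo k k' : int) : subgroup H -> order_mod H x r ->
  lo <= k < lo + r%:Z -> lo <= k' < lo + r%:Z -> x *~ k - x *~ k' \in H -> k = k'.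
Proof.
move=> sH xr kP kP'; rewrite -mulrzBr (order_modP _ sH xr) => /dvdzP[c E].
have : c = 0 by nia.
by move=> c0; rewrite c0 in E; lia.
Qed.

Definition cyc x r : {fset G} := [fset x *+ i | i in iota 0 r].

Definition cyc_ext H x r := sumset H (cyc x r).

(** The window of r exponents may start anywhere; [lo] is chosen later so that it matches an
    interval of subset sums and no wraparound has to be discussed. *)
Lemma cyc_extP H x r y (lo : int) : subgroup H -> order_mod H x r ->
  reflect (exists2 k : int, lo <= k < lo + r%:Z & y - x *~ k \in H) (y \in cyc_ext H x r).
Proof.
move=> sH xr; have [r0 rx _] := xr.
apply: (iffP (sumsetP _ _ _)) => [[h [_ [hH /imfsetP[i /= _ ->] ->]]]|[k kP yk]].
  have [] : 0 <= ((i%:Z - lo) %% r)%Z < r%:Z by rewrite modz_ge0 ?ltz_pmod//; lia.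
  set m := (_ %% _)%Z => mP; exists (lo + m); first by lia.
  rewrite -addrA pmulrn -mulrzBr sgDr// (order_modP _ sH xr).
  have -> : i%:Z - (lo + m) = ((i%:Z - lo) %/ r)%Z * r%:Z.
    by have := divz_eq (i%:Z - lo) r; rewrite -/m; lia.
  by rewrite dvdz_mull.
have /andP[m0 mr] : 0 <= (k %% r)%Z < r%:Z by rewrite modz_ge0 ?ltz_pmod//; lia.
case E : (k %% r)%Z m0 mr => [i|i] // _ ir.
exists (y - x *+ i), (x *+ i); split; rewrite ?subrK//.
  rewrite -(subrKA (x *~ k)) sgDr// pmulrn -mulrzBr (order_modP _ sH xr) -E.
  by rewrite {1}(divz_eq k r) addrK dvdz_mull.
by rewrite in_imfset//= mem_iota.
Qed.

Lemma sg_cyc_ext H x r : subgroup H -> order_mod H x r -> subgroup (cyc_ext H x r).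
Proof.
move=> sH xr; have [r0 _ _] := xr.
have sub k y : y - x *~ k \in H -> y \in cyc_ext H x r.
  move=> yk; apply/(cyc_extP _ k sH xr); exists k => //; lia.
split; first by apply: (sub 0); rewrite mulr0z subr0 sg0.
move=> y z /(cyc_extP _ 0 sH xr)[k _ yk] /(cyc_extP _ 0 sH xr)[k' _ zk].
apply: (sub (k - k')); rewrite mulrzBr opprB.
have -> : y - z + (x *~ k' - x *~ k) = (y - x *~ k) - (z - x *~ k').
  by rewrite opprD opprK [RHS]addrACA [- _ + _ *~ _]addrC.
exact: sgB.
Qed.

Lemma sub_cyc_ext H x r : subgroup H -> order_mod H x r -> H `<=` cyc_ext H x r.
Proof.
move=> sH [r0 _ _]; apply: sumset_subl.
by apply/imfsetP; exists 0%N; rewrite ?mulr0n//= mem_iota.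
Qed.

Lemma mem_cyc_ext H x r : subgroup H -> order_mod H x r -> x \in cyc_ext H x r.
Proof.
move=> sH xr; have [r0 _ _] := xr; apply/(cyc_extP _ 1 sH xr).
by exists 1; rewrite ?mulr1z ?subrr ?sg0//; lia.
Qed.

Lemma psums_mulz x (l : seq int) y :
  reflect (exists2 k, k \in psums l & y = x *~ k) (y \in psums [seq x *~ k | k <- l]).
Proof.
rewrite (psums_map (intmul x)); apply: (iffP (imfsetP _ _ _ _)) => /= -[k kl ->];
  by exists k.
Qed.

(** Induction on the index: for x in K outside H of order r modulo H, [interval_psums] gives
    multipliers whose sums run through exactly r consecutive integers, so each coset of H in the
    cyclic extension is met once; the extension then replaces H. *)
Lemma transversal_exists H K : subgroup H -> subgroup K -> H `<=` K ->
  exists s : seq G, [/\ uniq s, forall f, f \in s -> (f \in K) && (f \notin H),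
    inj_mod H (psums s) & sumset H (psums s) = K].
Proof.
move=> sH sK; have [n] := ubnP (#|` K| - #|` H|)%N.
elim: n H sH => // n IH H sH ltn HK.
have [KH|] := boolP (K `<=` H).
  exists [::]; split => //=; last by rewrite sumset0r; apply/eqP; rewrite eqEfsubset HK.
  by move=> t t' /fset1P -> /fset1P ->.
move=> /fsubsetPn[x xK xH].
have [r xr] := order_mod_exists sH sK xK; have [r0 _ _] := xr.
have sL := sg_cyc_ext sH xr; have HL := sub_cyc_ext sH xr; set L := cyc_ext H x r in sL HL.
have LK : L `<=` K.
  apply: sumset_sub => //; apply/fsubsetP => _ /imfsetP[i _ ->]; exact: sgMn.
have ltHL : (#|` H| < #|` L|)%N.
  apply: fproper_ltn_card; rewrite fproperE HL /=.
  by apply/fsubsetPn; exists x => //; exact: mem_cyc_ext.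
have leLK := fsubset_leq_card LK.
have [|s [us sP sinj sE]] := IH L sL _ LK; first by move: ltn; rewrite ltnS; lia.
have [l [lo [ul l0 loP lP]]] := interval_psums r0.
pose sl := [seq x *~ k | k <- l].
have slP y : y \in psums sl -> exists2 k : int, lo <= k < lo + r%:Z & y = x *~ k.
  by move=> /psums_mulz[k]; rewrite lP => kP ->; exists k.
have slL : psums sl `<=` L.
  apply/fsubsetP => y /slP[k kP ->]; apply/(cyc_extP _ lo sH xr).
  by exists k; rewrite ?subrr ?sg0.
have sle f : f \in sl -> (f \in L) && (f \notin H).
  move=> fl; rewrite (fsubsetP slL) ?mem_psums//=.
  move: fl => /mapP[k kl ->]; apply/negP => kH; move/negP: l0; apply.
  have := mem_psums kl; rewrite lP => kP.
  by rewrite (order_mod_inj sH xr loP kP)// mulr0z sub0r sgNE.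
exists (sl ++ s); split.
- rewrite cat_uniq us andbT map_inj_in_uniq ?ul/=.
    by apply/hasPn => f /sP/andP[_]; apply: contra => /sle/andP[].
  move=> k k' /mem_psums; rewrite lP => kP /mem_psums; rewrite lP => kP' E.
  by apply: (order_mod_inj sH xr kP kP'); rewrite E subrr sg0.
- move=> f; rewrite mem_cat => /orP[/sle/andP[fL ->]|/sP/andP[-> fL]].
    by rewrite (fsubsetP LK).
  by apply: contra fL; exact/fsubsetP.
- rewrite psums_cat => u u' /sumsetP[y [t [ysl ts ->]]] /sumsetP[y' [t' [ysl' ts' ->]]] E.
  have yL := fsubsetP slL _ ysl; have yL' := fsubsetP slL _ ysl'.
  have E' : t = t'.
    apply: sinj => //; move: (fsubsetP HL _ E).
    by rewrite opprD addrACA (sgDr _ sL (sgB sL yL yL')).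
  move: E; rewrite -E' opprD addrACA subrr addr0.
  move: ysl ysl' => /slP[k kP ->] /slP[k' kP' ->] E.
  by rewrite (order_mod_inj sH xr kP kP' E).
- rewrite psums_cat sumsetA -[RHS]sE; congr (sumset _ _).
  apply/eqP; rewrite eqEfsubset sumset_sub//=.
  apply/fsubsetP => y /(cyc_extP _ lo sH xr)[k kP yk].
  apply/sumsetP; exists (y - x *~ k), (x *~ k); rewrite subrK; split => //.
  by apply/psums_mulz; exists k => //; rewrite lP.
Qed.

End Cyclic.

(** * Chains of finite subgroups *)

Section Chain.
Variables (R : realType) (G : zmodType) (Hs : nat -> {fset G}).
Implicit Types (H K L M T U X Y : {fset G}) (x y : G) (s B : seq G).
Local Open Scope fset_scope.
Local Open Scope ring_scope.

Definition chain := [/\ forall n, subgroup (Hs n), forall n, Hs n `<=` Hs n.+1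
  & forall x, exists n, x \in Hs n].

Hypothesis Hs_chain : chain.

Lemma chain_sg n : subgroup (Hs n). Proof. by case: Hs_chain. Qed.

Lemma chain_le n m : (n <= m)%N -> Hs n `<=` Hs m.
Proof.
move=> /subnK <-; elim: (m - n)%N => //= k IH; apply: (fsubset_trans IH).
by rewrite addSn; case: Hs_chain.
Qed.

Lemma chain_sub X n : exists2 m, (n <= m)%N & X `<=` Hs m.
Proof.
suff [m Xm] : exists m, X `<=` Hs m.
  exists (maxn n m); first exact: leq_maxl.
  by apply: (fsubset_trans Xm); apply: chain_le; exact: leq_maxr.
suff [m sm] : exists m, {subset enum_fset X <= Hs m} by exists m; exact/fsubsetP.
elim: (enum_fset X) => [|x s [m sm]]; first by exists 0%N.
have [_ _ /(_ x)[k xk]] := Hs_chain; exists (maxn k m) => y; rewrite inE.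
move=> /predU1P[->|/sm].
  by apply: (fsubsetP (chain_le _)) xk; exact: leq_maxl.
by apply: (fsubsetP (chain_le _)); exact: leq_maxr.
Qed.

(** This produces the neutral elements. The cardinality identity says that the density of U + T in
    [Hs j] equals that of U in L /\ Hs j, at every intermediate level and for all U in L at once.
    The list is built level by level so that the identity survives at each of them. *)
Lemma transversal_chain n m L : subgroup L -> Hs n `<=` L -> (n <= m)%N ->
  exists s, [/\ uniq s, forall f, f \in s -> (f \in Hs m) && (f \notin L),
    inj_mod L (psums s) &
    forall U j, U `<=` L -> (n <= j <= m)%N ->
      (#|` sumset U (psums s) `&` Hs j| * #|` L `&` Hs j| =
       #|` U `&` Hs j| * #|` Hs j|)%N].
Proof.
move=> sL nL; elim: m => [|m IH].
  rewrite leqn0 => /eqP n0; exists [::]; split => //= [t t' /fset1P-> /fset1P->//|].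
  move=> U j _; rewrite n0 leqn0 => /eqP ->; rewrite sumset0r.
  by rewrite -n0; move/fsetIidPr: nL => ->.
rewrite leq_eqVlt => /predU1P[nm|].
  exists [::]; split => //= [t t' /fset1P-> /fset1P->//|].
  move=> U j _; rewrite nm -eqn_leq => /eqP <-; rewrite sumset0r.
  by rewrite -nm; move/fsetIidPr: nL => ->.
rewrite ltnS => nm; have [s [us sP sinj sE]] := IH nm.
(* K is the part of [Hs m.+1] already accounted for by L and the elements in [Hs m]; a transversal
   of K fills the rest. *)
pose K := sumset (L `&` Hs m.+1) (Hs m).
have sLm : subgroup (L `&` Hs m.+1) := sgI sL (chain_sg _).
have sK : subgroup K := sg_sumset sLm (chain_sg m).
have mS : Hs m `<=` Hs m.+1 := chain_le (leqnSn m).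
have KS : K `<=` Hs m.+1 by apply: sumset_sub => //; [exact: chain_sg|exact: fsubsetIr].
have mK : Hs m `<=` K := sumset_subr _ (sg0 sLm).
have LK : L `&` Hs m.+1 `<=` K := sumset_subl _ (sg0 (chain_sg m)).
have [t [ut tP tinj tE]] := transversal_exists sK (chain_sg m.+1) KS.
have tS : psums t `<=` Hs m.+1.
  by apply: psums_sub; [exact: chain_sg|move=> f /tP/andP[]].
have sm : psums s `<=` Hs m.
  by apply: psums_sub; [exact: chain_sg|move=> f /sP/andP[]].
have stS : sumset (psums s) (psums t) `<=` Hs m.+1.
  by apply: sumset_sub => //; [exact: chain_sg|exact: (fsubset_trans sm)].
have inj : inj_mod L (sumset (psums s) (psums t)).
  move=> u u' /[dup] /(fsubsetP stS) uS /sumsetP[a [b [aP bP uE]]].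
  move=> /[dup] /(fsubsetP stS) uS' /sumsetP[a' [b' [aP' bP' uE']]] E.
  have EK : u - u' \in K.
    by apply: (fsubsetP LK); rewrite in_fsetI E/=; apply: sgB => //; exact: chain_sg.
  have bb : b = b'.
    have aK : a - a' \in K.
      by apply: (fsubsetP mK); apply: sgB; [exact: chain_sg|exact/(fsubsetP sm)..].
    by apply: tinj => //; move: EK; rewrite uE uE' opprD addrACA (sgDr _ sK aK).
  rewrite uE uE' bb; congr (_ + _); apply: sinj => //.
  by move: E; rewrite uE uE' bb opprD addrACA subrr addr0.
exists (s ++ t); split.
- rewrite cat_uniq us ut /= andbT; apply/hasPn => f /tP/andP[_]; apply: contra.
  by move=> /sP/andP[fm _]; exact: (fsubsetP mK _ fm).
- move=> f; rewrite mem_cat => /orP[/sP/andP[fm ->]|/tP/andP[fS fK]].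
    by rewrite andbT (fsubsetP mS).
  rewrite fS /=; apply: contra fK => fL; apply: (fsubsetP LK).
  by rewrite in_fsetI fL fS.
- by rewrite psums_cat.
rewrite psums_cat => U j UL /andP[nj]; rewrite leq_eqVlt => /predU1P[->|].
  have card V : V `<=` L -> #|` sumset V (sumset (psums s) (psums t)) `&` Hs m.+1| =
      (#|` V `&` Hs m.+1| * #|` sumset (psums s) (psums t)|)%N.
    move=> VL; rewrite -(card_sumset_mod sL _ inj); last first.
      by apply: (fsubset_trans (fsubsetIl _ _) VL).
    congr #|` _|; apply/fsetP => z; rewrite in_fsetI; apply/andP/sumsetP.
      move=> [/sumsetP[v [w [vV wT ->]]] vw]; exists v, w; split=> //.
      rewrite in_fsetI vV -(sgDl _ (chain_sg m.+1) (fsubsetP stS _ wT)).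
      exact: vw.
    move=> [v [w [/fsetIP[vV vS] wT ->]]]; split; first exact: mem_sumset.
    by apply: sgD => //; [exact: chain_sg|exact: (fsubsetP stS)].
  rewrite card// -mulnA; congr (_ * _)%N.
  rewrite mulnC -(card L (fsubset_refl L)); congr #|` _|.
  apply/fsetIidPr/fsubsetP => g; rewrite -tE => /sumsetP[k [b [kK bt ->]]].
  move: kK => /sumsetP[l [h [/fsetIP[lL _] hm ->]]].
  (* The induction hypothesis for U = L and j = m shows that L + T fills [Hs m]. *)
  have : Hs m `<=` sumset L (psums s).
    apply/fsetIidPr/eqP; rewrite eqEfcard fsubsetIr/=.
    have /(_ m) := sE L ^~ (fsubset_refl L); rewrite nm leqnn => /(_ isT).
    rewrite mulnC => /eqP; rewrite eqn_pmul2l ?(card_gt0 (sg0 (sgI sL (chain_sg m))))//.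
    by move=> /eqP ->.
  move=> /fsubsetP/(_ _ hm)/sumsetP[l' [a [lL' aT ->]]].
  rewrite (addrA l) -!addrA addrA; apply: mem_sumset; first exact: sgD.
  exact: mem_sumset.
rewrite ltnS => jm; rewrite sumsetA.
have jK : Hs j `<=` K := fsubset_trans (chain_le jm) mK.
suff -> : sumset (sumset U (psums s)) (psums t) `&` Hs j =
          sumset U (psums s) `&` Hs j by apply: sE => //; rewrite nj.
apply/fsetP => z; rewrite !in_fsetI; case zj: (z \in Hs j); rewrite ?andbF// !andbT.
apply/idP/idP; last by move=> zU; rewrite -[z]addr0 mem_sumset ?psums0.
move=> /sumsetP[_ [b [/sumsetP[u [a [uU aT ->]]] bt zE]]].
(* The sum z and its components u and a lie in K, so b does too, and the transversal meets K only in
   0. Hence the new elements add nothing at levels up to m. *)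
suff b0 : b = 0 by rewrite zE b0 addr0 mem_sumset.
apply: tinj; rewrite ?psums0// subr0.
have zK := fsubsetP jK _ zj.
have aS := fsubsetP mS _ (fsubsetP sm _ aT).
have uK : u \in K.
  apply: (fsubsetP LK); rewrite in_fsetI (fsubsetP UL)//=.
  have := fsubsetP KS _ zK; rewrite zE (sgDl _ (chain_sg _) (fsubsetP tS _ bt)).
  by rewrite (sgDl _ (chain_sg _)).
have aK := fsubsetP mK _ (fsubsetP sm _ aT).
by move: zK; rewrite zE (sgDr _ sK)// sgD.
Qed.

Definition dens j U : R := #|` U `&` Hs j|%:R / #|` Hs j|%:R.

Lemma card_chain_gt0 j : 0 < #|` Hs j|%:R :> R.
Proof. by rewrite ltr0n (card_gt0 (sg0 (chain_sg j))). Qed.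

Lemma dens_ge0 j U : 0 <= dens j U.
Proof. by rewrite divr_ge0. Qed.

Lemma dens_le1 j U : dens j U <= 1.
Proof.
by rewrite ler_pdivrMr ?card_chain_gt0// mul1r ler_nat fsubset_leq_card// fsubsetIr.
Qed.

(** A stage of the construction: the level up to which densities are settled, and the elements
    chosen so far. *)
Definition state : Type := nat * seq G.

Definition valid (A : state) := uniq A.2 /\ {subset A.2 <= Hs A.1}.

Definition sdens (A : state) := dens A.1 (psums A.2).

Lemma valid_sub A : valid A -> psums A.2 `<=` Hs A.1.
Proof. by move=> [_ ?]; apply: psums_sub => //; exact: chain_sg. Qed.

Lemma sdensE A : valid A -> sdens A = #|` psums A.2|%:R / #|` Hs A.1|%:R.
Proof. by move=> /valid_sub/fsetIidPl vA; rewrite /sdens /dens vA. Qed.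

Lemma sdens_gt0 A : valid A -> 0 < sdens A.
Proof.
by move=> vA; rewrite sdensE// divr_gt0 ?card_chain_gt0// ltr0n (card_gt0 (psums0 _)).
Qed.

(* The last clause says that a descent from [A] to [A'] has gaps at most [e]. *)
Definition reach (lo hi e : R) (A A' : state) :=
  [/\ valid A', (A.1 <= A'.1)%N, {subset A.2 <= A'.2},
      psums A'.2 `&` Hs A.1 = psums A.2 &
   (forall j, (A.1 <= j <= A'.1)%N -> lo <= dens j (psums A'.2) <= hi) /\
   (forall g, sdens A' <= g <= sdens A -> exists2 j, (A.1 <= j <= A'.1)%N &
      `|dens j (psums A'.2) - g| <= e)].

Lemma reach_refl lo hi e A : valid A -> 0 <= e -> lo <= sdens A <= hi ->
  reach lo hi e A A.
Proof.
move=> vA e0 lohi; split => //; first by apply/fsetIidPl; exact: valid_sub.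
split=> [j|g gP]; first by rewrite -eqn_leq => /eqP <-.
have -> : g = sdens A by apply/eqP; rewrite eq_le andbC.
by exists A.1; rewrite ?leqnn// subrr normr0.
Qed.

Lemma dens_reach lo hi e A A' j : reach lo hi e A A' -> (j <= A.1)%N ->
  dens j (psums A'.2) = dens j (psums A.2).
Proof.
move=> [_ _ _ E _] jA; congr (_%:R / _); congr #|` _|.
by rewrite -E -fsetIA (fsetIidPr (chain_le jA)).
Qed.

Lemma reach_trans lo hi e (A B C : state) : reach lo hi e A B -> reach lo hi e B C ->
  reach lo hi e A C.
Proof.
move=> pAB pBC; have D := dens_reach pBC.
have [vB AB sAB EAB [bAB cAB]] := pAB; have [vC BC sBC EBC [bBC cBC]] := pBC.
split=> //; first exact: (leq_trans AB).
- by move=> x /sAB/sBC.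
- by rewrite -EAB -EBC -fsetIA (fsetIidPr (chain_le AB)).
split=> [j /andP[Aj jC]|g /andP[gC gA]].
  have [jB|Bj] := leqP j B.1; first by rewrite D// bAB// Aj.
  by rewrite bBC// (ltnW Bj).
(* The two ranges cover the whole range from [sdens C] to [sdens A] even when [sdens B] lies outside
   it. *)
have [gB|Bg] := lerP g (sdens B).
  have [|j /andP[Bj jC] jg] := cBC g; first by rewrite gC.
  by exists j; rewrite // jC (leq_trans AB).
have [|j /andP[Aj jB] jg] := cAB g; first by rewrite gA ltW.
by exists j; rewrite ?Aj ?(leq_trans jB)// D.
Qed.

Lemma reach_weaken lo hi e lo' hi' e' (A B : state) : lo' <= lo -> hi <= hi' -> e <= e' ->
  reach lo hi e A B -> reach lo' hi' e' A B.
Proof.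
move=> lolo hihi ee [vB AB sAB EAB [bAB cAB]]; split=> //; split=> [j /bAB/andP[lj jh]|g].
  by rewrite (le_trans lolo lj) (le_trans jh).
by move=> /cAB[j jP jg]; exists j => //; exact: le_trans ee.
Qed.

(** The common form of all moves: [B] changes the subset sums inside L, and neutral elements spread
    L over some [Hs m]. By [transversal_chain] the densities at levels up to m are those of U in L
    /\ Hs j, so a move only has to supply the band there. *)
Lemma extend (A : state) L U B (lo hi e : R) : valid A -> subgroup L -> Hs A.1 `<=` L ->
  U = sumset (psums A.2) (psums B) -> uniq B ->
  (forall b, b \in B -> (b \in L) && (b \notin Hs A.1)) ->
  U `&` Hs A.1 = psums A.2 ->
  (forall j, (A.1 <= j)%N -> lo * #|` L `&` Hs j|%:R <= #|` U `&` Hs j|%:R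
     <= hi * #|` L `&` Hs j|%:R) ->
  0 <= e -> sdens A <= #|` U|%:R / #|` L|%:R + e ->
  exists A' T, [/\ reach lo hi e A A', (A.1 < A'.1)%N,
    sdens A' = #|` U|%:R / #|` L|%:R,
    psums A'.2 = sumset U T & [/\ inj_mod L T, L `<=` Hs A'.1, T `<=` Hs A'.1 &
     #|` Hs A'.1| = (#|` L| * #|` T|)%N]].
Proof.
case: A => n s [/= us sn] sL nL UsB uB BP UE band e0 de.
have [m nm Lm] := chain_sub L n.+1.
have [t [ut tP tinj tE]] := transversal_chain sL nL (ltnW nm).
have UL : U `<=` L.
  rewrite UsB; apply: sumset_sub => //; last by apply: psums_sub => // b /BP/andP[].
  by apply: (fsubset_trans _ nL); apply: psums_sub => //; exact: chain_sg.
have sBm : {subset s ++ B ++ t <= Hs m}.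
  move=> x; rewrite !mem_cat => /or3P[/sn|/BP/andP[xL _]|/tP/andP[]//].
    exact/fsubsetP/chain_le/ltnW.
  exact: (fsubsetP Lm).
have vA' : valid (m, s ++ B ++ t).
  split => //=; rewrite !cat_uniq us uB ut /= andbT; apply/andP; split.
    apply/hasPn => x; rewrite mem_cat => /orP[/BP/andP[_]|/tP/andP[_]]; apply: contra.
      exact: sn.
    by move=> /sn xn; exact: (fsubsetP nL).
  by apply/hasPn => x /tP/andP[_]; apply: contra => /BP/andP[].
have pE : psums (s ++ B ++ t) = sumset U (psums t) by rewrite !psums_cat sumsetA UsB.
have L0 j : 0 < #|` L `&` Hs j|%:R :> R.
  by rewrite ltr0n (card_gt0 (sg0 (sgI sL (chain_sg j)))).
have dE j : (n <= j <= m)%N -> dens j (sumset U (psums t)) =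
    #|` U `&` Hs j|%:R / #|` L `&` Hs j|%:R.
  move=> jP; apply/eqP; rewrite /dens eqr_div ?lt0r_neq0 ?card_chain_gt0 ?L0//.
  by rewrite -!natrM tE.
have dm : dens m (sumset U (psums t)) = #|` U|%:R / #|` L|%:R.
  by rewrite dE ?(ltnW nm) ?leqnn// !(fsetIidPl _)//; exact: (fsubset_trans UL).
have tm : psums t `<=` Hs m.
  by apply: psums_sub => [|x /tP/andP[]//]; exact: chain_sg.
exists (m, s ++ B ++ t), (psums t); split=> //; last first.
- split=> //=; rewrite -(card_sumset_mod sL (fsubset_refl L) tinj).
  suff -> : sumset L (psums t) = Hs m by [].
  apply/eqP; rewrite eqEfcard sumset_sub//=; last exact: chain_sg.
  have := tE L m (fsubset_refl L); rewrite (ltnW nm) leqnn => /(_ isT).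
  rewrite (fsetIidPl Lm) mulnC => /eqP.
  rewrite eqn_pmul2l ?(card_gt0 (sg0 sL))// => /eqP <-.
  by apply: fsubset_leq_card; exact: fsubsetIl.
- by rewrite /sdens pE.
split => //=; first exact: ltnW.
- by move=> x xs; rewrite mem_cat xs.
- rewrite pE -UE; apply/fsetP => z; rewrite !in_fsetI.
  case zn: (z \in Hs n); rewrite ?andbF// !andbT.
  apply/idP/idP => [|zU]; last by rewrite -[z]addr0 mem_sumset ?psums0.
  move=> /sumsetP[u [w [uU wt zE]]]; suff w0 : w = 0 by rewrite zE w0 addr0.
  apply: tinj; rewrite ?psums0// subr0.
  by move: (fsubsetP nL _ zn); rewrite zE (sgDr _ sL)// (fsubsetP UL).
rewrite pE; split=> [j /[dup] /andP[nj _] jP|g].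
  by rewrite dE// ler_pdivlMr ?ler_pdivrMr ?L0// band.
(* The whole drop is at most e, so the starting level alone approximates every g in between. *)
rewrite {1}/sdens /= pE dm => /andP[g1 g2]; exists n; first by rewrite leqnn (ltnW nm).
have -> : dens n (sumset U (psums t)) = sdens (n, s).
  rewrite dE ?leqnn ?(ltnW nm)// UE sdensE ?(fsetIidPr nL)//.
by rewrite ler_norml; move: g1 g2 de; set d1 := sdens _; set d2 := _ / _; lra.
Qed.

(** By [sum_coset_card] the density of U in M is the average of its densities in the cosets of H. *)
Lemma coset_band H M U (lo hi : R) : subgroup H -> subgroup M -> H `<=` M ->
  (forall x, x \in M ->
    lo * #|` H|%:R <= #|` U `&` sumset [fset x] H|%:R <= hi * #|` H|%:R) ->
  lo * #|` M|%:R <= #|` U `&` M|%:R <= hi * #|` M|%:R.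
Proof.
move=> sH sM HM band.
have H0 : 0 < #|` H|%:R :> R by rewrite ltr0n (card_gt0 (sg0 sH)).
have E : #|` H|%:R * #|` U `&` M|%:R =
    \sum_(x <- M) #|` U `&` sumset [fset x] H|%:R :> R.
  by rewrite -natrM -sum_coset_card// natr_sum.
have const (c : R) : \sum_(x <- M) (c * #|` H|%:R) = #|` H|%:R * (c * #|` M|%:R).
  by rewrite big_const_seq count_predT iter_addr_0 -[LHS]mulr_natr -mulrA mulrCA.
apply/andP; split; rewrite -(ler_pM2l H0) -const E big_seq [leRHS]big_seq;
  by apply: ler_sum => x /band/andP[].
Qed.

Lemma coset_except H M U F (c : nat) : subgroup H -> subgroup M -> H `<=` M ->
  (c <= #|` H|)%N ->
  (forall x, x \in M -> x \notin F -> #|` U `&` sumset [fset x] H| = c) ->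
  `|#|` U `&` M|%:R - c%:R / #|` H|%:R * #|` M|%:R| <= #|` F `&` M|%:R :> R.
Proof.
move=> sH sM HM cH E.
have H0 : 0 < #|` H|%:R :> R by rewrite ltr0n (card_gt0 (sg0 sH)).
rewrite -(ler_pM2l H0) -{1}(gtr0_norm H0) -normrM mulrBr -natrM -sum_coset_card//.
have -> : #|` H|%:R * (c%:R / #|` H|%:R * #|` M|%:R) = \sum_(x <- M) c%:R :> R.
  rewrite big_const_seq count_predT iter_addr_0 mulrA mulrC [_ * (_ / _)]mulrC.
  by rewrite divfK ?gt_eqF// mulr_natl.
rewrite natr_sum -sumrB; apply: (le_trans (ler_norm_sum _ _ _)).
apply: (@le_trans _ _ (\sum_(x <- M) (x \in F)%:R * #|` H|%:R)).
  rewrite big_seq [leRHS]big_seq; apply: ler_sum => x xM.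
  have [xF|xF] := boolP (x \in F); last by rewrite E// subrr normr0 mul0r.
  have : (#|` U `&` sumset [fset x] H| <= #|` H|)%N.
    by rewrite -(card_sumset1 x H); apply: fsubset_leq_card; exact: fsubsetIr.
  rewrite mul1r ler_norml; move: cH; rewrite -2!(ler_nat R).
  have := ler0n R c; have := ler0n R #|` U `&` sumset [fset x] H|.
  by move=> ? ? ? ?; apply/andP; split; lra.
rewrite -mulr_suml mulrC ler_pM2l// -natr_sum -big_mkcond/= ler_nat.
rewrite -sum1_size /= -[X in (X <= _)%N]big_filter.
rewrite (perm_big (F `&` M)) //=; apply: uniq_perm; rewrite ?filter_uniq ?fset_uniq//.
by move=> x; rewrite mem_filter in_fsetI.
Qed.

(** The decrement c does not depend on the state and v stays nonnegative, so boundedly many steps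
    suffice. Ascents use a constant minus the density as v. *)
Lemma iterate_down (rel : state -> state -> Prop) (P : state -> Prop)
    (v : state -> R) (c th : R) :
  (forall A B C : state, rel A B -> rel B C -> rel A C) -> (forall A, P A -> rel A A) ->
  0 < c -> (forall A, P A -> 0 <= v A) ->
  (forall A, P A -> th < v A -> exists B : state, [/\ rel A B, P B & v B <= v A - c]) ->
  forall A, P A -> exists B : state, [/\ rel A B, P B & v B <= th].
Proof.
move=> tr refl c0 v0 step A PA.
have [k] : exists k : nat, v A <= k%:R * c.
  exists (Num.truncn (v A / c)).+1; rewrite -ler_pdivrMr//.
  by apply: ltW; exact: truncnS_gt.
elim: k A PA => [|k IH] A PA; have [Ath|thA] := lerP (v A) th.
- by exists A; split=> //; exact: refl.
- have [B [_ PB vB]] := step _ PA thA; have := v0 _ PB; rewrite mul0r; lra.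
- by exists A; split=> //; exact: refl.
have [B [rAB PB vB]] := step _ PA thA; rewrite -natr1 mulrDl mul1r => kA.
have [|C [rBC PC vC]] := IH B PB; first by lra.
by exists C; split => //; exact: tr rBC.
Qed.

End Chain.

(** * Triangular numbers close to prescribed sizes *)

Lemma tri_ge_sqr n : (n * n <= tri n * 2)%N.
Proof. by rewrite tri_mul2; nia. Qed.

(** An interval of tri n + 1 terms should miss between r / (4K) and r / K of r cosets. Consecutive
    triangular numbers below r differ by at most about sqrt (2r), which for r >= 64 K^2 fits into
    this margin. *)
Lemma tri_descent K r : (0 < K)%N -> (64 * K * K <= r)%N -> exists n,
  [/\ (tri n < r)%N, (K * (r - (tri n).+1) <= r)%N & (r <= 4 * K * (r - (tri n).+1))%N].
Proof.
move=> K0 Kr; pose q := (r %/ (4 * K)).+1.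
have q1 : (4 * K * q.-1 <= r)%N by rewrite /q /= mulnC leq_divM.
have q2 : (r <= 4 * K * q)%N by rewrite /q mulnC ltnW// ltn_ceil//; lia.
have q0 : (0 < q)%N by [].
have [n /andP[n1 n2]] := tri_floor (r - q.+1).
rewrite triS in n2; have n3 := tri_mul2 n.
have qr : (q.+1 <= r)%N by nia.
have Kn : (4 * K * n.+1 <= 3 * r)%N.
  rewrite leqNgt; apply/negP => Kn.
  have n4 : (n * n.+1 <= 2 * r)%N by nia.
  have n5 : (n.+1 * n.+1 <= 4 * r + 2)%N by nia.
  have n6 : (9 * r * r < 16 * (K * K) * (n.+1 * n.+1))%N by nia.
  have n7 : (16 * (K * K) * (n.+1 * n.+1) <= 16 * (K * K) * (4 * r + 2))%N.
    by rewrite leq_mul2l n5 orbT.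
  have n8 : (64 * (K * K) * r <= r * r)%N by rewrite leq_mul2r; lia.
  by nia.
exists n; split; nia.
Qed.

(** With m = tri a and t = tri b, the interval from -m to t has N = m + t + 1 terms and D = 2N - r
    is the overlap of two copies that together cover r cosets. The four bounds say: the second copy
    can start after 0, D is not negative, the exceptional cosets 1, ..., t are few, and the overlap
    is a proportion at least 1 / (4K). Take t close to r / K, then 2m close to r - t - 2; the
    rounding of m costs at most t / 2. *)
Lemma tri_ascent K r : (1 < K)%N -> (1024 * K * K <= r)%N -> exists a b,
  [/\ (2 * tri a + tri b + 2 <= r)%N, (r <= 2 * tri a + 2 * tri b + 2)%N,
      (K * tri b <= r)%N & (r <= 4 * K * (2 * tri a + 2 * tri b + 2 - r))%N].
Proof.
move=> K1 Kr; have K0 : (0 < K)%N by lia.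
have [b /andP[b1 b2]] := tri_floor (r %/ K).
have b3 : (K * tri b <= r)%N by rewrite mulnC; move: b1; rewrite leq_divRL.
have b4 : (r < K * tri b.+1)%N by rewrite mulnC; move: b2; rewrite ltn_divLR.
rewrite triS in b4; have b5 := tri_mul2 b; set t := tri b in b1 b3 b4 b5 *.
have b6 : (b <= t)%N by nia.
have b7 : (1024 * K < t + b.+1)%N.
  have : (K * (1024 * K) < K * (t + b.+1))%N by apply: leq_ltn_trans b4; lia.
  by rewrite ltn_pmul2l.
have b8 : (b.+1 <= t)%N by rewrite ltnNge; apply/negP => ?; nia.
have b9 : (r < K * (2 * t))%N.
  by apply: (leq_trans b4); rewrite leq_mul2l; apply/orP; right; lia.
have t2 : (2 * t <= r)%N by apply: leq_trans b3; rewrite leq_mul2r K1 orbT.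
have [a /andP[a1 a2]] := tri_floor ((r - (t + 2)) %/ 2).
rewrite triS in a2; have a5 := tri_ge_sqr a; set m := tri a in a1 a2 a5 *.
have a6 : (2 * m + t + 2 <= r)%N by lia.
have a7 : (r < 2 * m + 2 * a + 4 + t)%N by lia.
have a8 : (a * a < K * (2 * t))%N by lia.
have a9 : (4 * a + 2 <= t)%N.
  rewrite leqNgt; apply/negP => ta.
  have c1 : (512 * K * t <= t * t)%N by rewrite leq_mul2r; lia.
  have c2 : (t * t <= (4 * a + 2) * (4 * a + 2))%N by rewrite leq_mul; lia.
  have c3 : ((4 * a + 2) * (4 * a + 2) = 16 * (a * a) + 16 * a + 4)%N by ring.
  have c4 : (a <= a * a)%N by case: (a) => // i; rewrite leq_pmulr.
  have c5 : (t <= K * t)%N by rewrite leq_pmull.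
  by move: c1 a8; rewrite -mulnA [(K * (2 * t))%N]mulnCA; lia.
exists a, b; rewrite -/m -/t; split=> //; first by lia.
have d2 : (t <= 2 * (2 * m + 2 * t + 2 - r))%N by lia.
apply: (leq_trans (ltnW b9)); rewrite [(4 * K)%N]mulnC -mulnA leq_mul2l.
by apply/orP; right; lia.
Qed.

(** * Elements of large order *)

Section Averaging.
Variable G : zmodType.
Implicit Types (E W S : {fset G}).
Local Open Scope fset_scope.
Local Open Scope ring_scope.

(** Both sides count the pairs (w, v) in W x W, sorted on the left by h = w - v. *)
Lemma sum_card_shift E W : subgroup E -> W `<=` E ->
  (\sum_(h <- E) #|` W `&` sumset [fset h] W| = #|` W| * #|` W|)%N.
Proof.
move=> sE /fsubsetP WE.
transitivity (\sum_(h <- E) \sum_(w <- W) ((w - h)%R \in W))%N.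
  apply: eq_bigr => h _; rewrite -sum1_size -big_mkcond /= -[RHS]big_filter.
  apply/perm_big/uniq_perm; rewrite ?filter_uniq ?fset_uniq// => w.
  by rewrite mem_filter in_fsetI mem_sumset1 andbC.
rewrite exchange_big big_seq_cond (eq_bigr (fun=> #|` W|)); last first.
  move=> w /andP[wW _]; rewrite -big_mkcond /= -sum1_size -[LHS]big_filter.
  rewrite (perm_big [seq w - v | v <- W]) ?big_map//.
  apply: uniq_perm; rewrite ?filter_uniq ?map_inj_uniq ?fset_uniq//.
    by move=> a b /addrI/oppr_inj.
  move=> h; rewrite mem_filter; apply/andP/mapP => [[whW _]|[v vW ->]].
    by exists (w - h); rewrite // opprB subrKC.
  by rewrite opprB subrKC vW sgB ?WE.
by rewrite -big_seq_cond big_const_seq count_predT iter_addn_0 mulnC.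
Qed.

Lemma exists_small_overlap E W : subgroup E -> W `<=` E ->
  exists2 h, h \in E & (#|` W `&` sumset [fset h] W| * #|` E| <= #|` W| * #|` W|)%N.
Proof.
move=> sE WE; apply/hasP; apply/negPn/negP => /hasPn big.
have E0 : (0 < #|` E|)%N := card_gt0 (sg0 sE).
have : (\sum_(h <- E) (#|` W| * #|` W|).+1 <=
        \sum_(h <- E) #|` W `&` sumset [fset h] W| * #|` E|)%N.
  rewrite big_seq [X in (_ <= X)%N]big_seq.
  by apply: leq_sum => h hE; have := big _ hE; rewrite /= -ltnNge.
rewrite -big_distrl /= sum_card_shift// big_const_seq count_predT iter_addn_0.
by rewrite leq_pmul2r// ltnn.
Qed.

End Averaging.

Section CyclicCount.
Variable G : zmodType.
Implicit Types (H L M U S T : {fset G}) (x y h : G).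
Local Open Scope fset_scope.
Local Open Scope ring_scope.

Definition multiples x i n : {fset G} := [fset x *+ k | k in iota i n].

Lemma card_cyc_ext H x r : subgroup H -> order_mod H x r ->
  #|` cyc_ext H x r| = (#|` H| * r)%N.
Proof.
move=> sH xr; have inj i j : (i < r)%N -> (j < r)%N -> x *+ i - x *+ j \in H -> i = j.
  move=> ir jr; rewrite !pmulrn => /(order_mod_inj (lo := 0) sH xr).
  by rewrite !add0r => E; apply/eqP; rewrite -eqz_nat; apply/eqP/E; lia.
rewrite (card_sumset_mod (H := H))//; last first.
  move=> _ _ /imfsetP[i /= + ->] /imfsetP[j /= + ->]; rewrite !mem_iota !add0n.
  by move=> ir jr E; rewrite (inj i j).
rewrite card_in_imfset/=; last first.
  move=> i j /=; rewrite !mem_iota !add0n => ir jr E.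
  by apply: inj => //; rewrite E subrr sg0.
by rewrite undup_id ?iota_uniq ?size_iota.
Qed.

(* If the multiples of [x] lying in [M] are those of index divisible by [s],
   then [M] contains [r %/ s] of the cosets [x *+ i + H], [i < r], but only
   [t %/ s] of those with [1 <= i <= t]. *)
Lemma card_first_cosets H M x r t : subgroup H -> subgroup M -> H `<=` M ->
  order_mod H x r ->
  (#|` sumset H (multiples x 1 t) `&` M| * r <= t * #|` cyc_ext H x r `&` M|)%N.
Proof.
move=> sH sM HM xr; have [r0 rx _] := xr.
have [s xs] : exists s, order_mod M x s.
  have ex : exists s, (0 < s)%N && (x *+ s \in M).
    by exists r; rewrite r0 (fsubsetP HM).
  case: (ex_minnP ex) => s /andP[s0 sx] smin; exists s; split=> // i /andP[i0 si].
  by apply/negP => ix; move: (smin i); rewrite i0 ix => /(_ isT); lia.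
have [s0 sx _] := xs.
have dvd i : (x *+ i \in M) = (s %| i)%N by rewrite pmulrn (order_modP _ sM xs).
have sr : (s %| r)%N by rewrite -dvd (fsubsetP HM).
have rs0 : (0 < r %/ s)%N by rewrite divn_gt0// dvdn_leq.
have xsH : order_mod H (x *+ s) (r %/ s).
  split=> [//||i /andP[i0 ir]]; first by rewrite -mulrnA mulnC divnK.
  rewrite -mulrnA; case: xr => _ _; apply; rewrite muln_gt0 s0 i0 /=.
  by rewrite mulnC -ltn_divRL.
have c1 : (#|` H| * (r %/ s) <= #|` cyc_ext H x r `&` M|)%N.
  rewrite -(card_cyc_ext sH xsH); apply: fsubset_leq_card.
  apply/fsubsetP => _ /sumsetP[h [_ [hH /imfsetP[i /= + ->] ->]]].
  rewrite mem_iota add0n => ir; rewrite -mulrnA; apply/fsetIP; split; last first.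
    by apply: sgD => //; [exact: (fsubsetP HM)|rewrite dvd dvdn_mulr].
  apply: mem_sumset => //; apply/imfsetP; exists (s * i)%N => //=.
  by rewrite mem_iota add0n /= mulnC -ltn_divRL.
have c2 : (#|` sumset H (multiples x 1 t) `&` M| <= #|` H| * (t %/ s))%N.
  pose l := [seq h + x *+ (s * i) | h <- enum_fset H, i <- iota 1 (t %/ s)].
  have -> : (#|` H| * (t %/ s))%N = size l by rewrite size_allpairs size_iota.
  apply: uniq_leq_size; first exact: fset_uniq.
  move=> y /fsetIP[/sumsetP[h [_ [hH /imfsetP[i /= + ->] ->]]] + ].
  rewrite mem_iota add1n ltnS (sgDr _ sM (fsubsetP HM _ hH)) dvd.
  move=> /andP[i0 it] /dvdnP[k ik]; apply/allpairsP; exists (h, k) => /=.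
  rewrite mem_iota add1n ltnS mulnC -ik leq_divRL//; split=> //.
  by rewrite -ik it andbT; move: i0; rewrite ik; case: (k).
apply: (@leq_trans (#|` H| * (t %/ s) * r)); first by rewrite leq_mul2r c2 orbT.
apply: (@leq_trans (t * (#|` H| * (r %/ s)))); last by rewrite leq_mul2l c1 orbT.
rewrite -mulnA [leqRHS]mulnCA leq_mul2l; apply/orP; right.
by rewrite -{1}(divnK sr) mulnCA mulnC leq_mul2r leq_divM orbT.
Qed.

(** Both segments lie in one window of r consecutive exponents, so each coset sees each layer at
    most once and its fibre is the union of the layers whose segment contains k. *)
Lemma layers_coset H x r (lo p q p' q' : int) S S' U k y : subgroup H ->
  order_mod H x r -> S `<=` H -> S' `<=` H ->
  (forall u, u \in U <->
    (exists s i, [/\ s \in S, p <= i <= q & u = s + x *~ i]) \/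
    (exists s i, [/\ s \in S', p' <= i <= q' & u = s + x *~ i])) ->
  lo <= p -> q < lo + r%:Z -> lo <= p' -> q' < lo + r%:Z ->
  lo <= k < lo + r%:Z -> y - x *~ k \in H ->
  U `&` sumset [fset y] H = sumset [fset x *~ k]
    ((if p <= k <= q then S else fset0) `|` (if p' <= k <= q' then S' else fset0)).
Proof.
move=> sH xr /fsubsetP SH /fsubsetP SH' UE lp qr lp' qr' kP yk.
have yE : sumset [fset y] H = sumset [fset x *~ k] H.
  apply/fsetP => z; rewrite !mem_sumset1 -(subrKA y z (- (x *~ k))).
  by rewrite (sgDl _ sH yk).
have coset i s0 : s0 \in H -> lo <= i < lo + r%:Z -> s0 + x *~ i - x *~ k \in H -> i = k.
  by move=> sH0 iP; rewrite -addrA (sgDr _ sH sH0) => /(order_mod_inj sH xr iP kP).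
apply/fsetP => z; rewrite yE in_fsetI !mem_sumset1 in_fsetU; apply/andP/orP.
  move=> [/UE[] [s [i [sS iP ->]]] zH]; [left|right].
    have ik : i = k by apply: coset zH; rewrite ?SH//; lia.
    by move: iP; rewrite ik => ->; rewrite addrK.
  have ik : i = k by apply: coset zH; rewrite ?SH'//; lia.
  by move: iP; rewrite ik => ->; rewrite addrK.
case; case: ifP => // iP zS.
  by split; [apply/UE; left; exists (z - x *~ k), k; rewrite subrK|exact: SH].
by split; [apply/UE; right; exists (z - x *~ k), k; rewrite subrK|exact: SH'].
Qed.

End CyclicCount.

Section LongCycles.
Variables (R : realType) (G : zmodType) (Hs : nat -> {fset G}).
Hypothesis Hs_chain : chain Hs.
Hypothesis long_orders : forall (H : {fset G}) r, subgroup H ->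
  exists x : G, forall i, (0 < i < r)%N -> x *+ i \notin H.
Local Open Scope fset_scope.
Local Open Scope ring_scope.

Let chain_order (H : {fset G}) x : subgroup H -> exists r, order_mod H x r.
Proof.
move=> sH; have [_ _ /(_ x)[m xm]] := Hs_chain.
exact: (order_mod_exists sH (chain_sg Hs_chain m) xm).
Qed.

Lemma long_order (H : {fset G}) r0 : subgroup H -> exists x r, order_mod H x r /\ (r0 <= r)%N.
Proof.
move=> sH; have [x xP] := long_orders r0 sH; have [r xr] := chain_order x sH.
exists x, r; split=> //; rewrite leqNgt; apply/negP => rr0; case: xr => r1 rx _.
by have := xP r; rewrite r1 rr0 rx => /(_ isT).
Qed.

Lemma mulz_intervalP (x : G) (l : seq int) (lo hi : int) (S : {fset G}) u :
  (forall k, (k \in psums l) = (lo <= k <= hi)) ->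
  u \in sumset S (psums [seq x *~ k | k <- l]) <->
  exists s i, [/\ s \in S, lo <= i <= hi & u = s + x *~ i].
Proof.
move=> lP; split=> [/sumsetP[s [_ [sS /psums_mulz[k kl ->] ->]]]|[s [i [sS iP ->]]]].
  by exists s, k; rewrite -lP.
by apply: mem_sumset => //; apply/psums_mulz; exists i; rewrite // lP.
Qed.

(* The exceptional cosets may be badly distributed in [Hs j], but by
   [card_first_cosets] their proportion there is at most [t / r]. *)
Lemma cyclic_band (A : state G) x r t U K : subgroup (Hs A.1) -> valid Hs A ->
  order_mod (Hs A.1) x r -> (K * t <= r)%N -> (0 < K)%N ->
  (forall y, y \in cyc_ext (Hs A.1) x r ->
    y \notin sumset (Hs A.1) (multiples x 1 t) ->
    #|` U `&` sumset [fset y] (Hs A.1)| = #|` psums A.2|) ->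
  forall j, (A.1 <= j)%N ->
  (sdens R Hs A - K%:R^-1) * #|` cyc_ext (Hs A.1) x r `&` Hs j|%:R <=
    #|` U `&` (cyc_ext (Hs A.1) x r `&` Hs j)|%:R <=
  (sdens R Hs A + K%:R^-1) * #|` cyc_ext (Hs A.1) x r `&` Hs j|%:R.
Proof.
move=> sH vA xr Kt K0 UE j Aj; set L := cyc_ext _ x r in UE *.
have sL : subgroup L := sg_cyc_ext sH xr.
have sLj := sgI sL (chain_sg Hs_chain j).
have HLj : Hs A.1 `<=` L `&` Hs j.
  by rewrite fsubsetI (sub_cyc_ext sH xr) (chain_le Hs_chain).
have [r0 _ _] := xr.
have : forall y, y \in L `&` Hs j -> y \notin sumset (Hs A.1) (multiples x 1 t) ->
    #|` U `&` sumset [fset y] (Hs A.1)| = #|` psums A.2|.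
  by move=> y /fsetIP[yL _]; exact: UE.
move=> /(coset_except R sH sLj HLj (fsubset_leq_card (valid_sub Hs_chain vA))).
rewrite -sdensE//; have c2 := card_first_cosets t sH sLj HLj xr.
rewrite -/L [L `&` (L `&` _)]fsetIA fsetIid in c2.
set F := sumset _ _ in c2 *; set M := L `&` Hs j in c2 *.
have c3 : #|` F `&` M|%:R <= K%:R^-1 * #|` M|%:R :> R.
  rewrite ler_pdivlMl ?ltr0n// -natrM ler_nat.
  rewrite -(leq_pmul2r r0) -mulnA; apply: (@leq_trans (K * (t * #|` M|))).
    by rewrite leq_mul2l c2 orbT.
  by rewrite mulnA [leqRHS]mulnC leq_mul2r Kt orbT.
rewrite ler_norml; set d := sdens _ _ _; rewrite mulrBl mulrDl.
by move: c3; set f := _%:R; set g := _%:R; set u := _%:R; lra.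
Qed.

End LongCycles.

Section LongCycleMoves.
Variables (R : realType) (G : zmodType) (Hs : nat -> {fset G}).
Hypothesis Hs_chain : chain Hs.
Hypothesis long_orders : forall (H : {fset G}) r, subgroup H ->
  exists x : G, forall i, (0 < i < r)%N -> x *+ i \notin H.
Implicit Types (H : {fset G}) (x : G).
Local Open Scope fset_scope.
Local Open Scope ring_scope.

Definition zmultiples (x : G) (lo : int) N : {fset G} :=
  [fset x *~ (lo + Posz i) | i in iota 0 N].

Lemma zmultiplesP x lo N y :
  reflect (exists2 k : int, lo <= k < lo + N%:Z & y = x *~ k) (y \in zmultiples x lo N).
Proof.
apply: (iffP (imfsetP _ _ _ _)) => /= [[i + ->]|[k kP ->]].
  by rewrite mem_iota add0n => iN; exists (lo + Posz i) => //; lia.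
exists `|k - lo|%N; first by rewrite mem_iota; lia.
by congr (_ *~ _); lia.
Qed.

Lemma inj_zmultiples H x r lo N : subgroup H -> order_mod H x r -> (N <= r)%N ->
  inj_mod H (zmultiples x lo N).
Proof.
move=> sH xr Nr _ _ /zmultiplesP[k kP ->] /zmultiplesP[k' kP' ->] E.
by rewrite (order_mod_inj (lo := lo) sH xr _ _ E)//; lia.
Qed.

Lemma card_zmultiples H x r lo N : subgroup H -> order_mod H x r -> (N <= r)%N ->
  #|` zmultiples x lo N| = N.
Proof.
move=> sH xr Nr; rewrite card_in_imfset/=; last first.
  move=> i j /=; rewrite !mem_iota !add0n => iN jN E.
  have /(order_mod_inj (lo := lo) sH xr) : x *~ (lo + Posz i) - x *~ (lo + Posz j) \in H.
    by rewrite E subrr sg0.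
  by move=> F; have := F _ _; lia.
by rewrite undup_id ?iota_uniq ?size_iota.
Qed.

Lemma psums_zmultiples (x : G) (l : seq int) (lo : int) N :
  (forall k, (k \in psums l) = (lo <= k < lo + N%:Z)) ->
  psums [seq x *~ k | k <- l] = zmultiples x lo N.
Proof.
move=> lP; apply/fsetP => y; apply/psums_mulz/zmultiplesP => -[k kP ->]; exists k => //.
  by rewrite -lP.
by rewrite lP.
Qed.

(** Each multiplier and 0 are themselves among the subset sums, hence in a window of at most r
    integers, where distinct multiples of x lie in distinct cosets of H. *)
Lemma mulz_list H x r (l : seq int) (lo : int) N : subgroup H -> order_mod H x r ->
  (N <= r)%N -> uniq l -> 0 \notin l -> lo <= 0 < lo + N%:Z ->
  (forall k, (k \in psums l) = (lo <= k < lo + N%:Z)) ->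
  uniq [seq x *~ k | k <- l] /\
  forall b, b \in [seq x *~ k | k <- l] -> (b \in cyc_ext H x r) && (b \notin H).
Proof.
move=> sH xr Nr ul l0 loP lP; have inj k k' : k \in psums l -> k' \in psums l ->
    x *~ k - x *~ k' \in H -> k = k'.
  by rewrite !lP => kP kP' /(order_mod_inj (lo := lo) sH xr); apply; lia.
split.
  rewrite map_inj_in_uniq// => k k' /mem_psums kl /mem_psums kl' E.
  by apply: inj => //; rewrite E subrr sg0.
move=> _ /mapP[k kl ->]; apply/andP; split.
  apply/(cyc_extP _ lo sH xr); exists k; last by rewrite subrr sg0.
  by have := mem_psums kl; rewrite lP; lia.
apply/negP => kH; move/negP: l0; apply; suff -> : 0 = k by [].
by apply: inj; rewrite ?lP// -?lP ?mem_psums// mulr0z sub0r sgNE.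
Qed.

(** With the elements -x, ..., -nx the subset sums occupy the exponents from -tri n to 0, so the
    missing cosets are x, 2x, ..., (r - tri n - 1)x, the position required by [cyclic_band]. *)
Lemma long_descend K (A : state G) : (0 < K)%N -> valid Hs A ->
  exists A', [/\ reach Hs (sdens R Hs A - K%:R^-1) (sdens R Hs A + K%:R^-1) K%:R^-1 A A',
    (A.1 < A'.1)%N &
    sdens R Hs A' <= sdens R Hs A - sdens R Hs A / (4 * K)%:R].
Proof.
move=> K0 vA; have sH := chain_sg Hs_chain A.1; set H := Hs A.1 in sH *.
have [x [r [xr rK]]] := long_order Hs_chain long_orders (64 * K * K) sH.
have [n [nr Kn rn]] := tri_descent K0 rK; have [r0 _ _] := xr.
(* The empty list has the one subset sum 0, the case [hi = 0] of [psums_negints_cat]. *)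
pose l := negints n ++ [::].
have lP0 : forall k, (k \in psums l) = (- (tri n)%:Z <= k <= 0).
  by apply: psums_negints_cat => // k; rewrite /= inE; lia.
have lP : forall k, (k \in psums l) = (- (tri n)%:Z <= k < - (tri n)%:Z + (tri n).+1%:Z).
  by move=> k; rewrite lP0; lia.
have ul : uniq l by rewrite /l cats0 uniq_negints.
have l0 : 0 \notin l by rewrite /l cats0 mem_negints; lia.
have lo0 : - (tri n)%:Z <= 0 < - (tri n)%:Z + (tri n).+1%:Z by lia.
have [uB BP] := mulz_list sH xr nr ul l0 lo0 lP.
set B := [seq _ | _ <- _] in uB BP; pose S := psums A.2.
have SH : S `<=` H := valid_sub Hs_chain vA.
pose U := sumset S (psums B).
have UE u : u \in U <->
    (exists s i, [/\ s \in S, - (tri n)%:Z <= i <= 0 & u = s + x *~ i]) \/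
    (exists s i, [/\ s \in fset0, 0 <= i <= 0 & u = s + x *~ i]).
  rewrite /U /B (mulz_intervalP _ _ _ lP0); split; first by left.
  by case=> // -[s [i []]].
have sL := sg_cyc_ext sH xr; have HL := sub_cyc_ext sH xr.
set L := cyc_ext H x r in BP sL HL.
have coset k y : - (tri n)%:Z <= k < - (tri n)%:Z + r%:Z -> y - x *~ k \in H ->
    U `&` sumset [fset y] H =
    sumset [fset x *~ k] (if - (tri n)%:Z <= k <= 0 then S else fset0).
  move=> kP yk; rewrite (layers_coset sH xr SH (fsub0set H) UE _ _ _ _ kP yk); try by lia.
  by rewrite if_same fsetU0.
have UH : U `&` H = S.
  rewrite -{1}(sumset0l H) (coset 0 0) ?mulr0z ?subr0 ?sg0 ?sumset0l//; last by lia.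
  by rewrite ifT//; lia.
have UL : U `<=` L.
  apply: sumset_sub => //; first exact: fsubset_trans HL.
  by apply: psums_sub => // b /BP/andP[].
have cU : #|` U| = (#|` S| * (tri n).+1)%N.
  rewrite /U (psums_zmultiples _ lP) (card_sumset_mod sH SH); last exact: inj_zmultiples xr _.
  by rewrite (card_zmultiples _ sH xr).
have H0 : 0 < #|` H|%:R :> R by rewrite ltr0n (card_gt0 (sg0 sH)).
have rR : 0 < r%:R :> R by rewrite ltr0n.
have KR : 0 < K%:R :> R by rewrite ltr0n.
have dU : #|` U|%:R / #|` L|%:R = sdens R Hs A * ((tri n).+1%:R / r%:R) :> R.
  by rewrite cU /L card_cyc_ext// sdensE// !natrM; field; rewrite !gt_eqF.
have nrE : (tri n).+1%:R = r%:R - (r - (tri n).+1)%:R :> R by rewrite natrB// opprB addrC subrK.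
have d1 : (r - (tri n).+1)%:R / r%:R <= K%:R^-1 :> R.
  by rewrite ler_pdivrMr// mulrC ler_pdivlMr// -natrM ler_nat mulnC.
have d2 : (4 * K)%:R^-1 <= (r - (tri n).+1)%:R / r%:R :> R.
  by rewrite ler_pdivlMr// mulrC ler_pdivrMr ?ltr0n ?muln_gt0// -natrM ler_nat mulnC.
have d3 : #|` U|%:R / #|` L|%:R = sdens R Hs A - sdens R Hs A * ((r - (tri n).+1)%:R / r%:R) :> R.
  by rewrite dU nrE; field; rewrite gt_eqF.
have dA0 := dens_ge0 R Hs A.1 (psums A.2); have dA1 := dens_le1 R Hs_chain A.1 (psums A.2).
rewrite -/(sdens R Hs A) in dA0 dA1.
have Ki : 0 < K%:R^-1 :> R by rewrite invr_gt0.
have band j : (A.1 <= j)%N -> (sdens R Hs A - K%:R^-1) * #|` L `&` Hs j|%:R <=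
    #|` U `&` Hs j|%:R <= (sdens R Hs A + K%:R^-1) * #|` L `&` Hs j|%:R.
  have -> : U `&` Hs j = U `&` (L `&` Hs j) by rewrite fsetIA (fsetIidPl UL).
  move=> Aj.
  apply: (cyclic_band R Hs_chain sH vA xr Kn K0) => // y yL yF.
  (* In the window starting at -tri n, an exponent outside the interval is one of 1, ..., r - tri n
     - 1, hence exceptional. *)
  have [k kP yk] := cyc_extP y (- (tri n)%:Z) sH xr yL.
  rewrite (coset k y kP yk) card_sumset1; case: ifP => // /negbT kn.
  move/negP: yF; case; apply/sumsetP; exists (y - x *~ k), (x *~ k); rewrite subrK.
  split; [exact: yk| |by []].
  have k0 : (0 <= k)%R by clear -kP kn; lia.
  rewrite -(gez0_abs k0) -pmulrn; apply: in_imfset; rewrite /= mem_iota.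
  by clear -kP kn k0 nr; lia.
have de : sdens R Hs A <= #|` U|%:R / #|` L|%:R + K%:R^-1 by
  rewrite d3 -addrA lerDl addrC subr_ge0 (le_trans _ d1)// ler_piMl// divr_ge0.
have [A' [T [pA' AA' dA' _ _]]] := extend Hs_chain vA sL HL erefl uB BP UH band (ltW Ki) de.
exists A'; split=> //; rewrite dA' d3 lerD2l lerN2 ler_wpM2l//.
Qed.

(** The interval from -m to t and its translate by j = N - D cover exactly the window of r exponents
    starting at -m. Every coset receives at least one of S, S + z, and the D cosets of the overlap
    receive both. These lie among 1, ..., t, so they can be ignored at intermediate levels. Since z
    has small overlap, the gain is at least (D / r) d (1 - d) for the density d. *)
Lemma long_ascend K (A : state G) : (1 < K)%N -> valid Hs A -> sdens R Hs A < 1 ->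
  exists A', [/\ reach Hs (sdens R Hs A - K%:R^-1) (sdens R Hs A + K%:R^-1) K%:R^-1 A A',
    (A.1 < A'.1)%N &
    sdens R Hs A + sdens R Hs A * (1 - sdens R Hs A) / (4 * K)%:R <= sdens R Hs A'].
Proof.
move=> K1 vA dA1; have sH := chain_sg Hs_chain A.1; set H := Hs A.1 in sH *.
have K0 : (0 < K)%N by rewrite ltnW.
have [x [r [xr rK]]] := long_order Hs_chain long_orders (1024 * K * K) sH.
have [a [b [ab1 ab2 Kt rD]]] := tri_ascent K1 rK; have [r0 _ _] := xr.
set m := tri a in ab1 ab2 rD; set t := tri b in ab1 ab2 Kt rD.
pose D := (2 * m + 2 * t + 2 - r)%N; rewrite -/D in rD.
pose N := (m + t).+1.
have ND : (N + N = r + D)%N by rewrite /N /D; clear -ab1 ab2; lia.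
have Nr : (N <= r)%N by rewrite /N; clear -ab1; lia.
have Dr : (D <= r)%N by clear -ND Nr; lia.
have D1 : (m < N - D)%N by rewrite /N /D; clear -ab1; lia.
clearbody D; clear ab1 ab2.
pose S := psums A.2; have SH : S `<=` H := valid_sub Hs_chain vA.
have H0 : 0 < #|` H|%:R :> R by rewrite ltr0n (card_gt0 (sg0 sH)).
have [z zH zS] := exists_small_overlap sH SH; set o := #|` _| in zS.
(* For z = 0 the overlap would be S itself, against density less than 1. A nonzero z keeps the new
   element jx + z distinct from the multiples of x in the list. *)
have z0 : z != 0.
  apply: contraTneq zS => z0; rewrite /o z0 sumset0l fsetIid -ltnNge.
  rewrite ltn_mul2l card_fset_sum1 -card_fset_sum1 (card_gt0 (psums0 A.2)) /=.
  by move: dA1; rewrite sdensE// ltr_pdivrMr// mul1r ltr_nat.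
pose l := negints a ++ posints b.
have lP0 : forall k, (k \in psums l) = (- m%:Z <= k <= t%:Z).
  by apply: psums_negints_cat => // k; exact: psums_posints.
have lP : forall k, (k \in psums l) = (- m%:Z <= k < - m%:Z + N%:Z).
  by move=> k; rewrite lP0 /N; clear; lia.
have l0 : 0 \notin l by rewrite mem_cat mem_negints mem_posints; clear; lia.
have ul : uniq l.
  rewrite cat_uniq uniq_negints uniq_posints /= andbT; apply/hasPn => k.
  by rewrite mem_negints mem_posints; clear; lia.
have lo0 : - m%:Z <= 0 < - m%:Z + N%:Z by rewrite /N; clear; lia.
have [uB1 BP1] := mulz_list sH xr Nr ul l0 lo0 lP.
(* The shift j makes the translated interval end at the last exponent -m + r - 1 of the window. *)
set B1 := [seq _ | _ <- _] in uB1 BP1; have [j jE] : exists j : int, j = N%:Z - D%:Z by eexists.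
have sL := sg_cyc_ext sH xr; have HL := sub_cyc_ext sH xr.
set L := cyc_ext H x r in BP1 sL HL.
pose B := (x *~ j + z) :: B1; pose P := sumset S (psums B1).
have jP : - m%:Z <= j < - m%:Z + r%:Z by rewrite jE; clear -ND Nr D1; lia.
have BP b0 : b0 \in B -> (b0 \in L) && (b0 \notin H).
  rewrite inE => /predU1P[->|/BP1//]; rewrite (sgDl _ sH zH); apply/andP; split.
    by apply/(cyc_extP _ (- m%:Z) sH xr); exists j; rewrite // addrAC subrr add0r.
  apply/negP => jH; suff : j = 0 by rewrite jE; clear -D1; lia.
  apply: (order_mod_inj sH xr jP); first by clear -lo0 Nr; lia.
  by rewrite mulr0z subr0.
have uB : uniq B.
  rewrite /= uB1 andbT; apply/negP => /mapP[k kl E]; move/negP: z0; apply.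
  have kP := mem_psums kl; rewrite lP in kP.
  have zE : x *~ j - x *~ k = - z by rewrite -E opprD addrA subrr sub0r.
  have jk : j = k.
    by apply: (order_mod_inj sH xr jP); [clear -kP Nr; lia|rewrite zE sgNE].
  by move: zE; rewrite jk subrr => /esym/eqP; rewrite oppr_eq0.
pose U := sumset S (psums B).
have UPE : U = P `|` sumset [fset x *~ j + z] P.
  rewrite /U /B /= sumsetA [sumset S _]sumsetC -sumsetA -/P.
  by rewrite -[[fset 0; _]]/([fset 0] `|` [fset x *~ j + z]) sumsetUl sumset0l.
pose S' := sumset [fset z] S.
have SH' : S' `<=` H by apply: sumset_sub => //; rewrite fsub1set.
have UE u : u \in U <->
    (exists s i, [/\ s \in S, - m%:Z <= i <= t%:Z & u = s + x *~ i]) \/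
    (exists s i, [/\ s \in S', j - m%:Z <= i <= j + t%:Z & u = s + x *~ i]).
  rewrite UPE in_fsetU mem_sumset1; split.
    move=> /orP[|] /(mulz_intervalP _ _ _ lP0)[s [i [sS iP E]]]; [left|right].
      by exists s, i.
    exists (z + s), (j + i); split; rewrite ?mem_sumset ?inE//; first by clear -iP; lia.
    rewrite -[LHS](subrK (x *~ j + z)) E mulrzDr [x *~ j + z]addrC addrACA.
    by rewrite [s + z]addrC [x *~ i + _]addrC.
  move=> [|] [s [i [sS iP ->]]]; apply/orP; [left|right].
    by apply/(mulz_intervalP _ _ _ lP0); exists s, i.
  move: sS; rewrite mem_sumset1 => sS.
  apply/(mulz_intervalP _ _ _ lP0); exists (s - z), (i - j); split=> //.
    by clear -iP; lia.
  by rewrite mulrzBr opprD [- _ - z]addrC addrACA.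
have pq1 : - m%:Z <= - m%:Z by [].
have pq2 : t%:Z < - m%:Z + r%:Z by clear -ND D1; rewrite /N in ND D1; lia.
have pq3 : - m%:Z <= j - m%:Z by rewrite jE; clear -D1; lia.
have pq4 : j + t%:Z < - m%:Z + r%:Z by rewrite jE /N; clear -ND; rewrite /N in ND; lia.
have coset k y : - m%:Z <= k < - m%:Z + r%:Z -> y - x *~ k \in H ->
    U `&` sumset [fset y] H = sumset [fset x *~ k]
      ((if - m%:Z <= k <= t%:Z then S else fset0) `|`
       (if j - m%:Z <= k <= j + t%:Z then S' else fset0)).
  by move=> kP yk; exact: (layers_coset sH xr SH SH' UE pq1 pq2 pq3 pq4 kP yk).
have UH : U `&` H = S.
  rewrite -{1}(sumset0l H) (coset 0 0) ?mulr0z ?subr0 ?sg0 ?sumset0l//; last first.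
    by clear -lo0 Nr; lia.
  have -> : (- m%:Z <= 0 <= t%:Z) by clear; lia.
  have -> : (j - m%:Z <= 0 <= j + t%:Z) = false by rewrite jE; clear -D1; lia.
  by rewrite fsetU0.
have UL : U `<=` L.
  apply: sumset_sub => //; first exact: fsubset_trans HL.
  by apply: psums_sub => // b0 /BP/andP[].
have Ki : 0 < K%:R^-1 :> R by rewrite invr_gt0 ltr0n.
have band i : (A.1 <= i)%N -> (sdens R Hs A - K%:R^-1) * #|` L `&` Hs i|%:R <=
    #|` U `&` Hs i|%:R <= (sdens R Hs A + K%:R^-1) * #|` L `&` Hs i|%:R.
  have -> : U `&` Hs i = U `&` (L `&` Hs i) by rewrite fsetIA (fsetIidPl UL).
  move=> Ai; apply: (cyclic_band R Hs_chain sH vA xr Kt K0) => // y yL yF.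
  have [k kP yk] := cyc_extP y (- m%:Z) sH xr yL.
  rewrite (coset k y kP yk) card_sumset1.
  (* Off the exceptional cosets exactly one layer is present: the first for k <= 0, the second for k
     > t. *)
  have kF : ~~ (1 <= k <= t%:Z).
    apply: contra yF => kt; apply/sumsetP; exists (y - x *~ k), (x *~ k).
    rewrite subrK; split; [exact: yk| |by []].
    have k0 : (0 <= k)%R by clear -kt; lia.
    rewrite -(gez0_abs k0) -pmulrn; apply: in_imfset; rewrite /= mem_iota.
    by clear -kt k0; lia.
  have [k0|k0] := lerP k 0.
    have -> : (- m%:Z <= k <= t%:Z) by clear -k0 kP; lia.
    have -> : (j - m%:Z <= k <= j + t%:Z) = false by rewrite jE; clear -D1 k0; lia.
    by rewrite fsetU0.
  have -> : (- m%:Z <= k <= t%:Z) = false by clear -kF k0; lia.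
  have -> : (j - m%:Z <= k <= j + t%:Z).
    by rewrite jE; clear -kF k0 kP ND; rewrite /N in ND *; lia.
  by rewrite fset0U card_sumset1.
have cU : (2 * #|` S| * N <= #|` U| + D * o)%N.
  have cP : #|` P| = (#|` S| * N)%N.
    rewrite /P (psums_zmultiples _ lP) (card_sumset_mod sH SH); last exact: inj_zmultiples xr _.
    by rewrite (card_zmultiples _ sH xr).
  (* Doubly counted elements lie over the D exponents of the overlap, with first component in both S
     and S + z. *)
  have PI : P `&` sumset [fset x *~ j + z] P `<=`
      sumset (S `&` S') (zmultiples x (j - m%:Z) D).
    apply/fsubsetP => u /fsetIP[uP]; rewrite mem_sumset1 => uP'.
    move: uP => /(mulz_intervalP _ _ _ lP0)[s [i [sS iP E]]].
    move: uP' => /(mulz_intervalP _ _ _ lP0)[s' [i' [sS' iP' E']]].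
    have E2 : s + x *~ i = s' + z + x *~ (i' + j).
      rewrite -E -[LHS](subrK (x *~ j + z)) E' mulrzDr [x *~ j + z]addrC.
      by rewrite addrACA.
    have ii : i = i' + j.
      apply: (order_mod_inj (lo := - m%:Z) sH xr); first by clear -iP pq2; lia.
        by clear -iP' pq4 pq3; lia.
      have -> : x *~ i - x *~ (i' + j) = s' + z - s.
        by apply/eqP; rewrite subr_eq addrAC -E2 addrAC subrr add0r.
      by rewrite sgB ?sgD// (fsubsetP SH).
    have ss : s = s' + z by move: E2; rewrite ii => /addIr.
    rewrite E; apply: mem_sumset.
      by rewrite in_fsetI sS mem_sumset1 ss addrK.
    apply/zmultiplesP; exists i => //; rewrite ii jE; clear -iP' iP ii jE.
    by rewrite ii jE /N in iP *; lia.
  have := cardfsUI P (sumset [fset x *~ j + z] P); rewrite -UPE card_sumset1 cP.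
  have := fsubset_leq_card PI; rewrite (card_sumset_mod (H := H) sH); last 2 first.
  - exact: (fsubset_trans (fsubsetIl _ _) SH).
  - exact: (inj_zmultiples sH xr Dr).
  rewrite (card_zmultiples _ sH xr Dr) -/S' -/o => c1 c2.
  by move: c1; rewrite -mulnA [(D * o)%N]mulnC; move: c2; clear; lia.
have dU : #|` U|%:R / #|` L|%:R >= sdens R Hs A + sdens R Hs A * (1 - sdens R Hs A) / (4 * K)%:R.
  have rR : 0 < r%:R :> R by rewrite ltr0n.
  have q1 : (4 * K)%:R^-1 <= D%:R / r%:R :> R.
    rewrite ler_pdivlMr// mulrC ler_pdivrMr ?ltr0n ?muln_gt0// -natrM ler_nat.
    by rewrite mulnC.
  have q2 : o%:R / #|` H|%:R <= sdens R Hs A ^+ 2.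
    rewrite sdensE// expr_div_n ler_pdivrMr// expr2 [X in _ / X]expr2 invfM mulrA divfK ?gt_eqF//.
    by rewrite ler_pdivlMr// -!natrM ler_nat.
  have q3 : sdens R Hs A + D%:R / r%:R * (sdens R Hs A - o%:R / #|` H|%:R) <=
      #|` U|%:R / #|` L|%:R.
    have hr : 0 < #|` H|%:R * r%:R :> R by rewrite mulr_gt0.
    rewrite /L card_cyc_ext// natrM ler_pdivlMr// sdensE//.
    have -> : (#|` S|%:R / #|` H|%:R + D%:R / r%:R * (#|` S|%:R / #|` H|%:R - o%:R / #|` H|%:R)) *
       (#|` H|%:R * r%:R) = #|` S|%:R * (r%:R + D%:R) - D%:R * o%:R :> R.
      by field; rewrite !gt_eqF.
    rewrite -natrD -ND lerBlDr -!natrM -natrD ler_nat; move: cU; clear.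
    by rewrite -mulnA mulnDr; lia.
  apply: le_trans q3; rewrite lerD2l mulrC; apply: ler_pM => //.
  - by apply: mulr_ge0; [exact: dens_ge0|rewrite subr_ge0 ltW].
  - by rewrite mulrBr mulr1 lerD2l lerN2 -expr2.
have de : sdens R Hs A <= #|` U|%:R / #|` L|%:R + K%:R^-1.
  apply: (le_trans _ (lerD dU (ltW Ki))); rewrite addr0 lerDl.
  by apply: divr_ge0 => //; apply: mulr_ge0; [exact: dens_ge0|rewrite subr_ge0 ltW].
have [A' [T [pA' AA' dA' _ _]]] := extend Hs_chain vA sL HL erefl uB BP UH band (ltW Ki) de.
by exists A'; split=> //; rewrite dA'.
Qed.

End LongCycleMoves.

(** * Sweeps of the target interval *)

Section Steps.
Variables (R : realType) (G : zmodType) (Hs : nat -> {fset G}) (al be : R).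
Hypothesis Hs_chain : chain Hs.
Hypothesis ab : 0 <= al <= be.
Hypothesis be1 : be <= 1.

(* [good e] are the states whose density is within [e] of the target interval;
   a step sweeps the interval and ends in a better state. *)
Definition sweeping (good : R -> state G -> Prop) :=
  [/\ forall e A, good e A -> valid Hs A, exists A, good 1 A &
   forall e e' A, 0 < e' -> e' <= e -> good e A -> exists A',
    [/\ reach Hs (al - 3 * e) (be + 3 * e) (3 * e) A A', (A.1 < A'.1)%N, good e' A' &
     forall g, al <= g <= be -> exists2 j, (A.1 <= j <= A'.1)%N &
       `|dens R Hs j (psums A'.2) - g| <= 3 * e]].

Lemma reach_end (lo hi e : R) (A B : state G) : reach Hs lo hi e A B ->
  lo <= sdens R Hs B <= hi.
Proof. by move=> [_ AB _ _ [/(_ B.1) + _]]; rewrite AB leqnn; exact. Qed.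

Lemma reach_valid (lo hi e : R) (A B : state G) : reach Hs lo hi e A B -> valid Hs B.
Proof. by case. Qed.

(** The gap clause covers g between the two end densities; a g slightly outside is approximated at
    the nearer end level. *)
Lemma reach_ends (lo hi e : R) (A B : state G) (g d : R) : reach Hs lo hi e A B ->
  sdens R Hs B <= g + d -> g - d <= sdens R Hs A -> e <= d ->
  exists2 j, (A.1 <= j <= B.1)%N & `|dens R Hs j (psums B.2) - g| <= d.
Proof.
move=> rAB gB gA ed; have [_ AB _ _ [_ cover]] := rAB.
have [gA'|gA'] := lerP g (sdens R Hs A); last first.
  exists A.1; first by rewrite leqnn.
  by rewrite (dens_reach Hs_chain rAB)// -/(sdens R Hs A) ler_norml; lra.
have [gB'|gB'] := lerP (sdens R Hs B) g; last first.
  by exists B.1; rewrite ?leqnn ?andbT// -/(sdens R Hs B) ler_norml; lra.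
by have [|j jP jg] := cover g; [rewrite gB'|exists j => //; exact: le_trans ed].
Qed.

Lemma inv_nat_le (e : R) : 0 < e -> exists2 K, (1 < K)%N & K%:R^-1 <= e.
Proof.
move=> e0; exists (Num.truncn e^-1).+2 => //.
rewrite -[e in leRHS]invrK lef_pV2 ?posrE ?invr_gt0//.
by apply: (le_trans (ltW (truncnS_gt _))); rewrite ler_nat.
Qed.

Hypothesis long_orders : forall (H : {fset G}) r, subgroup H ->
  exists x : G, forall i, (0 < i < r)%N -> x *+ i \notin H.

(** Ascend until the density is at least be - e' / 2, then descend until it is at most al + e'. The
    factor 3 leaves room for the initial error e and for the error 1 / K <= e' / 2 of a single
    move. *)
Lemma sweeping_long : sweeping
  (fun e A => valid Hs A /\ al - e <= sdens R Hs A <= be + e).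
Proof.
have [al0 alb] := andP ab; have beq := be1.
split; first by move=> e A [].
  exists (0%N, [::]); have vA : valid Hs (0%N, [::] : seq G) by split.
  split=> //; have := dens_ge0 R Hs 0 (psums [::]).
  by have := dens_le1 R Hs_chain 0 (psums [::]); rewrite /sdens /=; lra.
move=> e e' A e'0 e'e [vA dA]; have dA0 := sdens_gt0 R Hs_chain vA.
have [K K1 Ke] : exists2 K, (1 < K)%N & (K%:R : R)^-1 <= e' / 2.
  by apply: inv_nat_le; rewrite divr_gt0.
have K4 : 0 < (4 * K)%:R :> R by rewrite ltr0n; clear -K1; lia.
have Ki : 0 < (K%:R : R)^-1 by rewrite invr_gt0 ltr0n ltnW.
have tr := @reach_trans R G Hs Hs_chain (al - 3 * e) (be + 3 * e) (3 * e).
(* Keeping the density at least [sdens A], which is positive because 0 is a subset sum, bounds the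
   gain of every ascent below by one constant; while the density is under be - e' / 2, its distance
   to 1 is at least e' / 2. *)
pose P1 B := valid Hs B /\ sdens R Hs A <= sdens R Hs B <= be + e.
have [|||||A1 [rA1 [vA1 dA1] dA1e]] := @iterate_down R G _ P1
    (fun B => 1 - sdens R Hs B) (sdens R Hs A * (e' / 2) / (4 * K)%:R)
    (1 - (be - e' / 2)) tr _ _ _ _ A.
- by move=> B [vB dB]; apply: reach_refl => //; lra.
- by rewrite divr_gt0// mulr_gt0// divr_gt0.
- by move=> B _; rewrite subr_ge0; exact: dens_le1.
- move=> B [vB dB] dBe; have dB1 : sdens R Hs B < 1 by lra.
  have [C [rBC BC dC]] := long_ascend Hs_chain long_orders K1 vB dB1.
  have := reach_end rBC => dC'.
  have up : sdens R Hs A * (e' / 2) / (4 * K)%:R <=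
      sdens R Hs B * (1 - sdens R Hs B) / (4 * K)%:R.
    by rewrite ler_pM2r ?invr_gt0//; apply: ler_pM; lra.
  have up0 : 0 <= sdens R Hs A * (e' / 2) / (4 * K)%:R.
    by rewrite divr_ge0 ?(ltW K4)// mulr_ge0 ?(ltW dA0)// divr_ge0// ltW.
  exists C; split; last by lra.
    by apply: reach_weaken rBC; lra.
  by split; [exact: reach_valid rBC|lra].
- by split=> //; lra.
(* Both loops may be empty; this unconditional descent guarantees that the level increases. *)
have [A2 [rA2 A12 dA2]] := long_descend R Hs_chain long_orders (ltnW K1) vA1.
have dA20 : 0 <= sdens R Hs A1 / (4 * K)%:R.
  by rewrite divr_ge0 ?(ltW K4)// ltW// sdens_gt0.
have dA2' := reach_end rA2.
pose P2 B := valid Hs B /\ al - e' <= sdens R Hs B <= be + e.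
have [|||||A3 [rA3 [vA3 dA3] dA3e]] := @iterate_down R G _ P2
    (sdens R Hs) (e' / (4 * K)%:R) (al + e') tr _ _ _ _ A2.
- by move=> B [vB dB]; apply: reach_refl => //; lra.
- by rewrite divr_gt0.
- by move=> B _; exact: dens_ge0.
- move=> B [vB dB] dBe.
  have [C [rBC BC dC]] := long_descend R Hs_chain long_orders (ltnW K1) vB.
  have := reach_end rBC => dC'.
  have down : e' / (4 * K)%:R <= sdens R Hs B / (4 * K)%:R.
    by rewrite ler_pM2r ?invr_gt0//; lra.
  have down0 : 0 <= e' / (4 * K)%:R by rewrite divr_ge0 ?(ltW K4)// ltW.
  exists C; split; last by lra.
    by apply: reach_weaken rBC; lra.
  by split; [exact: reach_valid rBC|lra].
- by split; [exact: reach_valid rA2|lra].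
have rA13 : reach Hs (al - 3 * e) (be + 3 * e) (3 * e) A1 A3.
  by apply: tr rA3; apply: reach_weaken rA2; lra.
have [_ A1l _ _ _] := rA1; have [_ A3l _ _ _] := rA3.
exists A3; split.
- exact: tr rA13.
- by rewrite (leq_ltn_trans A1l)// (leq_trans A12).
- by split=> //; lra.
move=> g gP; have [|||j /andP[j1 j3] jg] := @reach_ends _ _ _ A1 A3 g (3 * e) rA13; try by lra.
by exists j; rewrite // j3 (leq_trans A1l).
Qed.

End Steps.

(** * Independent elements of a fixed order *)

Section TwoRows.
Variable G : zmodType.
Implicit Types (H K X S U V W : {fset G}) (x y h w e : G).
Local Open Scope fset_scope.
Local Open Scope ring_scope.

Definition disjoint_sg H X := forall x, x \in H -> x \in X -> x = 0.

Lemma disjoint_inj_mod H X : subgroup X -> disjoint_sg H X -> inj_mod H X.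
Proof.
move=> sX HX x y xX yX E; apply/eqP; rewrite -subr_eq0; apply/eqP.
by apply: HX => //; exact: sgB.
Qed.

Lemma disjoint_sumset H V X : subgroup H -> subgroup V -> disjoint_sg H V ->
  disjoint_sg (sumset H V) X -> disjoint_sg H (sumset V X).
Proof.
move=> sH sV HV HVX _ /[swap] /sumsetP[v [x [vV xX ->]]] vxH.
have x0 : x = 0.
  apply: HVX => //; rewrite -(addKr v x) addrC; apply: mem_sumset => //; exact: sgN.
by move: vxH; rewrite x0 !addr0 => vH; exact: HV.
Qed.

Lemma card_direct H X S Y : subgroup H -> subgroup X -> disjoint_sg H X ->
  S `<=` H -> Y `<=` X -> #|` sumset S Y| = (#|` S| * #|` Y|)%N.
Proof.
move=> sH sX HX SH YX; apply: (card_sumset_mod sH) => // x y xY yY.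
by apply: (disjoint_inj_mod sX HX); exact: (fsubsetP YX).
Qed.

Lemma card_fibers H X U : subgroup H -> inj_mod H X -> U `<=` sumset H X ->
  #|` U| = (\sum_(x <- X) #|` U `&` sumset [fset x] H|)%N.
Proof.
move=> sH HX /fsubsetP UHX.
have E x : #|` U `&` sumset [fset x] H| = (\sum_(u <- U) ((u - x)%R \in H))%N.
  rewrite -sum1_size -big_mkcond /= -[RHS]big_filter.
  apply/perm_big/uniq_perm; rewrite ?filter_uniq ?fset_uniq// => u.
  by rewrite mem_filter in_fsetI mem_sumset1 andbC.
rewrite (eq_bigr _ (fun x _ => E x)) exchange_big /= -sum1_size.
rewrite big_seq [RHS]big_seq; apply: eq_bigr => u /UHX /sumsetP[h [x [hH xX ->]]].
rewrite (bigD1_seq x) ?fset_uniq//= addrK hH big_seq_cond big1 ?addn0// => y.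
move=> /andP[yX yx]; apply/eqP; rewrite eqb0; apply: contra yx => yH.
by apply/eqP/esym; apply: HX => //; move: yH; rewrite -addrA (sgDr _ sH hH).
Qed.

(* If [psums l = X `\ w], these are the subset sums of [l] and [w' - w + h]. *)
Definition two_rows X w w' h := (X `\ w) `|` sumset [fset h] (X `\ w').

(** The coset of w carries only h + S, that of w' only S, and every other coset carries both; only
    two cosets are defective. *)
Lemma two_rows_fiber H X S w w' h x : subgroup H -> inj_mod H X -> S `<=` H ->
  h \in H -> x \in X ->
  sumset S (two_rows X w w' h) `&` sumset [fset x] H = sumset [fset x]
    ((if x != w then S else fset0) `|` (if x != w' then sumset [fset h] S else fset0)).
Proof.
move=> sH HX /fsubsetP SH hH xX; apply/fsetP => z.
rewrite in_fsetI !mem_sumset1 in_fsetU; apply/andP/orP.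
  move=> [/sumsetP[s [y [sS yR ->]]]]; have sH0 := SH _ sS.
  rewrite -addrA (sgDr _ sH sH0); move: yR; rewrite in_fsetU mem_sumset1 !in_fsetD1.
  move=> /orP[|] /andP[yw yX] yxH; [left|right].
    by rewrite -(HX _ _ yX xX yxH) yw subrr addr0.
  have E : y - h = x by apply: HX; rewrite // addrAC (sgDl _ sH)// sgN.
  by rewrite -E yw mem_sumset1 subKr addrK.
case; case: ifP => // xw zS.
  split; last exact: SH.
  rewrite -(subrK x z); apply: mem_sumset => //.
  by rewrite in_fsetU in_fsetD1 xw xX.
move: zS; rewrite mem_sumset1 => zS; split; last first.
  by rewrite -(subrK h (z - x)) sgD// SH.
rewrite -(subrK x z) -[z - x](subrK h) -addrA; apply: mem_sumset => //.
by rewrite in_fsetU mem_sumset1 !in_fsetD1 [h + x]addrC addrK xw xX orbT.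
Qed.

Lemma two_rows_cardE H X S w w' h : subgroup H -> inj_mod H X -> S `<=` H ->
  h \in H -> w \in X -> w' \in X -> w != w' ->
  (#|` sumset S (two_rows X w w' h)| =
     2 * #|` S| + (#|` X| - 2) * #|` S `|` sumset [fset h] S|)%N.
Proof.
move=> sH HX SH hH wX w'X ww'.
have sub : sumset S (two_rows X w w' h) `<=` sumset H X.
  apply/fsubsetP => z /sumsetP[s [y [sS + ->]]]; rewrite in_fsetU mem_sumset1 !in_fsetD1.
  have sH0 := fsubsetP SH _ sS.
  move=> /orP[/andP[_ yX]|/andP[_ yX]]; first exact: mem_sumset.
  by rewrite -(subrK h y) [y - h + h]addrC addrA mem_sumset// sgD.
rewrite (card_fibers sH HX sub).
have E x : x \in X -> #|` sumset S (two_rows X w w' h) `&` sumset [fset x] H| =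
    #|` (if x != w then S else fset0) `|` (if x != w' then sumset [fset h] S else fset0)|.
  by move=> xX; rewrite (two_rows_fiber w w' sH HX SH hH xX) card_sumset1.
rewrite big_seq (eq_bigr _ E) -big_seq (big_fsetD1 w)//= (big_fsetD1 w')/=; last first.
  by rewrite in_fsetD1 eq_sym ww' w'X.
rewrite !eqxx ww' [w' == w]eq_sym (negPf ww') /= fset0U fsetU0 card_sumset1.
rewrite addnA mul2n addnn; congr (_ + _)%N.
have -> : (#|` X| - 2)%N = #|` (X `\ w) `\ w'|.
  by rewrite (cardfsD1 w X) wX (cardfsD1 w' (X `\ w)) in_fsetD1 eq_sym ww' w'X add1n add1n subn2.
rewrite big_seq (eq_bigr (fun=> #|` S `|` sumset [fset h] S|)); last first.
  by move=> x; rewrite !in_fsetD1 => /and3P[-> -> _].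
by rewrite -big_seq big_const_seq count_predT iter_addn_0 mulnC.
Qed.

Lemma two_rows_fiber_bounds H X S w w' h y : subgroup H -> inj_mod H X -> S `<=` H ->
  h \in H -> w != w' -> y \in sumset H X ->
  (#|` S| <= #|` sumset S (two_rows X w w' h) `&` sumset [fset y] H|
     <= #|` S `|` sumset [fset h] S|)%N.
Proof.
move=> sH HX SH hH ww' /sumsetP[k [x [kH xX ->]]].
have -> : sumset [fset k + x] H = sumset [fset x] H.
  apply/fsetP => z; rewrite !mem_sumset1 [k + x]addrC opprD addrA.
  by rewrite (sgDl _ sH (sgN sH kH)).
rewrite (two_rows_fiber w w' sH HX SH hH xX) card_sumset1; apply/andP; split; last first.
  apply: fsubset_leq_card; rewrite fsubUset; apply/andP; split; case: ifP => _;
    by rewrite ?fsub0set ?fsubsetUl ?fsubsetUr.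
have [->|xw] /= := eqVneq x w.
  by rewrite ww' fset0U card_sumset1.
by apply: fsubset_leq_card; exact: fsubsetUl.
Qed.

End TwoRows.

Section ShortCycles.
Variables (R : realType) (G : zmodType) (Hs : nat -> {fset G}) (q : nat).
Implicit Types (H K L X S T U V W Y : {fset G}) (x y h w e : G).
Local Open Scope fset_scope.
Local Open Scope ring_scope.

Hypothesis Hs_chain : chain Hs.
Hypothesis q3 : (2 < q)%N.
Hypothesis split_orders : forall H, subgroup H ->
  exists2 e, e *+ q = 0 & forall i, (0 < i < q)%N -> e *+ i \notin H.

Lemma new_cycle H : subgroup H -> exists X w l,
  [/\ subgroup X, #|` X| = q, disjoint_sg H X, w \in X & w != 0] /\
   [/\ uniq l, {subset l <= X}, 0 \notin l & psums l = X `\ w].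
Proof.
move=> sH; have q0 : (0 < q)%N by rewrite (ltn_trans _ q3).
have [e eq0 eH] := split_orders sH.
have e1 : order_mod [fset 0] e q.
  split=> //; first by rewrite eq0 inE.
  by move=> i /eH; apply: contra => /fset1P ->; exact: sg0.
have eHq : order_mod H e q by split=> //; rewrite eq0 sg0.
have XE : cyc_ext [fset 0] e q = cyc e q by exact: sumset0l.
have [l [lo [ul l0 loP lP]]] := @interval_psums q.-1 ltac:(clear -q3; lia).
have loq : (lo + q.-1%:Z)%R - lo = q%:Z - 1 by clear -q3; lia.
pose w := e *~ (lo + q.-1%:Z).
have memX y : reflect (exists2 k : int, lo <= k < lo + q%:Z & y = e *~ k) (y \in cyc e q).
  rewrite -XE; apply: (iffP (cyc_extP y lo (sg1 G) e1)) => -[k kP].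
    by rewrite inE subr_eq0 => /eqP ->; exists k.
  by move=> ->; exists k; rewrite // subrr inE.
have wX : w \in cyc e q by apply/memX; exists (lo + q.-1%:Z) => //; clear -q3; lia.
have inj k k' : lo <= k < lo + q%:Z -> lo <= k' < lo + q%:Z -> e *~ k = e *~ k' -> k = k'.
  by move=> kP kP' E; apply: (order_mod_inj (sg1 G) e1 kP kP'); rewrite E subrr inE.
have [uB BP] := mulz_list (sg1 G) e1 (leq_pred q) ul l0 loP lP.
exists (cyc e q), w, [seq e *~ k | k <- l]; split; first split=> //.
- by rewrite -XE; exact: (sg_cyc_ext (sg1 G) e1).
- by rewrite -XE (card_cyc_ext (sg1 G) e1) cardfs1 mul1n.
- move=> x xH /imfsetP[i /=]; rewrite mem_iota add0n => iq xE.
  move: xH; rewrite xE; case: i iq {xE} => [|i] iq; first by rewrite mulr0n.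
  by move=> H'; have := eH i.+1; rewrite H' iq => /(_ isT).
- apply/eqP => w0; have : lo + q.-1%:Z = 0.
    by apply: inj; rewrite ?mulr0z//; clear -q3 loP; lia.
  by clear -loP; lia.
split=> //; first by move=> b /BP; rewrite XE => /andP[].
  by apply/negP => /BP; rewrite inE eqxx andbF.
rewrite (psums_zmultiples _ lP); apply/fsetP => y; rewrite in_fsetD1.
apply/zmultiplesP/andP => [[k kP ->]|[yw /memX[k kP yE]]].
  split; last by apply/memX; exists k => //; clear -kP; lia.
  apply/negP => /eqP /inj E; have : k = lo + q.-1%:Z by apply: E; clear -kP q3; lia.
  by clear -kP; lia.
exists k => //; have : k != lo + q.-1%:Z by apply: contra yw => /eqP E; rewrite yE E.
by clear -kP q3; lia.
Qed.

(** Adding w' - w to X \ w moves the gap from w to w', since X is a subgroup; the extra h separates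
    the second row. Containment in K + X for every subgroup K containing h, not only K = H, allows
    the list to be placed in smaller subgroups. *)
Lemma two_rows_list H X w w' h (l : seq G) : subgroup H -> subgroup X ->
  disjoint_sg H X -> w \in X -> w' \in X -> w != w' -> h \in H -> h != 0 ->
  uniq l -> {subset l <= X} -> 0 \notin l -> psums l = X `\ w ->
  exists B, [/\ uniq B, psums B = two_rows X w w' h, forall b, b \in B -> b \notin H &
    forall K, subgroup K -> h \in K -> {subset B <= sumset K X}].
Proof.
move=> sH sX HX wX w'X ww' hH h0 ul lX l0 lE.
have cX : w' - w \in X by exact: sgB.
exists (w' - w + h :: l); split.
- rewrite /= ul andbT; apply: contra h0 => /lX; rewrite (sgDr _ sX cX) => hX.
  by apply/eqP; exact: HX.
- rewrite /= lE -[[fset 0; _]]/([fset 0] `|` [fset w' - w + h]) sumsetUl sumset0l.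
  congr (_ `|` _); apply/fsetP => y; rewrite !mem_sumset1 !in_fsetD1.
  rewrite [w' - w + h]addrC opprD addrA opprB (sgDl _ sX); last by rewrite -opprB sgN.
  by congr (~~ _ && _); rewrite addrA subr_eq addrC -[RHS](inj_eq (addrI w)) addrC.
- move=> b; rewrite inE => /predU1P[->|bl].
    rewrite (sgDl _ sH hH); apply/negP => cH; move/negP: ww'; apply.
    by rewrite eq_sym -subr_eq0; apply/eqP; exact: HX.
  apply/negP => bH; move/negP: l0; apply; rewrite -(HX b bH (lX _ bl))//.
- move=> K sK hK b; rewrite inE => /predU1P[->|/lX bX].
    by rewrite addrC mem_sumset.
  by rewrite -[b]add0r mem_sumset ?sg0.
Qed.

End ShortCycles.

Section ShortCycleMoves.
Variables (R : realType) (G : zmodType) (Hs : nat -> {fset G}) (q : nat).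
Implicit Types (H K L X S T U V W Y : {fset G}) (x y h w e : G).
Local Open Scope fset_scope.
Local Open Scope ring_scope.

Hypothesis Hs_chain : chain Hs.
Hypothesis q3 : (2 < q)%N.
Hypothesis split_orders : forall H, subgroup H ->
  exists2 e, e *+ q = 0 & forall i, (0 < i < q)%N -> e *+ i \notin H.

(** One shift h is kept throughout. If W and h + W cover V, then W plus two rows over a new X fills
    all fibres but those of 0 and w, which are W and h + W and miss 2^k elements each. So the
    missing number doubles while the group grows by q, and the two translates by h still cover. *)
Lemma thin_block k H : subgroup H -> exists V W h (B : seq G),
  [/\ subgroup V, disjoint_sg H V, #|` V| = (q ^ k.+1)%N, h \in V & h != 0] /\
  [/\ uniq B, {subset B <= V}, 0 \notin B, psums B = W &
   W `|` sumset [fset h] W = V /\ (#|` W| + 2 ^ k = q ^ k.+1)%N].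
Proof.
move=> sH; elim: k => [|k [V [W [h [B [[sV HV cV hV h0] [uB BV B0 BW [WV cW]]]]]]]].
  have [X [w [l [[sX cX HX wX w0] [ul lX l0 lE]]]]] := new_cycle q3 split_orders sH.
  exists X, (X `\ w), w, l; split; first by split; rewrite ?cX ?expn1.
  split=> //; split; last by rewrite expn0 expn1 -cX (cardfsD1 w X) wX addnC.
  apply/fsetP => y; rewrite in_fsetU mem_sumset1 !in_fsetD1 (sgDl _ sX (sgN sX wX)).
  case yX: (y \in X); rewrite ?andbF// !andbT; have [->|//] := eqVneq y w.
  by rewrite subrr eq_sym w0.
have sHV := sg_sumset sH sV.
have [X [w [l [[sX cX HVX wX w0] [ul lX l0 lE]]]]] := new_cycle q3 split_orders sHV.
have VX : disjoint_sg V X.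
  by move=> x xV; apply: HVX; apply: (fsubsetP (sumset_subr _ (sg0 sH))).
have [B' [uB' B'E B'V B'sub]] :=
  two_rows_list sV sX VX wX (sg0 sX) w0 hV h0 ul lX l0 lE.
have WsV : W `<=` V by rewrite -BW; exact: psums_sub.
pose Z := two_rows X w 0 h; pose V' := sumset V X.
have sV' : subgroup V' := sg_sumset sV sX.
have VV' : V `<=` V' := sumset_subl _ (sg0 sX).
have XV' : X `<=` V' := sumset_subr _ (sg0 sV).
exists V', (sumset W Z), h, (B ++ B'); split; first split=> //.
- exact: disjoint_sumset.
- by rewrite (card_direct sV sX VX)// cV cX -expnSr.
- exact: (fsubsetP VV').
split.
- rewrite cat_uniq uB uB' /= andbT; apply/hasPn => b /B'V.
  by apply: contra => /BV.
- move=> b; rewrite mem_cat => /orP[/BV|/(B'sub _ sV hV)//].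
  exact: (fsubsetP VV').
- rewrite mem_cat negb_or B0; apply/negP => /B'V; by rewrite sg0.
- by rewrite psums_cat BW B'E.
have inj := disjoint_inj_mod sX VX.
split; last first.
  rewrite (two_rows_cardE sV inj WsV hV wX (sg0 sX) w0) WV cV cX expnSr.
  have : (2 <= q)%N by rewrite ltnW.
  by move: cW; rewrite !expnS; clear; nia.
have Zw : X `\ w `<=` Z by exact: fsubsetUl.
have ZsV' : Z `<=` V'.
  rewrite fsubUset; apply/andP; split.
    by apply: (fsubset_trans _ XV'); exact: fsubD1set.
  apply: sumset_sub => //; first by rewrite fsub1set (fsubsetP VV').
  by apply: (fsubset_trans _ XV'); exact: fsubD1set.
apply/eqP; rewrite eqEfsubset fsubUset sumset_sub//=; last first.
  exact: fsubset_trans VV'.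
rewrite sumset_sub//=; last 2 first.
- by rewrite fsub1set (fsubsetP VV').
- by rewrite sumset_sub//; exact: fsubset_trans VV'.
apply/fsubsetP => _ /sumsetP[v [x [vV xX ->]]].
rewrite in_fsetU mem_sumset1; have [->|xw] := eqVneq x w; last first.
  have xZ : x \in Z by apply: (fsubsetP Zw); rewrite in_fsetD1 xw.
  move: vV; rewrite -WV in_fsetU mem_sumset1 => /orP[vW|vW].
    by apply/orP; left; exact: mem_sumset.
  by apply/orP; right; rewrite addrAC; exact: mem_sumset.
(* Over w only the translated row is present; writing v = (v - h) + h reduces this fibre to the
   covering of V. *)
have hwZ : h + w \in Z.
  by apply/fsetUP; right; rewrite mem_sumset1 addrAC subrr add0r in_fsetD1 w0.
have : v - h \in V by rewrite sgB.
rewrite -WV in_fsetU mem_sumset1 => /orP[vW|vW].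
  by apply/orP; left; rewrite -(subrK h v) -addrA; exact: mem_sumset.
apply/orP; right; rewrite addrAC -[v - h](subrK h) -addrA; exact: mem_sumset.
Qed.

(** A last pair of rows has its defective fibres at w and w', both nonzero, so that Y contains all
    of the thin block's group. Densities at low levels then do not drop at all, and at higher levels
    they are averages of fibres that each miss at most the proportion 2^k / q^(k+1). *)
Lemma short_descend k (A : state G) : valid Hs A ->
  exists A' V Y T, [/\
   reach Hs (sdens R Hs A - sdens R Hs A * (2 ^ k)%:R / (q ^ k.+1)%:R) (sdens R Hs A)
     ((2 ^ k)%:R / (q ^ k.+1)%:R) A A', (A.1 < A'.1)%N &
   psums A'.2 = sumset (sumset (psums A.2) Y) T] /\
   [/\ subgroup V, disjoint_sg (Hs A.1) V, Y `<=` V & inj_mod (sumset (Hs A.1) V) T] /\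
   [/\ V `<=` Hs A'.1, T `<=` Hs A'.1,
     #|` Hs A'.1| = (#|` Hs A.1| * #|` V| * #|` T|)%N, (0 < #|` T|)%N &
     #|` Y|%:R = (1 - 2 * (2 ^ k)%:R / (q ^ k.+2)%:R) * #|` V|%:R :> R].
Proof.
move=> vA; set H := Hs A.1; have sH : subgroup H := chain_sg Hs_chain _.
have [V [W [h [B [[sV HV cV hV h0] [uB BV B0 BW [WV cW]]]]]]] := thin_block k sH.
have sHV := sg_sumset sH sV.
(* X is taken independent of a whole [Hs m1] containing H + V, so that X contributes nothing to
   levels up to m1. *)
have [m1 _ HVm] := chain_sub Hs_chain (sumset H V) 0.
have sm : subgroup (Hs m1) := chain_sg Hs_chain m1.
have [X [w [l [[sX cX mX wX w0] [ul lX l0 lE]]]]] := new_cycle q3 split_orders sm.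
have VHV : V `<=` sumset H V := sumset_subr _ (sg0 sH).
have VX : disjoint_sg V X by move=> x xV; apply: mX; apply/(fsubsetP HVm)/(fsubsetP VHV).
have HVX : disjoint_sg (sumset H V) X by move=> x xV; apply: mX; exact: (fsubsetP HVm).
(* A third element of X exists because q > 2. *)
have [w' w'X /andP[w'0 w'w]] : exists2 w', w' \in X & (w' != 0) && (w != w').
  have : (0 < #|` (X `\ 0%R) `\ w|)%N.
    have c1 := cardfsD1 0 X; have c2 := cardfsD1 w (X `\ 0).
    rewrite cX (sg0 sX) in c1; have q2 := q3.
    by move: q2; rewrite c1 c2; case: (w \in _); rewrite /= ?add1n ?add0n !ltnS// => /ltnW.
  rewrite cardfs_gt0 => /fset0Pn[w']; rewrite !in_fsetD1 => /and3P[a b c].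
  by exists w'; rewrite // b eq_sym a.
have [B' [uB' B'E B'V B'sub]] := two_rows_list sV sX VX wX w'X w'w hV h0 ul lX l0 lE.
have WsV : W `<=` V by rewrite -BW; exact: psums_sub.
pose Z := two_rows X w w' h; pose V' := sumset V X; pose Y := sumset W Z.
have sV' : subgroup V' := sg_sumset sV sX.
have VV' : V `<=` V' := sumset_subl _ (sg0 sX).
have XV' : X `<=` V' := sumset_subr _ (sg0 sV).
have HV' : disjoint_sg H V' by exact: disjoint_sumset.
have BBV' : {subset B ++ B' <= V'}.
  move=> b; rewrite mem_cat => /orP[/BV|/(B'sub _ sV hV)//].
  exact: (fsubsetP VV').
have YE : psums (B ++ B') = Y by rewrite psums_cat BW B'E.
have YV' : Y `<=` V' by rewrite -YE; exact: psums_sub.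
have injV := disjoint_inj_mod sX VX.
have VY : V `<=` Y.
  apply/fsubsetP => v vV; have := two_rows_fiber w w' sV injV WsV hV (sg0 sX).
  rewrite eq_sym w0 eq_sym w'0 WV !sumset0l => E.
  by have : v \in Y `&` V by [rewrite E]; rewrite in_fsetI => /andP[].
have cV' : #|` V'| = (q ^ k.+2)%N by rewrite (card_direct sV sX VX)// cV cX -expnSr.
have q0 : 0 < q%:R :> R by rewrite ltr0n (ltn_trans _ q3).
have q1 n : 0 < (q ^ n)%:R :> R by rewrite natrX exprn_gt0.
have cY : #|` Y|%:R = (1 - 2 * (2 ^ k)%:R / (q ^ k.+2)%:R) * #|` V'|%:R :> R.
  rewrite (two_rows_cardE sV injV WsV hV wX w'X w'w) WV cV cX cV'.
  have -> : (2 * #|` W| + (q - 2) * q ^ k.+1 = q ^ k.+2 - 2 * 2 ^ k)%N.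
    have := q3; move: cW; rewrite (expnS _ k.+1); clear; nia.
  rewrite mulrBl mul1r divfK ?gt_eqF// natrB ?natrM// expnS.
  by apply: leq_mul; [exact: ltnW|rewrite -cW leq_addl].
pose eta : R := (2 ^ k)%:R / (q ^ k.+1)%:R.
have eta0 : 0 <= eta by rewrite divr_ge0.
have WV1 : #|` W|%:R = (1 - eta) * #|` V|%:R :> R.
  by rewrite cV mulrBl mul1r divfK ?gt_eqF// -cW natrD addrK.
have bandV j : (1 - eta) * #|` V' `&` Hs j|%:R <= #|` Y `&` Hs j|%:R.
  (* Up to m1 the new group meets [Hs j] within V, which Y contains; beyond m1 all of V lies in
     [Hs j] and the fibres over V can be averaged. *)
  have [jm|mj] := leqP j m1.
    have -> : V' `&` Hs j = V `&` Hs j.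
      apply/fsetP => z; rewrite !in_fsetI; case zj: (z \in Hs j); rewrite ?andbF// !andbT.
      apply/idP/idP; last exact: (fsubsetP VV').
      move=> /sumsetP[v [x [vV xX zE]]]; suff -> : z = v by [].
      have vm : v \in Hs m1 by apply/(fsubsetP HVm)/(fsubsetP VHV).
      have xm : x \in Hs m1.
        by rewrite -(sgDr _ sm vm) -zE (fsubsetP (chain_le Hs_chain jm)).
      by rewrite zE (mX x xm xX) addr0.
    apply: (@le_trans _ _ #|` V `&` Hs j|%:R); last first.
      by rewrite ler_nat; apply: fsubset_leq_card; exact: fsetSI.
    by rewrite ler_piMl// lerBlDr lerDl.
  have VM : V `<=` V' `&` Hs j.
    rewrite fsubsetI VV'; apply: (fsubset_trans _ (chain_le Hs_chain (ltnW mj))).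
    exact: fsubset_trans HVm.
  have fib y : y \in V' `&` Hs j -> (1 - eta) * #|` V|%:R <=
      #|` Y `&` sumset [fset y] V|%:R <= (1 : R) * #|` V|%:R.
    move=> /fsetIP[yV _]; rewrite mul1r -WV1 !ler_nat.
    have /andP[-> _] := two_rows_fiber_bounds sV injV WsV hV w'w yV.
    by rewrite -(card_sumset1 y V); apply: fsubset_leq_card; exact: fsubsetIr.
  have /andP[] := coset_band sV (sgI sV' (chain_sg Hs_chain j)) VM fib.
  by rewrite fsetIA (fsetIidPl YV').
pose S := psums A.2; have SH : S `<=` H := valid_sub Hs_chain vA.
pose L := sumset H V'; have sL : subgroup L := sg_sumset sH sV'.
have HL : H `<=` L := sumset_subl _ (sg0 sV').
pose U := sumset S Y.
have uBB : uniq (B ++ B').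
  by rewrite cat_uniq uB uB' /= andbT; apply/hasPn => b /B'V; apply: contra => /BV.
have BB0 : 0 \notin B ++ B'.
  by rewrite mem_cat negb_or B0; apply/negP => /B'V; rewrite sg0.
have BP b : b \in B ++ B' -> (b \in L) && (b \notin H).
  move=> bB; rewrite (fsubsetP (sumset_subr _ (sg0 sH)) b (BBV' _ bB)) /=.
  by apply: contra BB0 => bH; rewrite -(HV' b bH (BBV' _ bB)).
(* P lies in [Hs j], so membership of p + v in [Hs j] depends on v alone. *)
have split_j P Q j : (A.1 <= j)%N -> P `<=` H -> Q `<=` V' ->
    #|` sumset P Q `&` Hs j| = (#|` P| * #|` Q `&` Hs j|)%N.
  move=> Aj PH QV; have sj := chain_sg Hs_chain j.
  rewrite -(card_direct sH sV' HV' PH (fsubset_trans (fsubsetIl _ _) QV)).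
  suff -> : sumset P Q `&` Hs j = sumset P (Q `&` Hs j) by [].
  have Pj z : z \in P -> z \in Hs j.
    by move=> zP; apply/(fsubsetP (chain_le Hs_chain Aj))/(fsubsetP PH).
  apply/fsetP => z; rewrite in_fsetI; apply/andP/sumsetP.
    move=> [/sumsetP[a [b [aP bQ ->]]]]; rewrite (sgDr _ sj (Pj _ aP)) => bj.
    by exists a, b; rewrite in_fsetI bQ bj.
  move=> [a [b [aP /fsetIP[bQ bj] ->]]]; split; first exact: mem_sumset.
  by rewrite sgD// Pj.
have UH : U `&` H = S.
  apply/fsetP => z; rewrite in_fsetI; apply/andP/idP => [[]|zS]; last first.
    split; last exact: (fsubsetP SH).
    by rewrite -[z]addr0 mem_sumset// -YE psums0.
  move=> /sumsetP[s [y [sS yY ->]]]; rewrite (sgDr _ sH (fsubsetP SH _ sS)) => yH.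
  by rewrite (HV' y yH (fsubsetP YV' _ yY)) addr0.
have H0 : 0 < #|` H|%:R :> R by rewrite ltr0n (card_gt0 (sg0 sH)).
have dA := sdensE R Hs_chain vA; have dA0 := sdens_gt0 R Hs_chain vA.
have SdH : #|` S|%:R = sdens R Hs A * #|` H|%:R :> R by rewrite dA divfK ?gt_eqF.
have band j : (A.1 <= j)%N ->
    (sdens R Hs A - sdens R Hs A * (2 ^ k)%:R / (q ^ k.+1)%:R) * #|` L `&` Hs j|%:R <=
    #|` U `&` Hs j|%:R <= sdens R Hs A * #|` L `&` Hs j|%:R.
  move: dA0 SdH; move: (sdens R Hs A) => d d0 SdH Aj.
  rewrite /U /L (split_j S Y j Aj SH YV').
  rewrite (split_j H V' j Aj (fsubset_refl _) (fsubset_refl _)) -mulrA -/eta.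
  have -> : d - d * eta = d * (1 - eta) by rewrite mulrBr mulr1.
  rewrite (natrM R #|` H|) (natrM R #|` S|) SdH -!mulrA !(ler_pM2l d0).
  rewrite mulrCA !(ler_pM2l H0) bandV ler_nat.
  by apply: fsubset_leq_card; exact: fsetSI.
have V0 : 0 < #|` V'|%:R :> R by rewrite cV'.
have dU : #|` U|%:R / #|` L|%:R = sdens R Hs A * (1 - 2 * (2 ^ k)%:R / (q ^ k.+2)%:R) :> R.
  rewrite /U /L (card_direct sH sV' HV' SH YV').
  rewrite (card_direct sH sV' HV' (fsubset_refl _) (fsubset_refl _)).
  rewrite (natrM R #|` H|) (natrM R #|` S|) cY SdH.
  set c := 1 - _; clearbody c; field; by rewrite !gt_eqF.
have dA1 := dens_le1 R Hs_chain A.1 (psums A.2); rewrite -/(sdens R Hs A) in dA1.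
have eta2 : 2 * (2 ^ k)%:R / (q ^ k.+2)%:R <= eta.
  rewrite /eta expnS natrM invfM mulrA ler_pM2r ?invr_gt0//.
  rewrite mulrC mulrA ler_piMl// ler_pdivrMl// mulr1 ler_nat; exact: ltnW.
have de : sdens R Hs A <= #|` U|%:R / #|` L|%:R + eta.
  rewrite dU mulrBr mulr1 -addrA lerDl addrC subr_ge0.
  apply: le_trans eta2; rewrite -[leRHS]mul1r; apply: ler_wpM2r dA1.
  by rewrite divr_ge0// mulr_ge0.
have UsB : U = sumset (psums A.2) (psums (B ++ B')) by rewrite YE.
have [A' [T [pA' AA' dA' pE [Tinj Lm Tm cm]]]] :=
  extend Hs_chain vA sL HL UsB uBB BP UH band eta0 de.
exists A', V', Y, T; split=> //; split; first by split.
split=> //; first exact: (fsubset_trans (sumset_subr _ (sg0 sH)) Lm).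
- by rewrite cm (card_direct sH sV' HV').
- by have := card_gt0 (sg0 (chain_sg Hs_chain A'.1)); rewrite cm muln_gt0 => /andP[].
Qed.

End ShortCycleMoves.

(** * Product states and the ceiling on the density *)

Section SplitStates.
Variables (R : realType) (G : zmodType) (Hs : nat -> {fset G}) (q : nat).
Implicit Types (H K L X S T U V W Y E Q : {fset G}) (x y h w e : G).
Local Open Scope fset_scope.
Local Open Scope ring_scope.

Hypothesis Hs_chain : chain Hs.

(* The subset sums of [A] form a product [Q + W] in which [W] may be filled up
   to the subgroup [E]; [c] is the density of [Q + E], [f] that of [W] in [E]. *)
Definition splits (A : state G) (c f : R) := exists Q E W,
  [/\ valid Hs A, subgroup E, E `<=` Hs A.1, Q `<=` Hs A.1 & inj_mod E Q] /\
  [/\ W `<=` E, psums A.2 = sumset Q W, c = (#|` Q| * #|` E|)%:R / #|` Hs A.1|%:R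
    & f = #|` W|%:R / #|` E|%:R].

Lemma splits_valid A c f : splits A c f -> valid Hs A.
Proof. by move=> [Q [E [W [[]]]]]. Qed.

Lemma splits_sdens A c f : splits A c f -> sdens R Hs A = c * f.
Proof.
move=> [Q [E [W [[vA sE EH QH EQ] [WE pE -> ->]]]]].
rewrite (sdensE R Hs_chain vA) pE sumsetC (card_sumset_mod sE WE EQ) !natrM.
have E0 : #|` E|%:R != 0 :> R by rewrite pnatr_eq0 -lt0n (card_gt0 (sg0 sE)).
have H0 : #|` Hs A.1|%:R != 0 :> R by rewrite gt_eqF// card_chain_gt0.
by field; rewrite H0 E0.
Qed.

Lemma splits_range A c f : splits A c f -> [/\ 0 < c, c <= 1, 0 < f & f <= 1].
Proof.
move=> sp; have d0 := sdens_gt0 R Hs_chain (splits_valid sp).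
rewrite (splits_sdens sp) in d0.
move: sp => [Q [E [W [[vA sE EH QH EQ] [WE pE cE fE]]]]].
have E0 : 0 < #|` E|%:R :> R by rewrite ltr0n (card_gt0 (sg0 sE)).
have H0 : 0 < #|` Hs A.1|%:R :> R by rewrite card_chain_gt0.
have c0 : 0 <= c by rewrite cE divr_ge0.
have f0 : 0 <= f by rewrite fE divr_ge0.
split.
- by rewrite lt_def c0 andbT; apply: contraTneq d0 => ->; rewrite mul0r ltxx.
- rewrite cE ler_pdivrMr// mul1r ler_nat mulnC -(card_sumset_mod sE (fsubset_refl E) EQ).
  by apply: fsubset_leq_card; apply: sumset_sub => //; exact: chain_sg.
- by rewrite lt_def f0 andbT; apply: contraTneq d0 => ->; rewrite mulr0 ltxx.
- by rewrite fE ler_pdivrMr// mul1r ler_nat fsubset_leq_card.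
Qed.

Lemma inj_mod_sumset H V E Q T : subgroup H -> subgroup V -> disjoint_sg H V ->
  subgroup E -> E `<=` H -> Q `<=` H -> inj_mod E Q -> inj_mod (sumset H V) T ->
  inj_mod (sumset E V) (sumset Q T).
Proof.
move=> sH sV HV sE /fsubsetP EH /fsubsetP QH EQ HVT.
move=> _ _ /sumsetP[a [t [aQ tT ->]]] /sumsetP[b [u [bQ uT ->]]].
rewrite opprD addrACA => abtu.
have sHV := sg_sumset sH sV.
have abH : a - b \in H by apply: sgB => //; exact: QH.
have HHV := fsubsetP (sumset_subl H (sg0 sV)).
have tu : t = u.
  apply: HVT => //; rewrite -(sgDr _ sHV (HHV _ abH)).
  by apply: fsubsetP abtu; apply: sumsetS => //; exact/fsubsetP.
move: abtu; rewrite tu subrr addr0 => /sumsetP[k [v [kE vV E1]]].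
have v0 : v = 0.
  apply: HV => //; have -> : v = a - b - k by rewrite E1 addrC addKr.
  by apply: sgB => //; exact: EH.
by congr (_ + _); apply: EQ => //; rewrite E1 v0 addr0.
Qed.

Lemma inj_mod_comp E K P T : subgroup K -> E `<=` K -> P `<=` K ->
  inj_mod E P -> inj_mod K T -> inj_mod E (sumset P T).
Proof.
move=> sK /fsubsetP EK /fsubsetP PK EP KT.
move=> _ _ /sumsetP[a [t [aP tT ->]]] /sumsetP[b [u [bP uT ->]]].
rewrite opprD addrACA => abtu.
have abK : a - b \in K by apply: sgB => //; exact: PK.
have tu : t = u by apply: KT => //; rewrite -(sgDr _ sK abK) EK.
by rewrite tu; congr (_ + _); apply: EP => //; move: abtu; rewrite tu subrr addr0.
Qed.

Hypothesis q3 : (2 < q)%N.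
Hypothesis split_orders : forall H, subgroup H ->
  exists2 e, e *+ q = 0 & forall i, (0 < i < q)%N -> e *+ i \notin H.

(** [eta k] bounds the drop and the gaps of one descent; [rho k] is the factor by which it
    multiplies the density. *)
Let eta k : R := (2 ^ k)%:R / (q ^ k.+1)%:R.
Let rho k : R := 1 - 2 * (2 ^ k)%:R / (q ^ k.+2)%:R.

Let natr_gt0 H x : x \in H -> 0 < #|` H|%:R :> R.
Proof. by move=> xH; rewrite ltr0n (card_gt0 xH). Qed.

Let reach_eta k A A' :
  reach Hs (sdens R Hs A - sdens R Hs A * (2 ^ k)%:R / (q ^ k.+1)%:R) (sdens R Hs A)
    (eta k) A A' ->
  reach Hs (sdens R Hs A - eta k) (sdens R Hs A) (eta k) A A'.
Proof.
apply: reach_weaken => //.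
rewrite lerD2l lerN2 -mulrA -[leRHS]mul1r.
by apply: ler_wpM2r (dens_le1 R Hs_chain A.1 (psums A.2)); rewrite divr_ge0.
Qed.

(** The new factor Y is absorbed into Q, so the ceiling falls and the filling proportion is
    unchanged; [lower_fill] interprets the same descent differently. *)
Lemma lower_cap k A c f : splits A c f -> exists A',
  [/\ reach Hs (sdens R Hs A - eta k) (sdens R Hs A) (eta k) A A',
    (A.1 < A'.1)%N & splits A' (rho k * c) f].
Proof.
move=> sp; have vA := splits_valid sp.
have [A' [V [Y [T [[rA AA' pE] [[sV HV YV HVT] [VH TH cH T0 cY]]]]]]] :=
  short_descend R Hs_chain q3 split_orders k vA.
exists A'; split=> //; first exact: reach_eta.
have [Q [E [W [[_ sE EH QH EQ] [WE pA -> ->]]]]] := sp.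
have sH := chain_sg Hs_chain A.1; have sHV := sg_sumset sH sV.
have HHV : Hs A.1 `<=` sumset (Hs A.1) V := sumset_subl _ (sg0 sV).
have VHV : V `<=` sumset (Hs A.1) V := sumset_subr _ (sg0 sH).
have HY : inj_mod (Hs A.1) Y.
  by move=> y y' yY y'Y; apply: (disjoint_inj_mod sV HV); exact: (fsubsetP YV).
have QYHV : sumset Q Y `<=` sumset (Hs A.1) V by exact: sumsetS.
have [vA' lAA _ _ _] := rA; have H' := chain_le Hs_chain lAA.
have sA' := chain_sg Hs_chain A'.1.
exists (sumset (sumset Q Y) T), E, W; split; first split=> //.
- exact: fsubset_trans H'.
- apply: sumset_sub => //; apply: sumset_sub => //; first exact: fsubset_trans H'.
  exact: fsubset_trans VH.
- apply: (inj_mod_comp sHV _ QYHV) => //; first exact: fsubset_trans HHV.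
  exact: (inj_mod_comp sH).
split=> //.
  rewrite pE pA -[sumset (sumset Q W) Y]sumsetA [sumset W Y]sumsetC sumsetA.
  by rewrite -[LHS]sumsetA [sumset W T]sumsetC sumsetA.
rewrite (card_sumset_mod sHV QYHV HVT) (card_sumset_mod sH QH HY) cH !natrM cY.
rewrite -/(rho k); move: (rho k) => r; field.
by rewrite !gt_eqF ?(natr_gt0 (sg0 sV)) ?(natr_gt0 (sg0 sH)) ?ltr0n.
Qed.

(** Here Y is absorbed into W and its ambient group V into E, so the ceiling stays and only the
    filling drops; it can later be raised again. *)
Lemma lower_fill k A c f : splits A c f -> exists A',
  [/\ reach Hs (sdens R Hs A - eta k) (sdens R Hs A) (eta k) A A',
    (A.1 < A'.1)%N & splits A' c (rho k * f)].
Proof.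
move=> sp; have vA := splits_valid sp.
have [A' [V [Y [T [[rA AA' pE] [[sV HV YV HVT] [VH TH cH T0 cY]]]]]]] :=
  short_descend R Hs_chain q3 split_orders k vA.
exists A'; split=> //; first exact: reach_eta.
have [Q [E [W [[_ sE EH QH EQ] [WE pA -> ->]]]]] := sp.
have sH := chain_sg Hs_chain A.1; have sHV := sg_sumset sH sV.
have HHV : Hs A.1 `<=` sumset (Hs A.1) V := sumset_subl _ (sg0 sV).
have EV : disjoint_sg E V by move=> x xE; apply: HV; exact: (fsubsetP EH).
have [vA' lAA _ _ _] := rA; have H' := chain_le Hs_chain lAA.
have sA' := chain_sg Hs_chain A'.1.
exists (sumset Q T), (sumset E V), (sumset W Y); split; first split=> //.
- exact: sg_sumset.
- by apply: sumset_sub => //; exact: fsubset_trans H'.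
- by apply: sumset_sub => //; exact: fsubset_trans H'.
- exact: (inj_mod_sumset sH).
have QHV : Q `<=` sumset (Hs A.1) V by exact: fsubset_trans HHV.
split.
- exact: sumsetS.
- by rewrite pE pA -!sumsetA; congr sumset; rewrite sumsetA sumsetC.
- rewrite (card_sumset_mod sHV QHV HVT) (card_direct sE sV EV)// cH !natrM; field.
  by rewrite !gt_eqF ?(natr_gt0 (sg0 sV)) ?(natr_gt0 (sg0 sH)) ?ltr0n.
rewrite !(card_direct sE sV EV)// !natrM cY -/(rho k); move: (rho k) => r; field.
by rewrite !gt_eqF ?(natr_gt0 (sg0 sV)) ?(natr_gt0 (sg0 sE)).
Qed.

(** The shift h is taken in E, so every fibre lies between S and a translate pair inside Q + E.
    Hence all intermediate densities lie between the old density and c however large the jump is. *)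
Lemma raise_fill A c f : splits A c f -> f < 1 -> exists A' f',
  [/\ reach Hs (sdens R Hs A) c 0 A A', (A.1 < A'.1)%N, splits A' c f' &
    f + (f - f ^+ 2) / 3 <= f'].
Proof.
move=> sp f1; have vA := splits_valid sp; have dA := splits_sdens sp.
have [Q [E [W [[_ sE EH QH EQ] [WE pA cE fE]]]]] := sp.
have [c0 c1 f0 _] := splits_range sp.
have E0 := natr_gt0 (sg0 sE).
have sH := chain_sg Hs_chain A.1; set H := Hs A.1 in sH EH QH cE.
have H0 := natr_gt0 (sg0 sH).
have [h hE hW] := exists_small_overlap sE WE.
(* The shift 0 has full overlap, which is not small when f < 1. *)
have h0 : h != 0.
  apply: contraTneq hW => ->; rewrite sumset0l fsetIid -ltnNge ltn_mul2l.
  move: f1; rewrite fE ltr_pdivrMr// mul1r ltr_nat => WE1.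
  rewrite WE1 andbT lt0n; apply: contraTneq f0 => W0.
  by rewrite fE W0 mul0r ltxx.
have [X [w [l [[sX cX HX wX w0] [ul lX l0 lE]]]]] := new_cycle q3 split_orders sH.
have hH := fsubsetP EH _ hE.
have [B [uB BE BH Bsub]] := two_rows_list sH sX HX wX (sg0 sX) w0 hH h0 ul lX l0 lE.
pose L := sumset H X; have sL : subgroup L := sg_sumset sH sX.
have HL : H `<=` L := sumset_subl _ (sg0 sX).
pose Y := two_rows X w 0 h; pose S := psums A.2; pose U := sumset S Y.
have SH : S `<=` H := valid_sub Hs_chain vA.
have injX := disjoint_inj_mod sX HX.
have UH : U `&` H = S.
  have := two_rows_fiber w 0 sH injX SH hH (sg0 sX).
  by rewrite eqxx eq_sym w0 fsetU0 !sumset0l.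
have SE : S `|` sumset [fset h] S = sumset (W `|` sumset [fset h] W) Q.
  by rewrite sumsetUl -sumsetA -[sumset W Q]sumsetC -pA.
have WhE : W `|` sumset [fset h] W `<=` E.
  by rewrite fsubUset WE sumset_sub// fsub1set.
have EX : disjoint_sg E X by move=> x xE; apply: HX; exact: (fsubsetP EH).
have YEX : Y `<=` sumset E X.
  rewrite fsubUset; apply/andP; split.
    by apply: (fsubset_trans (fsubD1set _ _)); exact: (sumset_subr _ (sg0 sE)).
  by apply: sumsetS; [rewrite fsub1set|exact: fsubD1set].
have cS : #|` S|%:R = c * f * #|` H|%:R :> R.
  by rewrite -dA (sdensE R Hs_chain vA) divfK ?gt_eqF.
have band j : (A.1 <= j)%N -> sdens R Hs A * #|` L `&` Hs j|%:R <=
    #|` U `&` Hs j|%:R <= c * #|` L `&` Hs j|%:R.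
  move=> Aj; have sLj := sgI sL (chain_sg Hs_chain j).
  have UL : U `<=` L.
    apply: sumset_sub => //; first exact: fsubset_trans HL.
    by apply: (fsubset_trans YEX); apply: sumsetS.
  have HLj : H `<=` L `&` Hs j by rewrite fsubsetI HL (chain_le Hs_chain).
  have -> : U `&` Hs j = U `&` (L `&` Hs j) by rewrite fsetIA (fsetIidPl UL).
  apply: (coset_band sH sLj HLj) => y /fsetIP[yL _].
  have /andP[b1 b2] := two_rows_fiber_bounds sH injX SH hH w0 yL.
  rewrite dA -cS ler_nat b1 /= cE divfK ?gt_eqF// ler_nat; apply: (leq_trans b2).
  rewrite SE (card_sumset_mod sE WhE EQ) mulnC leq_mul2l.
  by rewrite fsubset_leq_card ?orbT.
have cU : (#|` U| = 2 * #|` S| + (q - 2) * #|` S `|` sumset [fset h] S|)%N.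
  by rewrite (two_rows_cardE sH injX SH hH wX (sg0 sX) w0) cX.
have q0 : 0 < q%:R :> R by rewrite ltr0n (ltn_trans _ q3).
have qS : (q * #|` S| <= #|` U|)%N.
  have q2 : (q = 2 + (q - 2))%N by rewrite subnKC// ltnW.
  rewrite cU {1}q2 mulnDl leq_add2l leq_mul2l.
  by rewrite fsubset_leq_card ?orbT// fsubsetUl.
have cL : #|` L| = (#|` H| * q)%N by rewrite (card_direct sH sX HX)// cX.
have de : sdens R Hs A <= #|` U|%:R / #|` L|%:R + 0.
  rewrite addr0 ler_pdivlMr ?cL ?natrM ?mulr_gt0// dA mulrA -cS -natrM ler_nat.
  by rewrite mulnC.
have UsB : U = sumset (psums A.2) (psums B) by rewrite BE.
have BP b : b \in B -> (b \in L) && (b \notin H).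
  by move=> bB; rewrite BH// andbT; exact: (Bsub _ sH hH).
have [A' [T [rA AA' _ pE [LT Lm Tm cm]]]] :=
  extend Hs_chain vA sL HL UsB uB BP UH band (lexx 0) de.
have [vA' lAA _ _ _] := rA; have H' := chain_le Hs_chain lAA.
have sA' := chain_sg Hs_chain A'.1.
have T0 : 0 < #|` T|%:R :> R.
  rewrite ltr0n; have := card_gt0 (sg0 sA'); rewrite cm muln_gt0 => /andP[_ //].
have cW : #|` sumset W Y| = (2 * #|` W| + (q - 2) * #|` W `|` sumset [fset h] W|)%N.
  by rewrite (two_rows_cardE sE (disjoint_inj_mod sX EX) WE hE wX (sg0 sX) w0) cX.
exists A', (#|` sumset W Y|%:R / #|` sumset E X|%:R); split=> //.
  exists (sumset Q T), (sumset E X), (sumset W Y); split; first split=> //.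
  - exact: sg_sumset.
  - by apply: (fsubset_trans _ Lm); apply: sumsetS.
  - apply: sumset_sub => //; exact: fsubset_trans H'.
  - exact: (inj_mod_sumset sH).
  split=> //.
  - apply: sumset_sub => //; first exact: sg_sumset.
    by apply: (fsubset_trans WE); exact: (sumset_subl _ (sg0 sX)).
  - by rewrite pE /U /S pA -!sumsetA; congr sumset; rewrite sumsetA sumsetC.
  have QL : Q `<=` L by exact: fsubset_trans HL.
  rewrite (card_sumset_mod sL QL LT) (card_direct sE sX EX)// cm cL cX cE !natrM; field.
  by rewrite !gt_eqF.
rewrite (card_direct sE sX EX (fsubset_refl E) (fsubset_refl X)) cX cW.
have cI := cardfsUI W (sumset [fset h] W); rewrite card_sumset1 in cI.
set o := #|` W `&` sumset [fset h] W| in hW cI.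
set u := #|` W `|` sumset [fset h] W| in cI *.
have oR : o%:R / #|` E|%:R <= f ^+ 2 :> R.
  rewrite fE expr_div_n ler_pdivrMr// expr2 [X in _ / X]expr2 invfM mulrA divfK ?gt_eqF//.
  by rewrite ler_pdivlMr// -!natrM ler_nat.
have -> : (2 * #|` W| + (q - 2) * u)%:R / (#|` E| * q)%:R =
    f + (1 - 2 / q%:R) * (f - o%:R / #|` E|%:R) :> R.
  rewrite natrD !natrM (natrB _ (ltnW q3)).
  have -> : u%:R = #|` W|%:R + #|` W|%:R - o%:R :> R by rewrite -natrD -cI natrD addrK.
  by rewrite fE; field; rewrite !gt_eqF.
rewrite lerD2l mulrC; apply: ler_pM.
- by rewrite invr_ge0.
- by rewrite subr_ge0 expr2 ler_piMl// ltW.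
(* The factor 1 / 3 is the least value of 1 - 2 / q, the proportion of fibres carrying both rows. *)
- have : 2 / q%:R <= 2 / 3 :> R by rewrite ler_pM2l// lef_pV2 ?posrE// ler_nat.
  by lra.
by rewrite lerD2l lerN2.
Qed.

End SplitStates.

Section ShortSweep.
Variables (R : realType) (G : zmodType) (Hs : nat -> {fset G}) (q : nat) (al be : R).
Local Open Scope fset_scope.
Local Open Scope ring_scope.

Hypothesis Hs_chain : chain Hs.
Hypothesis ab : 0 <= al <= be.
Hypothesis be1 : be <= 1.
Hypothesis q3 : (2 < q)%N.
Hypothesis split_orders : forall H : {fset G}, subgroup H ->
  exists2 e : G, e *+ q = 0 & forall i, (0 < i < q)%N -> e *+ i \notin H.

Lemma small_ratio (e : R) : 0 < e ->
  exists k, ((2 ^ k)%:R / (q ^ k.+1)%:R : R) <= e.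
Proof.
move=> e0; have [K K1 Ke] := inv_nat_le e0; exists K.
have K0 : (0 < K)%N by rewrite ltnW.
have q0 : (0 < q)%N by rewrite (ltn_trans _ q3).
apply: le_trans Ke; rewrite ler_pdivrMr ?ltr0n ?expn_gt0 ?q0//.
rewrite mulrC ler_pdivlMr ?ltr0n// -natrM ler_nat.
have : (2 ^ K * K.+2 <= q ^ K.+1)%N.
  have q3' := q3; elim: (K) => [|k IH]; first by rewrite expn0 mul1n expn1 ltnW.
  rewrite [(q ^ _)%N]expnS; apply: (@leq_trans (3 * (2 ^ k * k.+2))).
    by rewrite expnS; clear; nia.
  exact: leq_mul.
by apply: leq_trans; rewrite leq_mul2l leqW ?orbT.
Qed.

Lemma full_state : exists A, splits Hs A (1 : R) 1.
Proof.
have s0 := chain_sg Hs_chain 0.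
exists (0%N, enum_fset (Hs 0)), [fset 0], (Hs 0), (Hs 0).
have pE : psums (enum_fset (Hs 0)) = Hs 0.
  apply/eqP; rewrite eqEfsubset psums_sub//=.
  by apply/fsubsetP => x; exact: mem_psums.
have H0 : #|` Hs 0|%:R != 0 :> R by rewrite gt_eqF// card_chain_gt0.
split; split=> //.
- by split=> //; exact: fset_uniq.
- by rewrite fsub1set sg0.
- by move=> x y /fset1P -> /fset1P ->.
- by rewrite /= pE sumset0l.
- by rewrite cardfs1 mul1n divff.
- by rewrite divff.
Qed.

(** The ceiling is lowered to at most be + e' before any filling, since [raise_fill] is bounded by
    the ceiling alone. Filling then brings the density close to be from wherever it was, and
    descents of the filling sweep the interval while the ceiling remains available for the next
    round. *)
Lemma sweeping_short : sweeping Hs al be (fun e A => exists c f,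
  [/\ splits Hs A c f, be <= c <= be + e & al - e <= c * f]).
Proof.
have [al0 alb] := andP ab; have beq := be1.
split; first by move=> e A [c [f [/splits_valid]]].
  have [A sp] := full_state; exists A, 1, 1; split=> //; lra.
move=> e e' A e'0 e'e [c [f [sp cP fP]]].
have [c0 c1 f0 f1] := splits_range Hs_chain sp.
have [k kP] : exists k, ((2 ^ k)%:R / (q ^ k.+1)%:R : R) <= e' / 2.
  by apply: small_ratio; rewrite divr_gt0.
set eta := _ / _ in kP.
pose rh : R := 1 - 2 * (2 ^ k)%:R / (q ^ k.+2)%:R.
have rho1 : rh < 1.
  by rewrite ltrBlDr ltrDl divr_gt0// ?mulr_gt0 ?ltr0n ?expn_gt0// (ltn_trans _ q3).
have rhoe : 1 - eta <= rh.
  have q0 : 0 < q%:R :> R by rewrite ltr0n (ltn_trans _ q3).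
  rewrite lerD2l lerN2 /eta expnS natrM invfM mulrA ler_pM2r; last first.
    by rewrite invr_gt0 ltr0n expn_gt0 (ltn_trans _ q3).
  rewrite mulrC mulrA ler_piMl// ler_pdivrMl// mulr1 ler_nat; exact: ltnW.
have low B (c' f' : R) : splits Hs B c' f' -> c' - e' / 2 <= rh * c' /\ f' - e' / 2 <= rh * f'.
  move=> /(splits_range Hs_chain) [c'0 c'1 f'0 f'1].
  have aux x : 0 < x -> x <= 1 -> x - e' / 2 <= rh * x.
    move=> x0 x1; apply: (@le_trans _ _ ((1 - eta) * x)); last by rewrite ler_pM2r.
    rewrite mulrBl mul1r lerD2l lerN2; apply: (le_trans _ kP).
    by rewrite ler_piMr// divr_ge0.
  by split; exact: aux.
have e0 : 0 < e by rewrite (lt_le_trans e'0).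
have tr := @reach_trans R G Hs Hs_chain (al - 3 * e) (be + 3 * e) (3 * e).
(* Lowering the ceiling also lowers the density; as the ceiling stays at least be, it cannot lose
   more than another e. *)
have bef : al - 2 * e <= be * f.
  have : c * f <= (be + e) * f by rewrite ler_pM2r//; case/andP: cP.
  have : e * f <= e by rewrite ler_piMr// ltW.
  by move: fP; rewrite mulrDl; lra.
have sd B (c' f' : R) : splits Hs B c' f' -> sdens R Hs B = c' * f' :=
  splits_sdens Hs_chain (A := B) (c := c') (f := f').
have le1 B (c' f' : R) : splits Hs B c' f' -> c' * f' <= c'.
  by move=> /(splits_range Hs_chain)[? _ _ ?]; rewrite ler_piMr// ltW.
have drop (x : R) : 0 < x -> 0 < (1 - rh) * x by move=> x0; rewrite mulr_gt0// subr_gt0.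
pose P0 B := exists2 c', splits Hs B c' f & be <= c' <= be + e.
have refl B (c' f' : R) : splits Hs B c' f' -> al - 3 * e <= c' * f' -> c' <= be + e ->
    reach Hs (al - 3 * e) (be + 3 * e) (3 * e) B B.
  move=> spB lo hi; apply: (reach_refl Hs_chain (splits_valid spB)); first by lra.
  rewrite (sd _ _ _ spB) lo /=; have := le1 _ _ _ spB.
  by lra.
have P0d c' : be <= c' -> al - 2 * e <= c' * f.
  by move=> bc; apply: (le_trans bef); rewrite ler_pM2r.
(* With f fixed, the threshold (be + e') f on the density means a ceiling of at most be + e'. *)
have [|||||A1 [rA1 [ca spa caP] dA1]] := @iterate_down R G _ P0 (sdens R Hs)
    ((1 - rh) * (e' * f)) ((be + e') * f) tr _ _ _ _ A.
- move=> B [c' spB /andP[bc cb]]; apply: (refl _ _ _ spB) => //.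
  by have := P0d _ bc; lra.
- by apply: drop; rewrite mulr_gt0.
- by move=> B _; exact: dens_ge0.
- move=> B [c' spB /andP[bc cb]]; rewrite (sd _ _ _ spB) ltr_pM2r// => cbe.
  have [C [rBC BC spC]] := lower_cap Hs_chain q3 split_orders k spB.
  have [c'0 c'1 _ _] := splits_range Hs_chain spB.
  rewrite -/rh in spC; have [l1 _] := low _ _ _ spB.
  have l2 : rh * c' <= c' by rewrite ler_piMl// ltW.
  exists C; split.
  + apply: reach_weaken rBC; rewrite ?(sd _ _ _ spB) -/eta.
    * by have := P0d _ bc; move: kP; lra.
    * by have := le1 _ _ _ spB; lra.
    * by lra.
  + by exists (rh * c') => //; lra.
  rewrite (sd _ _ _ spC) -mulrA lerBrDr -lerBrDl -[X in _ <= X - _]mul1r -mulrBl.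
  rewrite ler_pM2l ?subr_gt0// ler_pM2r//; lra.
- by exists c.
rewrite (sd _ _ _ spa) ler_pM2r// in dA1.
have [ca0 ca1 _ _] := splits_range Hs_chain spa; have [bca _] := andP caP.
pose P1 B := exists2 f', splits Hs B ca f' & f <= f'.
have P1d f' : f <= f' -> al - 2 * e <= ca * f'.
  by move=> ff; apply: (le_trans (P0d _ bca)); rewrite ler_pM2l.
(* The quantity driven down is the unfilled part below the ceiling; its threshold means filling at
   least 1 - e' / 2. *)
have [|||||A2 [rA2 [fb spb fbP] dA2]] := @iterate_down R G _ P1
    (fun B => ca - sdens R Hs B) (ca * (f * (e' / 2) / 3)) (ca * (e' / 2)) tr _ _ _ _ A1.
- move=> B [f' spB ff]; apply: (refl _ _ _ spB).
    by have := P1d _ ff; lra.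
  by lra.
- by rewrite mulr_gt0// divr_gt0// mulr_gt0// divr_gt0.
- by move=> B [f' spB _]; rewrite subr_ge0 (sd _ _ _ spB) (le1 _ _ _ spB).
- move=> B [f' spB ff]; rewrite (sd _ _ _ spB) -{2}[ca]mulr1 -mulrBr ltr_pM2l// => fe.
  have f'1 : f' < 1 by lra.
  have [C [f'' [rBC BC spC fC]]] := raise_fill Hs_chain q3 split_orders spB f'1.
  have up : f * (e' / 2) / 3 <= (f' - f' ^+ 2) / 3.
    rewrite ler_pM2r ?invr_gt0// expr2 -{1}[f']mulr1 -mulrBr.
    by apply: ler_pM; [exact: ltW|rewrite divr_ge0// ltW|exact: ff|lra].
  have up0 : 0 <= f * (e' / 2) / 3.
    by rewrite divr_ge0// mulr_ge0 ?(ltW f0)// divr_ge0// ltW.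
  exists C; split.
  + apply: reach_weaken rBC; rewrite ?(sd _ _ _ spB).
    * by have := P1d _ ff; lra.
    * by lra.
    * by lra.
  + by exists f'' => //; lra.
  rewrite (sd _ _ _ spC) -{1 3}[ca]mulr1 -!mulrBr ler_pM2l//.
  by lra.
- by exists f.
(* An unconditional move, so that the level increases even if all loops are empty. *)
have [C0 [rC0 AC0 sp0]] := lower_fill Hs_chain q3 split_orders k spb.
rewrite -/rh in sp0.
have fb1 : 1 - e' / 2 <= fb.
  move: dA2; rewrite (sd _ _ _ spb) -{1}[ca]mulr1 -mulrBr ler_pM2l//; lra.
have db : be - e' / 2 <= ca * fb.
  apply: (@le_trans _ _ (ca * (1 - e' / 2))); last by rewrite ler_pM2l.
  rewrite mulrBr mulr1; have : ca * (e' / 2) <= e' / 2.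
    by rewrite ler_piMl// divr_ge0// ltW.
  by lra.
have low2 B f' : splits Hs B ca f' -> ca * f' - e' / 2 <= ca * (rh * f').
  move=> spB; have [_ l2] := low _ _ _ spB.
  apply: (@le_trans _ _ (ca * (f' - e' / 2))); last by rewrite ler_pM2l.
  by rewrite mulrBr lerD2l lerN2 ler_piMl// divr_ge0// ltW.
pose P2 B := exists2 f', splits Hs B ca f' & al - e' <= ca * f'.
have P2C B f' C : splits Hs B ca f' -> al - e' <= ca * f' ->
    reach Hs (sdens R Hs B - eta) (sdens R Hs B) eta B C ->
    reach Hs (al - 3 * e) (be + 3 * e) (3 * e) B C.
  move=> spB dB; apply: reach_weaken; rewrite ?(sd _ _ _ spB).
  + by move: dB; lra.
  + by have := le1 _ _ _ spB; lra.
  + by lra.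
have [|||||A3 [rA3 [fc spc fcP] dA3]] := @iterate_down R G _ P2 (sdens R Hs)
    ((1 - rh) * e') (al + e') tr _ _ _ _ C0.
- move=> B [f' spB ff]; apply: (refl _ _ _ spB); last by lra.
  by move: ff; lra.
- exact: drop.
- by move=> B _; exact: dens_ge0.
- move=> B [f' spB ff]; rewrite (sd _ _ _ spB) => dB.
  have [C [rBC BC spC]] := lower_fill Hs_chain q3 split_orders k spB.
  rewrite -/rh in spC; exists C; split; first exact: (P2C _ _ _ spB ff rBC).
    exists (rh * f') => //; apply: le_trans (low2 _ _ spB).
    by move: dB; lra.
  rewrite (sd _ _ _ spC) mulrCA lerBrDr -lerBrDl -[X in _ <= X - _]mul1r -mulrBl.
  rewrite ler_pM2l ?subr_gt0//; move: dB; lra.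
- exists (rh * fb) => //; apply: le_trans (low2 _ _ spb).
  by move: db; lra.
have rA23 : reach Hs (al - 3 * e) (be + 3 * e) (3 * e) A2 A3.
  apply: tr rA3; apply: (P2C _ _ _ spb) rC0.
  by move: db; lra.
have [_ A1l _ _ _] := rA1; have [_ A2l _ _ _] := rA2; have [_ A3l _ _ _] := rA3.
exists A3; split.
- exact: (tr _ _ _ rA1 (tr _ _ _ rA2 rA23)).
- by rewrite (leq_ltn_trans A1l)// (leq_ltn_trans A2l)// (leq_trans AC0).
- by exists ca, fc; split=> //; lra.
move=> g gP; have [|||j /andP[j1 j3] jg] := @reach_ends R G Hs Hs_chain _ _ _ A2 A3 g (3 * e) rA23.
- by lra.
- by rewrite (sd _ _ _ spb); move: db; lra.
- by [].
by exists j; rewrite // j3 (leq_trans A1l)// (leq_trans A2l).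
Qed.

End ShortSweep.

(** * Limit points of sequences *)

Section LimitPoints.
Variable R : realType.

(** An epsilon form of the statement that the limit points of [u] are exactly the points of
    [al, be], from which both density statements follow. *)
Definition limit_interval (u : R^nat) (al be : R) :=
  (forall e : R, 0 < e -> exists N, forall j, (N <= j)%N -> al - e <= u j <= be + e) /\
  (forall g e N, 0 < e -> al <= g <= be -> exists2 j, (N <= j)%N & `|u j - g| <= e).

Lemma unit_bounded (u : R^nat) : (forall j, 0 <= u j <= 1) -> bounded_fun u.
Proof.
move=> u01; exists 1; split; first exact: num_real.
move=> x x1 j _ /=; apply: le_trans (ltW x1).
by have /andP[u0 u1] := u01 j; rewrite ger0_norm.
Qed.

Lemma limn_inf_ge (u : R^nat) (a : R) : (forall j, 0 <= u j <= 1) ->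
  (forall e : R, 0 < e -> exists N, forall j, (N <= j)%N -> a - e <= u j) ->
  a <= limn_inf u.
Proof.
move=> u01 ev; rewrite limn_infE; last exact: unit_bounded.
apply/ler_addgt0Pr => e e0; rewrite -lerBlDr; have [N NP] := ev e e0.
apply: (@le_trans _ _ (infs u N)).
  by apply: lb_le_inf; [exists (u N), N => /=|move=> _ [j /= Nj <-]; exact: NP].
apply: ub_le_sup; last by exists N.
exists 1 => _ [n _ <-]; have /andP[_ un1] := u01 n; apply: le_trans un1.
by apply: ge_inf; [exists 0 => _ [j _ <-]; case/andP: (u01 j)|exists n => /=].
Qed.

Lemma limn_inf_le (u : R^nat) (a : R) : (forall j, 0 <= u j <= 1) ->
  (forall e N, 0 < e -> exists2 j, (N <= j)%N & u j <= a + e) ->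
  limn_inf u <= a.
Proof.
move=> u01 fr; rewrite limn_infE; last exact: unit_bounded.
apply/ler_addgt0Pr => e e0; apply: ge_sup; first by exists (infs u 0%N), 0%N.
move=> _ [n _ <-]; have [j nj uj] := fr e n e0; apply: le_trans uj.
by apply: ge_inf; [exists 0 => _ [i _ <-]; case/andP: (u01 i)|exists j => /=].
Qed.

Lemma limn_sup_le (u : R^nat) (b : R) : (forall j, 0 <= u j <= 1) ->
  (forall e : R, 0 < e -> exists N, forall j, (N <= j)%N -> u j <= b + e) ->
  limn_sup u <= b.
Proof.
move=> u01 ev; rewrite limn_supE; last exact: unit_bounded.
apply/ler_addgt0Pr => e e0; have [N NP] := ev e e0.
apply: (@le_trans _ _ (sups u N)); last first.
  by apply: ge_sup; [exists (u N), N => /=|move=> _ [j /= Nj <-]; exact: NP].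
apply: ge_inf; last by exists N.
exists 0 => _ [n _ <-]; have /andP[un0 _] := u01 n; apply: (le_trans un0).
by apply: ub_le_sup; [exists 1 => _ [j _ <-]; case/andP: (u01 j)|exists n => /=].
Qed.

Lemma limn_sup_ge (u : R^nat) (b : R) : (forall j, 0 <= u j <= 1) ->
  (forall e N, 0 < e -> exists2 j, (N <= j)%N & b - e <= u j) ->
  b <= limn_sup u.
Proof.
move=> u01 fr; rewrite limn_supE; last exact: unit_bounded.
apply/ler_addgt0Pr => e e0; rewrite -lerBlDr.
apply: lb_le_inf; first by exists (sups u 0%N), 0%N.
move=> _ [n _ <-]; have [j nj uj] := fr e n e0; apply: (le_trans uj).
by apply: ub_le_sup; [exists 1 => _ [i _ <-]; case/andP: (u01 i)|exists j => /=].
Qed.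

Lemma limit_interval_limn (u : R^nat) al be : (forall j, 0 <= u j <= 1) -> al <= be ->
  limit_interval u al be -> limn_inf u = al /\ limn_sup u = be.
Proof.
move=> u01 ab [ev fr]; split; apply/eqP; rewrite eq_le; apply/andP; split.
- apply: limn_inf_le => // e N e0; have [|j Nj uj] := fr al e N e0; first by rewrite lexx.
  by exists j => //; move: uj; rewrite ler_norml; lra.
- apply: limn_inf_ge => // e e0; have [N NP] := ev e e0.
  by exists N => j /NP/andP[].
- apply: limn_sup_le => // e e0; have [N NP] := ev e e0.
  by exists N => j /NP/andP[].
- apply: limn_sup_ge => // e N e0; have [|j Nj uj] := fr be e N e0; first by rewrite lexx ab.
  by exists j => //; move: uj; rewrite ler_norml; lra.
Qed.

Lemma subseq_near (u : R^nat) (i : nat -> nat) g : increasing_seq i ->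
  u (i l) @[l --> \oo] --> g ->
  forall e N, 0 < e -> exists2 j, (N <= j)%N & `|u j - g| <= e.
Proof.
move=> inc /cvgrPdist_le cvg e N e0; have [M _ MP] := cvg _ e0.
have idi n : (n <= i n)%N.
  elim: n => // n IH; apply: (leq_ltn_trans IH).
  by move/increasing_seqP: inc; exact.
exists (i (maxn N M)); first by apply: leq_trans (idi _); exact: leq_maxl.
by have := MP (maxn N M) (leq_maxr N M); rewrite /= distrC.
Qed.

(** For the converse direction a subsequence is chosen recursively with errors 1 / (l + 1). *)
Lemma limit_interval_subseq (u : R^nat) al be g : limit_interval u al be ->
  (exists2 i : nat -> nat, increasing_seq i & u (i l) @[l --> \oo] --> g) <->
  al <= g <= be.
Proof.
move=> [ev fr]; split=> [[i inc cvg]|gP].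
  have near_g e : 0 < e -> al - e <= g <= be + e.
    move=> e0; have e20 : 0 < e / 2 by rewrite divr_gt0.
    have [N NP] := ev _ e20.
    have [j /NP + ug] := subseq_near inc cvg N e20.
    by move: ug; rewrite ler_norml; lra.
  by apply/andP; split; apply/ler_addgt0Pr => e /near_g; lra.
(* The condition 0 < e is inside the type so that [pick] is total; for e <= 0 it returns the default
   0. *)
have pick N e : {j | 0 < e -> (N <= j)%N /\ `|u j - g| <= e}.
  apply: cid; have [e0|e0] := boolP (0 < e); last by exists 0%N.
  by have [j Nj uj] := fr g e N e0 gP; exists j.
(* Searching from [(i l').+1] on makes the sequence strictly increasing. *)
pose i := fix i l := if l is l'.+1 then sval (pick (i l').+1 (l.+1%:R^-1))
                     else sval (pick 0%N 1).
have e0 l : 0 < l.+1%:R^-1 :> R by rewrite invr_gt0.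
exists i.
  by apply/increasing_seqP => n /=; case: (pick _ _) => j /= /(_ (e0 _))[].
apply/cvgrPdist_le => e egt0.
have [M M1 Me] := inv_nat_le egt0; exists M => // l /= Ml.
rewrite distrC; apply: (@le_trans _ _ l.+1%:R^-1).
  case: l {Ml} => [|l] /=; case: (pick _ _) => j /=.
    by rewrite invr1 => /(_ ltr01)[].
  by move=> /(_ (e0 _))[].
apply: le_trans Me; rewrite lef_pV2 ?posrE ?ltr0n ?(ltn_trans _ M1)// ler_nat.
exact: leqW.
Qed.

End LimitPoints.

(** * Filtrations *)

Section Filtrations.
Variables (R : realType) (G : zmodType) (Gs : nat -> set G).
Hypothesis Gs_filtration : filtration Gs.
Let Hs i : {fset G} := fset_set (Gs i).

Lemma mem_filtration i x : (x \in Hs i) = (x \in Gs i).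
Proof. by rewrite in_fset_set//; case: Gs_filtration. Qed.

Lemma filtration_chain : chain Hs.
Proof.
have [sG finG incG covG] := Gs_filtration; split=> [n|n|x].
- have [G0 GB] := sG n; split; rewrite ?mem_filtration// => x y.
  by rewrite !mem_filtration; exact: GB.
- by apply/fsubsetP => x; rewrite !mem_filtration !inE; exact: incG.
have : x \in [set: G] by rewrite inE.
rewrite -covG inE => -[n _ xn]; exists n.
by rewrite mem_filtration inE.
Qed.

Lemma mem_sums S j x : (x \in fset_set (S `&` Gs j)) = (x \in S) && (x \in Hs j).
Proof.
rewrite in_fset_set; last by apply: finite_setIr; case: Gs_filtration.
by rewrite in_setI mem_filtration.
Qed.

Lemma density_itv S j : 0 <= density R Gs S j <= 1.
Proof.
have H0 : (0 < #|` Hs j|)%N := card_gt0 (sg0 (chain_sg filtration_chain j)).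
rewrite /density divr_ge0//= ler_pdivrMr ?ltr0n// mul1r ler_nat fsubset_leq_card//.
by apply/fsubsetP => x; rewrite mem_sums => /andP[].
Qed.

Lemma density_dens S U j : (forall x, x \in Hs j -> (x \in S) = (x \in U)) ->
  density R Gs S j = dens R Hs j U.
Proof.
move=> SU; congr (_%:R / _); congr #|` _|; apply/fsetP => x.
by rewrite mem_sums in_fsetI; case xj : (x \in Hs j); rewrite ?andbF// SU.
Qed.

(** Sweeps are iterated with errors 1 / (k + 1), starting from [good 1]. A later move does not
    change the subset sums inside an earlier [Hs n], so each density of the union is already decided
    at a finite stage. *)
Lemma sweeping_limit_interval al be good : sweeping Hs al be good ->
  exists A : set G, limit_interval (density R Gs (subset_sums A)) al be.
Proof.
move=> [good_valid [A0 good0] step]; have chG := filtration_chain.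
pose e k : R := k.+1%:R^-1.
have e_gt0 k : 0 < e k by rewrite invr_gt0.
have e_le k l : (k <= l)%N -> e l <= e k by move=> kl; rewrite lef_pV2 ?posrE// ler_nat.
(* [choice] needs a total function, so the conclusion is conditional on [good]; other states are
   sent to themselves. *)
have /choice[f fP] : forall kA : nat * state G, exists A', good (e kA.1) kA.2 ->
    [/\ reach Hs (al - 3 * e kA.1) (be + 3 * e kA.1) (3 * e kA.1) kA.2 A',
     (kA.2.1 < A'.1)%N, good (e kA.1.+1) A' &
     forall g, al <= g <= be -> exists2 j, (kA.2.1 <= j <= A'.1)%N &
       `|dens R Hs j (psums A'.2) - g| <= 3 * e kA.1].
  move=> [k A]; have [gA|ngA] := pselect (good (e k) A); last by exists A.
  by have [A' A'P] := step _ _ _ (e_gt0 k.+1) (e_le _ _ (leqnSn k)) gA; exists A'.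
pose F := fix F k := if k is k'.+1 then f (k', F k') else A0.
have goodF k : good (e k) (F k).
  elim: k => [|k /(fP (k, F k))[]] //.
  by rewrite /= /e invr1.
have FP k := fP (k, F k) (goodF k).
have nF k : ((F k).1 < (F k.+1).1)%N by have [] := FP k.
have kF k : (k <= (F k).1)%N by elim: k => // k IH; exact: leq_ltn_trans (nF k).
have nmono k l : (k <= l)%N -> ((F k).1 <= (F l).1)%N.
  move=> /subnK <-; elim: (l - k)%N => // d IH; apply: (leq_trans IH); exact: ltnW (nF _).
have smono k l : (k <= l)%N -> {subset (F k).2 <= (F l).2}.
  move=> /subnK <-; elim: (l - k)%N => // d IH x /IH; have [[_ _ sub _ _] _ _ _] := FP (d + k)%N.
  exact: sub.
have stable k l x : (k <= l)%N -> x \in Hs (F k).1 -> (x \in psums (F l).2) = (x \in psums (F k).2).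
  move=> /subnK <- xk; elim: (l - k)%N => // d IH; rewrite -{}IH addSn.
  have [[_ _ _ <- _] _ _ _] := FP (d + k)%N; rewrite in_fsetI.
  by rewrite (fsubsetP (chain_le chG (nmono _ _ (leq_addl d k))) _ xk) andbT.
pose A := [set a | exists k, a \in (F k).2].
(* A finite subset of the union is contained in one of the lists, and [stable] brings the sum back
   to stage k. *)
have sumsE k x : x \in Hs (F k).1 -> (x \in subset_sums A) = (x \in psums (F k).2).
  move=> xk; have [uk _] := good_valid _ _ (goodF k); apply/idP/idP.
    rewrite inE => -[T /= TA xE].
    have [l Tl] : exists l, {subset enum_fset T <= (F l).2}.
      have : {subset enum_fset T <= mem A} by move=> a aT; rewrite inE; exact: TA.
      elim: (enum_fset T) => [|a s IH] sA; first by exists 0%N.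
      have [|l sl] := IH; first by move=> b bs; rewrite sA// inE bs orbT.
      have : a \in A by rewrite sA// mem_head.
      rewrite inE => -[k' ak']; exists (maxn k' l) => b; rewrite inE => /predU1P[->|/sl].
        by apply: smono ak'; exact: leq_maxl.
      by apply: smono; exact: leq_maxr.
    rewrite -(stable k (maxn k l)) ?leq_maxl//.
    have [ul _] := good_valid _ _ (goodF (maxn k l)).
    apply/psumsP => //; exists T => // a /Tl; apply: smono; exact: leq_maxr.
  move=> /(psumsP _ uk)[T Tk ->]; rewrite inE; exists T => //= a aT.
  by exists k; exact: Tk.
have densE k j : (j <= (F k).1)%N ->
    density R Gs (subset_sums A) j = dens R Hs j (psums (F k).2).
  move=> jk; apply: density_dens => x xj; apply: sumsE.
  exact: fsubsetP (chain_le chG jk) _ xj.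
have small d : 0 < d -> exists K, 3 * e K <= d.
  move=> d0; have d30 : 0 < d / 3 by rewrite divr_gt0.
  have [K K1 Kd] := inv_nat_le d30; exists K; rewrite -ler_pdivlMl// mulrC.
  by apply: le_trans Kd; rewrite lef_pV2 ?posrE ?ltr0n ?(ltnW K1)// ler_nat.
exists A; split=> [d d0|g d N d0 gP].
  have [K Kd] := small d d0; exists (F K).1 => j Kj.
  (* Levels increase strictly, so consecutive stages enclose every j beyond the level of stage K. *)
  have [l Kl jl] : exists2 l, (K <= l)%N & ((F l).1 <= j <= (F l.+1).1)%N.
    have : (j <= (F (j + K)%N).1)%N := leq_trans (leq_addr K j) (kF _).
    elim: {2}j => [|m IH] jm.
      by exists K => //; rewrite Kj (leq_trans jm)// nmono.
    have [/IH//|mj] := leqP j (F (m + K)%N).1.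
    by exists (m + K)%N; rewrite ?leq_addl// (ltnW mj).
  have [[_ _ _ _ [band _]] _ _ _] := FP l.
  have := band j jl; rewrite -(densE l.+1); last by case/andP: jl.
  by have := e_le _ _ Kl; rewrite /=; lra.
have [K Kd] := small d d0; pose k := maxn K N.
have [_ _ _ /(_ g gP)[j /andP[kj jk] jg]] := FP k.
exists j; first by apply: leq_trans kj; apply: leq_trans (kF k); exact: leq_maxr.
rewrite (densE k.+1)//; apply: (le_trans jg); apply: le_trans Kd.
by rewrite ler_pM2l//; apply: e_le; exact: leq_maxl.
Qed.

End Filtrations.

(** * Torsion and the two cases for the orders of elements *)

Section Torsion.
Variables (G : zmodType).
Implicit Types (M : set G).

(** Strong induction on n: for a prime p dividing n, if the p-torsion of M is finite then pM is
    infinite, is killed by n / p, and lies in M. *)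
Lemma bounded_torsion M n : (0 < n)%N -> is_subgroup M -> infinite_set M ->
  (forall x, M x -> x *+ n = 0) ->
  exists2 p, prime p & infinite_set [set x | M x /\ x *+ p = 0].
Proof.
have [k] := ubnP n; elim: k n M => // k IH n M nk n0 sM infM Mn.
have [n1|n1] := leqP n 1%N.
  case: infM; apply: (@sub_finite_set _ _ [set 0]) => // x /Mn.
  by have -> : n = 1%N by [apply/eqP; rewrite eqn_leq n1].
pose p := pdiv n; have p_pr : prime p := pdiv_prime n1.
have [finMp|] := pselect (finite_set [set x | M x /\ x *+ p = 0]); last by exists p.
have [M0 MB] := sM.
have [|||||p' p'_pr infp'] := IH (n %/ p)%N [set x *+ p | x in M].
- rewrite -ltnS; apply: leq_trans nk; rewrite ltnS.
  by apply: ltn_Pdiv => //; exact: prime_gt1.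
- by rewrite divn_gt0 ?prime_gt0//; apply: dvdn_leq => //; exact: pdiv_dvd.
- split; first by rewrite inE; exists 0; rewrite ?mul0rn//; move: M0; rewrite inE.
  move=> u v; rewrite !inE => -[x Mx <-] [y My <-].
  exists (x - y); rewrite ?mulrnBl//.
  by move: (MB x y); rewrite !inE; exact.
(* With g a section of multiplication by p, every x is g(px) plus a p-torsion element; so M would be
   finite if pM were. *)
- move=> finpM; apply: infM; have /choice[g gP] : forall y, exists x,
      [set x *+ p | x in M] y -> M x /\ x *+ p = y.
    move=> y; have [[x Mx <-]|ny] := pselect ([set x *+ p | x in M] y).
      by exists x.
    by exists 0.
  apply: sub_finite_set (finite_image (fun yz => g yz.1 + yz.2) (finite_setX finpM finMp)).
  move=> x Mx; have [|Mg gE] := gP (x *+ p); first by exists x.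
  exists (x *+ p, x - g (x *+ p)); rewrite /= ?subrKC//; split; first by exists x.
  split; last by rewrite mulrnBl gE subrr.
  by move: (MB x (g (x *+ p))); rewrite !inE; exact.
- by move=> _ [x Mx <-]; rewrite -mulrnA mulnC divnK ?pdiv_dvd// Mn.
exists p' => //; apply: sub_infinite_set infp'.
have M00 : M 0 by move: M0; rewrite inE.
have MBE y z : M y -> M z -> M (y - z) by move: (MB y z); rewrite !inE; exact.
move=> y [[x Mx <-] yp]; split=> //.
elim: (p) => [|m IHm]; first by rewrite mulr0n.
by rewrite mulrSr -[x in _ + x]opprK -(sub0r x); exact: MBE _ _ IHm (MBE _ _ M00 Mx).
Qed.

Lemma infinite_notin M (H : {fset G}) : infinite_set M -> exists2 x, M x & x \notin H.
Proof.
move=> infM; apply: contrapT => MH; apply: infM.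
apply: (@sub_finite_set _ _ [set` H]) => // x Mx /=.
by apply/negPn/negP => xH; apply: MH; exists x.
Qed.

Variables (R : realType) (Hs : nat -> {fset G}).
Hypothesis Hs_chain : chain Hs.
Hypothesis double_infinite : infinite_set [set g *+ 2 | g in [set: G]].

(** Without long orders G has bounded exponent. [bounded_torsion] is applied to 2G rather than G: if
    the prime found is 2, the elements of order 2 are doubles, and their halves have order 4. *)
Lemma long_or_split_orders :
  (forall (H : {fset G}) r, subgroup H ->
    exists x : G, forall i, (0 < i < r)%N -> x *+ i \notin H) \/
  (exists2 q, (2 < q)%N & forall H : {fset G}, subgroup H ->
    exists2 e, e *+ q = 0 & forall i, (0 < i < q)%N -> e *+ i \notin H).
Proof.
have [|nlong] := pselect (forall (H : {fset G}) r, subgroup H ->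
    exists x : G, forall i, (0 < i < r)%N -> x *+ i \notin H); [by left|right].
have [H [r [sH short]]] : exists H r, subgroup H /\
    forall x : G, exists2 i, (0 < i < r)%N & x *+ i \in H.
  apply: contrapT => no; apply: nlong => H r sH; apply: contrapT => nox.
  apply: no; exists H, r; split=> // x; apply: contrapT => noi; apply: nox; exists x => i ir.
  by apply/negP => xi; apply: noi; exists i.
(* Some ix with 0 < i < r lies in H, and i divides r! while the order of ix divides (card H)!. *)
have kill (x : G) : x *+ (r`! * (#|` H|)`!)%N = 0.
  have [i /andP[i0 ir] xi] := short x; have [s /andP[s0 sm] xs] := torsion_fset sH xi.
  have /dvdnP[a ->] : (i %| r`!)%N by rewrite dvdn_fact// i0 ltnW.
  have /dvdnP[b ->] : (s %| (#|` H|)`!)%N by rewrite dvdn_fact// s0.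
  by rewrite mulnACA mulnC mulrnA (mulrnA x) xs mul0rn.
have [|||//|p p_pr infp] := @bounded_torsion [set g *+ 2 | g in [set: G]] (r`! * (#|` H|)`!).
- by rewrite muln_gt0 !fact_gt0.
- split; first by rewrite inE; exists 0; rewrite ?mul0rn.
  move=> u v; rewrite !inE => -[x _ <-] [y _ <-].
  by exists (x - y); rewrite ?mulrnBl.
- by [].
have [p2|p2] := eqVneq p 2%N; last first.
  exists p; first by case: p p2 p_pr {infp} => [|[|[]]].
  move=> K sK; have [e [_ ep] eK] := infinite_notin K infp.
  exists e => // i /andP[i0 ip]; apply: contra eK => eiK.
  have cop : coprime i p.
    by rewrite coprime_sym prime_coprime// gtnNdvd.
  have [u v uv _] := egcdnP p i0.
  move: cop; rewrite /coprime => /eqP cop; rewrite cop in uv.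
  have -> : e = e *+ i *+ u.
    by rewrite -mulrnA mulnC uv mulrnDr mulnC mulrnA ep mul0rn add0r.
  exact: sgMn.
exists 4%N => // K sK; rewrite p2 in infp.
(* The element outside K is 2e with 4e = 0, so e, 2e and 3e all avoid K. *)
have [_ [[e _ <-] e4] eK] := infinite_notin K infp; rewrite -mulrnA in e4.
exists e => // -[|[|[|[|]]]] //= _; apply: contra eK => //; first exact: sgMn.
(* Since 8e = 0, 2e = -6e is a multiple of 3e. *)
move=> e3; suff -> : e *+ 2 = - (e *+ 3) *+ 2 by rewrite sgMn// sgN.
rewrite mulNrn -mulrnA; apply/eqP; rewrite -addr_eq0 -mulrnDr.
by rewrite (mulrnDr e 4 4) e4 addr0.
Qed.

Lemma sweeping_exists (al be : R) : 0 <= al <= be -> be <= 1 ->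
  exists good, sweeping Hs al be good.
Proof.
move=> ab be1; have [long|[q q2 split]] := long_or_split_orders.
  by eexists; exact: sweeping_long.
by eexists; exact: (sweeping_short Hs_chain ab be1 q2 split).
Qed.

End Torsion.

(** * The case of finite 2G *)

Section Converse.
Variables (R : realType) (G : zmodType) (Gs : nat -> set G).
Implicit Types (A S : set G).

Lemma generated_is_subgroup S : is_subgroup (generated_subgroup S).
Proof.
split; first by rewrite inE => M [[M0 _] _]; move: M0; rewrite inE.
move=> x y; rewrite !inE => xS yS M MP; have [[_ MB] _] := MP.
by have := MB x y; rewrite !inE; apply; [exact: xS|exact: yS].
Qed.

(** Statements (ii) and (iii) say nothing unless a filtration exists; here the groups are generated
    by initial segments of an enumeration of G. *)
Lemma filtration_exists : countable [set: G] -> locally_finite G ->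
  exists Gs', @filtration G Gs'.
Proof.
move=> /countable_injP[f f_inj] G_lf.
exists (fun i => generated_subgroup (f @^-1` `I_i)); split=> [i|i|i|].
- exact: generated_is_subgroup.
- apply: G_lf; apply: finite_preimage => //; first by move=> x y _ _; apply: f_inj; rewrite inE.
- apply: sub_smallest2r; first exact: generated_is_subgroup.
  by move=> x /= /ltnW.
rewrite -subTset => x _; exists (f x).+1 => //.
by apply: sub_gen_smallest; rewrite /=.
Qed.

(** Modulo 2G every element is its own inverse, so differences of subset sums are again subset sums
    and P(A) + 2G contains the subgroup generated by A. *)
Lemma subset_sums_double A x : generated_subgroup A x ->
  exists2 s, subset_sums A s & exists g, x - s = g *+ 2.
Proof.
apply: (@smallest_sub _ _ _ [set x | exists2 s, subset_sums A s & exists g, x - s = g *+ 2]).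
  split.
    rewrite inE; exists 0; last by exists 0; rewrite mul0rn subr0.
    by exists fset0; rewrite ?big_seq_fset0//= => a; rewrite inE.
  move=> y z; rewrite !inE => -[_ [F /= FA <-] [g yE]] [_ [F' /= FA' <-] [g' zE]].
  have split_sum (B B' : {fset G}) : \sum_(a <- B) a =
      \sum_(a <- (B `&` B')%fset) a + \sum_(a <- (B `\` B')%fset) a :> G.
    by rewrite (big_fsetID _ (mem B')) /=; congr (_ + _);
      apply: congr_big => //; congr enum_fset; apply/fsetP => a;
      rewrite !(in_fsetI, in_fsetD, in_fset)// andbC.
  (* The symmetric difference of F and F'. *)
  pose D := ((F `\` F') `|` (F' `\` F))%fset.
  exists (\sum_(a <- D) a).
    exists D => //= a /fsetUP[]/fsetDP[aF _]; [exact: FA|exact: FA'].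
  (* The sum over F minus the sum over F' is the sum over D minus twice the sum over F' \ F. *)
  exists (g - g' - \sum_(a <- (F' `\` F)%fset) a).
  have -> : y = g *+ 2 + \sum_(a <- F) a by rewrite -yE subrK.
  have -> : z = g' *+ 2 + \sum_(a <- F') a by rewrite -zE subrK.
  rewrite (split_sum F F') (split_sum F' F) (split_sum D F) (fsetIC F').
  have -> : (D `&` F = F `\` F')%fset.
    by apply/fsetP => a; rewrite /D !(in_fsetU, in_fsetD, in_fsetI); do 2 case: (a \in _).
  have -> : (D `\` F = F' `\` F)%fset.
    by apply/fsetP => a; rewrite /D !(in_fsetU, in_fsetD, in_fsetI); do 2 case: (a \in _).
  have zmod_id (u v w c d : G) : c + (u + v) - (d + (u + w)) - (v + w) = c - d - (w + w).
    rewrite (opprD d) addrACA -[LHS]addrA; congr (_ + _).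
    by rewrite (opprD u) addrACA subrr add0r opprD addrACA subrr add0r opprD.
  by rewrite !mulrnBl zmod_id -mulr2n.
move=> a Aa; exists a; last by exists 0; rewrite subrr mul0rn.
by exists [fset a]%fset; rewrite ?big_seq_fset1//= => b /fset1P ->.
Qed.

Hypothesis Gs_filtration : filtration Gs.
Let Hs i : {fset G} := fset_set (Gs i).

Lemma density_gap A : finite_set [set g *+ 2 | g in [set: G]] ->
  (exists2 c : R, 0 < c & exists N, forall j, (N <= j)%N ->
     c <= density R Gs (subset_sums A) j) \/
  (exists N, forall j, (N <= j)%N -> density R Gs (subset_sums A) j <= 2^-1).
Proof.
move=> fin2; have chG := filtration_chain Gs_filtration.
have [genA|] := pselect (forall x, generated_subgroup A x); [left|].
  pose D := fset_set [set g *+ 2 | g in [set: G]].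
  have DE x : (x \in D) = (x \in [set g *+ 2 | g in [set: G]]) := in_fset_set fin2 x.
  have D0 : (0 < #|` D|)%N.
    by apply: (@card_gt0 _ _ 0); rewrite DE inE; exists 0; rewrite ?mul0rn.
  exists (#|` D|%:R^-1); first by rewrite invr_gt0 ltr0n.
  (* Once [Hs j] contains 2G, the summand s of an x in [Hs j] also lies in [Hs j], so the covering
     by translates of P(A) restricts to it. *)
  have [N _ DN] := chain_sub chG D 0; exists N => j Nj.
  rewrite /density ler_pdivlMr; last by rewrite (card_chain_gt0 R chG).
  rewrite mulrC ler_pdivrMr ?ltr0n// -natrM ler_nat.
  set P := fset_set (_ `&` _).
  apply: leq_trans (card_sumset_le P D); apply: fsubset_leq_card.
  apply/fsubsetP => x xj; have [s sA [g xs]] := subset_sums_double (genA x).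
  have xsD : x - s \in D by rewrite DE inE xs; exists g.
  rewrite -(subrK s x) addrC; apply: mem_sumset => //.
  rewrite mem_sums// mem_set//= -[s](subKr x); apply: sgB => //; first exact: chain_sg chG _.
  exact: fsubsetP (chain_le chG Nj) _ (fsubsetP DN _ xsD).
move=> /existsNP[x xA]; right; have [_ _ /(_ x)[N xN]] := chG.
exists N => j Nj; have xj := fsubsetP (chain_le chG Nj) _ xN.
have H0 := card_chain_gt0 R chG j.
rewrite /density ler_pdivrMr// ler_pdivlMl// -natrM ler_nat mul2n -addnn.
set P := fset_set _; have PE y : (y \in P) = (y \in subset_sums A) && (y \in Hs j).
  exact: mem_sums.
have [g0 gB] := generated_is_subgroup A.
have Pgen y : y \in P -> y \in generated_subgroup A.
  rewrite PE => /andP[+ _]; rewrite inE => -[F /= FA <-].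
  rewrite big_seq; elim/big_ind: _ => // [u v uA vA|a aF].
    by rewrite -[v]opprK -(sub0r v); exact: gB uA (gB _ _ g0 vA).
  by rewrite inE; apply: sub_gen_smallest; exact: FA.
(* With x outside the generated subgroup but in [Hs j], P and x + P are disjoint subsets of [Hs j]
   of equal size. *)
have dis : (sumset [fset x] P `&` P = fset0)%fset.
  apply/eqP; rewrite -fsubset0; apply/fsubsetP => y /fsetIP[+ yP].
  rewrite mem_sumset1 => yxP; exfalso; apply: xA.
  by have := gB _ _ (Pgen _ yP) (Pgen _ yxP); rewrite subKr inE.
have := cardfsUI (sumset [fset x]%fset P) P.
rewrite dis cardfs0 addn0 card_sumset1 => <-; apply: fsubset_leq_card.
rewrite fsubUset; apply/andP; split; apply/fsubsetP => y.
  rewrite mem_sumset1 PE => /andP[_ yxj]; rewrite -(subrK x y).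
  by apply: sgD => //; exact: chain_sg chG _.
by rewrite PE => /andP[].
Qed.

End Converse.

Theorem corollary1p5 (R : realType) (G : zmodType)
    (G_countable : countable [set: G]) (G_locally_finite : locally_finite G) :
  [<-> infinite_set [set g *+ 2 | g in [set: G]];
       forall Gs : nat -> set G, filtration Gs ->
         forall alpha beta : R, 0 <= alpha <= beta -> beta <= 1 ->
           exists A : set G,
             lower_density R Gs (subset_sums A) = alpha /\
             upper_density R Gs (subset_sums A) = beta;
       forall Gs : nat -> set G, filtration Gs ->
         forall alpha beta : R, 0 <= alpha <= beta -> beta <= 1 ->
           exists A : set G,
             limit_densities R Gs A = `[alpha, beta]%classic].
Proof.
have main : infinite_set [set g *+ 2 | g in [set: G]] -> forall Gs, filtration Gs ->
    forall alpha beta : R, 0 <= alpha <= beta -> beta <= 1 -> exists A : set G,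
    limit_interval (density R Gs (subset_sums A)) alpha beta.
  move=> inf Gs fil al be ab be1; have chG := filtration_chain fil.
  have [good swp] := sweeping_exists chG inf ab be1.
  exact: sweeping_limit_interval fil _ _ _ swp.
have [Gs0 fil0] := filtration_exists G_countable G_locally_finite.
have unit0 : 0 <= (0 : R) <= 1 by rewrite lexx ler01.
tfae.
- move=> inf Gs fil al be ab be1; have [A accA] := main inf Gs fil al be ab be1.
  exists A; have [_ alb] := andP ab.
  by apply: limit_interval_limn accA => // j; exact: density_itv.
(* The implication from (ii) to (iii) passes through (i): (ii) for alpha = 0 and beta = 1
   contradicts [density_gap] when 2G is finite. *)
- move=> dens2; have inf : infinite_set [set g *+ 2 | g in [set: G]].
    move=> fin; have [A [low up]] := dens2 Gs0 fil0 0 1 unit0 (lexx 1).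
    have d01 := density_itv R fil0 (subset_sums A).
    have [[c c0 [N cP]]|[N hP]] := density_gap R fil0 A fin.
      have : c <= lower_density R Gs0 (subset_sums A).
        apply: limn_inf_ge => // e e0; exists N => j /cP; lra.
      by rewrite low; lra.
    have : upper_density R Gs0 (subset_sums A) <= 2^-1.
      apply: limn_sup_le => // e e0; exists N => j /hP; lra.
    by rewrite up; lra.
  move=> Gs fil al be ab be1; have [A accA] := main inf Gs fil al be ab be1.
  exists A; apply/seteqP; split=> g /=; rewrite in_itv /=.
    by move=> [_ /(limit_interval_subseq g accA)].
  move=> gP; split; last exact/(limit_interval_subseq g accA).
  by move: ab gP be1; lra.
- move=> dens3 fin; have [A AE] := dens3 Gs0 fil0 0 1 unit0 (lexx 1).
  have near_point (g : R) : 0 <= g <= 1 -> forall e N, 0 < e ->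
      exists2 j, (N <= j)%N & `|density R Gs0 (subset_sums A) j - g| <= e.
    move=> gP; have : limit_densities R Gs0 A g by rewrite AE /= in_itv.
    by move=> [_ [i inc ucvg]]; exact: (subseq_near inc ucvg).
  have [[c c0 [N cP]]|[N hP]] := density_gap R fil0 A fin.
    have c2 : 0 < c / 2 by rewrite divr_gt0.
    by have [j /cP + ] := near_point 0 unit0 _ N c2; rewrite ler_norml; lra.
  (* A density within 1 / 4 of 1 exceeds the bound 1 / 2. *)
  have c2 : 0 < 4^-1 :> R by rewrite invr_gt0.
  have [|j /hP + ] := near_point 1 _ _ N c2; first by rewrite lexx ler01.
  by rewrite ler_norml; lra.
Qed.
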